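(* Let $(G,\sigma)$ be a 2-edge-connected cubic signed graph. If $(G,\sigma)$ is flow-admissible, then $\mathrm{scc}(G,\sigma)\le \frac{26}{9}|E(G)|$.
   Context: A signed graph $(G,\sigma)$ is a graph $G$ with a map $\sigma:E(G)\to\{-1,+1\}$; an edge $e$ is positive if $\sigma(e)=1$ and negative if $\sigma(e)=-1$. A cycle is a connected 2-regular subgraph; it is positive if it contains an even number of negative edges and negative otherwise. A barbell is a pair of edge-disjoint negative cycles joined by a path (possibly of length zero, i.e. the cycles may share a vertex). A circuit of $(G,\sigma)$ is a positive cycle or a barbell. A circuit cover is a family of circuits whose union contains every edge of $G$; its length is $\sum_{C}|E(C)|$ over the circuits of the family (counted with multiplicity). $\mathrm{scc}(G,\sigma)$ is the minimum length of a circuit cover of $(G,\sigma)$. Flows on signed graphs: each edge is split into two half-edges, each given a direction (toward or away from its end vertex), such that for a positive edge one half-edge points toward its end and the other away, while for a negative edge both half-edges point toward their ends or both point away. An integer flow is a map $f:E(G)\to\mathbb{Z}$ such that at every vertex the sum of $f$ over incident half-edges directed into the vertex equals the sum over incident half-edges directed out of it. $(G,\sigma)$ is flow-admissible if it admits a nowhere-zero integer flow (i.e. $f(e)\neq 0$ for all $e$). *)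

(* Defs.v *)
From HB Require Import structures.
From mathcomp Require Import all_boot all_order all_algebra.

Set Implicit Arguments.
Unset Strict Implicit.
Unset Printing Implicit Defensive.

(* Finite graphs with parallel edges and loops allowed.  An edge e consists of
   the two half-edges (e, false) and (e, true), and [endpoint e b] is the end
   vertex of the half-edge (e, b). *)
Record graph := Graph {
  vertex : finType;
  edge : finType;
  endpoint : edge -> bool -> vertex
}.

(* A signature sigma : E(G) -> {-1, +1}, encoded by the predicate "e is
   negative": the sign of e is (-1) ^+ sigma e. *)
Definition signature (G : graph) := edge G -> bool.

Section Graphs.
Variable G : graph.

Definition joins (e : edge G) (x y : vertex G) : bool :=
  ((endpoint e false == x) && (endpoint e true == y)) ||
  ((endpoint e false == y) && (endpoint e true == x)).

Record subgraph := Subgraph {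
  vset : {set vertex G};
  eset : {set edge G};
  subgraphP : forall e, e \in eset -> forall b, endpoint e b \in vset
}.

(* Counts half-edges, so a loop contributes 2. *)
Definition sdegree (H : subgraph) (v : vertex G) : nat :=
  #|[set h : edge G * bool | (h.1 \in eset H) && (endpoint h.1 h.2 == v)]|.

Definition regular (d : nat) (H : subgraph) : Prop :=
  forall v, v \in vset H -> sdegree H v = d.

Definition adjacent (H : subgraph) : rel (vertex G) :=
  fun x y => [exists e in eset H, joins e x y].

Definition connected (H : subgraph) : Prop :=
  vset H != set0 /\
  forall x y, x \in vset H -> y \in vset H -> connect (adjacent H) x y.

Definition spanning (A : {set edge G}) : subgraph :=
  @Subgraph [set: vertex G] A (fun _ _ _ => in_setT _).

Definition cubic : Prop := regular 3 (spanning [set: edge G]).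

Definition two_edge_connected : Prop :=
  [/\ 1 < #|vertex G|,
      connected (spanning [set: edge G]) &
      forall e : edge G, connected (spanning [set~ e])].

Definition is_cycle (C : subgraph) : Prop := connected C /\ regular 2 C.

(* [walk x p]: the pairs (e, v) of p successively lead, starting at x, along
   the edge e to the vertex v. *)
Fixpoint walk (x : vertex G) (p : seq (edge G * vertex G)) : bool :=
  if p is (e, v) :: p' then joins e x v && walk v p' else true.

(* P is a path with ends x and y; P has length zero when x = y. *)
Definition is_path (x y : vertex G) (P : subgraph) : Prop :=
  exists p : seq (edge G * vertex G),
    [/\ walk x p, uniq (x :: unzip2 p), last x (unzip2 p) = y,
        vset P = [set v in x :: unzip2 p] & eset P = [set e in unzip1 p]].

Section Signed.
Variable sigma : signature G.

Definition positive_cycle (C : subgraph) : Prop :=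
  is_cycle C /\ ~~ odd #|[set e in eset C | sigma e]|.

Definition negative_cycle (C : subgraph) : Prop :=
  is_cycle C /\ odd #|[set e in eset C | sigma e]|.

(* The connecting path P meets each of the two cycles exactly in one of its
   ends, and the cycles have no common vertex outside P: they are disjoint if P
   has positive length, and share exactly one vertex if P has length zero. *)
Definition barbell (B : subgraph) : Prop :=
  exists (C1 C2 P : subgraph) (x y : vertex G),
    [/\ [/\ negative_cycle C1, negative_cycle C2 &
            [disjoint eset C1 & eset C2]],
        is_path x y P,
        [/\ vset C1 :&: vset P = [set x], vset C2 :&: vset P = [set y] &
            vset C1 :&: vset C2 \subset vset P],
        vset B = vset C1 :|: vset C2 :|: vset P &
        eset B = eset C1 :|: eset C2 :|: eset P].

Definition circuit (H : subgraph) : Prop := positive_cycle H \/ barbell H.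

(* Families are indexed, hence may contain repetitions. *)
Definition circuit_cover (k : nat) (F : 'I_k -> subgraph) : Prop :=
  (forall i, circuit (F i)) /\ \bigcup_i eset (F i) = [set: edge G].

Definition family_length (k : nat) (F : 'I_k -> subgraph) : nat :=
  \sum_i #|eset (F i)|.

(* scc(G, sigma) = n.  A relation, because the minimum does not exist when
   (G, sigma) has no circuit cover. *)
Definition is_scc (n : nat) : Prop :=
  (exists k (F : 'I_k -> subgraph), circuit_cover F /\ family_length F = n) /\
  (forall k (F : 'I_k -> subgraph), circuit_cover F -> n <= family_length F).

(* [toward e b]: the half-edge (e, b) is directed toward its end vertex. *)
Definition bidirection (toward : edge G -> bool -> bool) : Prop :=
  forall e, (toward e false == toward e true) = sigma e.

Definition integer_flow (toward : edge G -> bool -> bool) (f : edge G -> int) :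
    Prop :=
  forall v : vertex G,
    (\sum_(h : edge G * bool | (endpoint h.1 h.2 == v) && toward h.1 h.2)
        f h.1 =
     \sum_(h : edge G * bool | (endpoint h.1 h.2 == v) && ~~ toward h.1 h.2)
        f h.1)%R.

Definition flow_admissible : Prop :=
  exists (toward : edge G -> bool -> bool) (f : edge G -> int),
    [/\ bidirection toward, integer_flow toward f & forall e, f e != 0%R].

End Signed.
End Graphs.

(* Main.v *)
(* Switch so that the set N of negative edges is as small as possible; since the graph
   has a nowhere-zero flow, |N| <> 1.  At most half of the edges of a cut lie in N, so
   every bridge of G - N forms a 2-edge-cut with an edge of N and hence lies in each
   even edge set containing N.  By Seymour's 6-flow theorem the other edges of G - N
   are covered by cycles, all positive, of total length at most 5/3 of their number.

   Let J be a smallest set of edges of G - N making S = N + J even.  Averaging over the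
   6-flow bounds |J|, and S is a disjoint union of cycles.  Its negative cycles are
   joined in pairs to barbells along a T-join of at most half of the edges.  If their
   number is odd and at least 3, one of them is used twice: two of them are close since
   balls of suitable radii around three of them cannot be disjoint.

   If S has a single negative cycle D, then D and a disjoint negative cycle form a
   barbell, or else the signature can be switched to be positive outside D.  In the
   latter case every path outside D between two vertices of D forms a positive cycle
   with one of the two arcs of D.  Either three vertices attached to one component
   outside D give three such arcs any two of which cover D, and a closed walk through
   that component bounds the three paths, or arcs from distinct components cover D
   and their paths are disjoint. *)

(* The constant splits as 26/9 = 5/3 + 11/9. An edge of G - N covered by the even sets costs 5/3.
   Covering S may cost 5/3 for each edge of N and each bridge of G - N, plus 11/6 per vertex, which
   is 11/9 per edge of a cubic graph.

   Two cases need the full 11/6. For an odd number of negative cycles, S and the T-join cost 3/2 per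
   vertex and the cycle used twice costs 1/3. For a single cycle D, the ears cost 4/3 per vertex; as
   |S| is only bounded by about 3/4 |V|, the other cycles of S must cost 2/3 per edge instead of 1
   to fit into the remaining 1/2. This forces the closed walk to run around these cycles rather than
   past them. Additive constants are absorbed since |N| is at least 2 whenever the number of
   negative cycles is odd.

   In a cubic graph edge-disjoint even sets are vertex-disjoint unions of cycles, so cycles and arcs
   can be identified by parity arguments alone. Contraction and deletion redirect the ends of edges,
   so that all constructions keep the same vertex and edge types. *)
Require Import Defs.
From mathcomp Require Import all_boot all_order all_algebra.
From mathcomp Require Import zify lra.
From Stdlib Require Import Classical_Prop.

Set Implicit Arguments.
Unset Strict Implicit.
Unset Printing Implicit Defensive.

Import Order.TTheory GRing.Theory Num.Theory.

(** * Even edge sets and walks *)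

Section XorSums.
Variable T : finType.
Implicit Types (A B C : {set T}) (P : T -> bool).

Definition symd A B := (A :\: B) :|: (B :\: A).

Lemma in_symd A B e : (e \in symd A B) = (e \in A) (+) (e \in B).
Proof. by rewrite !inE; case: (e \in A); case: (e \in B). Qed.

Lemma symd_sub A B C : A \subset C -> B \subset C -> symd A B \subset C.
Proof.
move=> sA sB; apply/subsetP=> e; rewrite in_symd.
by case eA: (e \in A); case eB: (e \in B) => // _;
  [apply: (subsetP sA) | apply: (subsetP sB)].
Qed.

Lemma symd_disj A B : [disjoint A & B] -> symd A B = A :|: B.
Proof.
move=> /pred0P dAB; apply/setP=> e; rewrite in_symd inE.
by have := dAB e; rewrite /= => /andP; case: (e \in A); case: (e \in B) => // -[].
Qed.

Lemma symd_setD A B : B \subset A -> symd A B = A :\: B.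
Proof.
move=> /subsetP sBA; apply/setP=> e; rewrite in_symd inE.
by case eB: (e \in B); [rewrite (sBA e eB) | rewrite addbF].
Qed.

Lemma card_symd A B : #|symd A B| + 2 * #|A :&: B| = #|A| + #|B|.
Proof.
have d : [disjoint A :\: B & B :\: A].
  by apply/pred0P=> e /=; rewrite !inE; case: (e \in A); case: (e \in B).
rewrite /symd cardsU (disjoint_setI0 d) cards0 subn0.
have := cardsID B A; have := cardsID A B; rewrite (setIC B A); lia.
Qed.

(** Degree parities, signs and intersections with cuts are all instances of this sum over GF(2); it
    is additive in both arguments. *)
Definition xsum P A : bool := \big[addb/false]_(e in A) P e.

Lemma xsum_symd P A B : xsum P (symd A B) = xsum P A (+) xsum P B.
Proof.
rewrite /xsum !(big_mkcond (fun e => e \in _)) -big_split; apply: eq_bigr => e _ /=.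
by rewrite in_symd; case: (e \in A); case: (e \in B); case: (P e).
Qed.

Lemma xsum0 P : xsum P set0 = false.
Proof. by rewrite /xsum big_set0. Qed.

Lemma xsum1 P e : xsum P [set e] = P e.
Proof. by rewrite /xsum big_set1. Qed.

Lemma eq_xsum P P' A : {in A, P =1 P'} -> xsum P A = xsum P' A.
Proof. by move=> eP; apply: eq_bigr => e /eP. Qed.

Lemma xsumF P A : {in A, forall e, P e = false} -> xsum P A = false.
Proof. by move=> eP; rewrite /xsum big1. Qed.

Lemma xsum_addb P P' A : xsum (fun e => P e (+) P' e) A = xsum P A (+) xsum P' A.
Proof. by rewrite /xsum -big_split. Qed.

Lemma xsum_odd P A : xsum P A = odd #|[set e in A | P e]|.
Proof.
rewrite -sum1_card (big_morph odd oddD (erefl _)) /xsum.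
rewrite [LHS]big_mkcond [RHS]big_mkcond; apply: eq_bigr => e _ /=.
by rewrite inE; case: (e \in A); case: (P e).
Qed.

Lemma xsum_eq (a : T) X : xsum (eq_op a) X = (a \in X).
Proof.
rewrite xsum_odd; case aX: (a \in X).
  rewrite (_ : [set e in X | a == e] = [set a]) ?cards1 //.
  by apply/setP=> e; rewrite !inE eq_sym; case: eqP => [->|]; rewrite ?aX ?andbF.
rewrite (_ : [set e in X | a == e] = set0) ?cards0 //.
by apply/setP=> e; rewrite !inE; case: eqP => [<-|]; rewrite ?aX ?andbF.
Qed.

End XorSums.

Section Basics.
Variable G : graph.
Notation E := (edge G).
Notation V := (vertex G).
Implicit Types (A B C : {set E}) (X Y : {set V}) (e : E) (x y z v : V)
  (p q : seq (E * V)).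

(** A loop has incidence [false], so edges turned into loops by contraction or deletion do not
    affect parities. *)
Definition inc v e : bool := (endpoint e false == v) (+) (endpoint e true == v).
Definition odeg A v : bool := xsum (inc v) A.
Definition evenset A : Prop := forall v, odeg A v = false.
Definition cut X : {set E} :=
  [set e | (endpoint e false \in X) (+) (endpoint e true \in X)].

Lemma odeg_symd A B v : odeg (symd A B) v = odeg A v (+) odeg B v.
Proof. exact: xsum_symd. Qed.

Lemma even_symd A B : evenset A -> evenset B -> evenset (symd A B).
Proof. by move=> eA eB v; rewrite odeg_symd eA eB. Qed.

Lemma even0 : evenset set0.
Proof. by move=> v; apply: xsum0. Qed.

(** Each edge of [A] is counted once for every end in [X]; modulo 2 only the edges leaving [X]
    survive. *)
Lemma handshake A X : xsum (odeg A) X = xsum (mem (cut X)) A.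
Proof.
rewrite /xsum /odeg /xsum exchange_big; apply: eq_bigr => e _ /=.
have := xsum_addb (eq_op (endpoint e false)) (eq_op (endpoint e true)) X.
by rewrite !xsum_eq /xsum /= inE.
Qed.

Lemma even_cut A X : evenset A -> ~~ odd #|A :&: cut X|.
Proof.
move=> eA; have := handshake A X; rewrite xsumF => [|v _]; last exact: eA.
rewrite xsum_odd => h.
by rewrite (_ : A :&: cut X = [set e in A | e \in cut X]) -?h //; apply/setP=> e; rewrite !inE.
Qed.

Lemma joinsC e x y : joins e x y = joins e y x.
Proof. by rewrite /joins orbC. Qed.

Lemma joins_ends e : joins e (endpoint e false) (endpoint e true).
Proof. by rewrite /joins !eqxx. Qed.

Lemma joins_endpoint e b : joins e (endpoint e b) (endpoint e (~~ b)).
Proof. by case: b; rewrite /joins !eqxx ?orbT. Qed.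

Lemma joins_inc e x y v : joins e x y -> inc v e = (x == v) (+) (y == v).
Proof.
by case/orP=> /andP[/eqP h1 /eqP h2]; rewrite /inc h1 h2 // addbC.
Qed.

Lemma joins_cut e x y X : joins e x y -> (e \in cut X) = (x \in X) (+) (y \in X).
Proof.
by case/orP=> /andP[/eqP h1 /eqP h2]; rewrite /cut inE h1 h2 // addbC.
Qed.

Lemma joins_end e x y : joins e x y -> exists b, endpoint e b = x /\ endpoint e (~~ b) = y.
Proof.
by case/orP=> /andP[/eqP h1 /eqP h2]; [exists false | exists true].
Qed.

Definition adj A := adjacent (spanning A).

Lemma adjP A x y : reflect (exists2 e, e \in A & joins e x y) (adj A x y).
Proof. exact: exists_inP. Qed.

Lemma adjC A : symmetric (adj A).
Proof.
by move=> x y; apply/adjP/adjP=> -[e eA j]; exists e => //; rewrite joinsC.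
Qed.

Lemma conn_sym A x y : connect (adj A) x y = connect (adj A) y x.
Proof. exact: (sym_connect_sym (adjC A) x y). Qed.

Lemma adj_sub A B : A \subset B -> subrel (adj A) (adj B).
Proof. by move=> /subsetP s x y /adjP[e /s eB j]; apply/adjP; exists e. Qed.

Lemma conn_sub A B x y : A \subset B -> connect (adj A) x y -> connect (adj B) x y.
Proof.
by move=> s; apply: connect_sub => u w a; apply: connect1; apply: adj_sub a.
Qed.

Lemma conn_ends A e : e \in A -> connect (adj A) (endpoint e false) (endpoint e true).
Proof. by move=> eA; apply/connect1/adjP; exists e => //; apply: joins_ends. Qed.

Lemma conn_end A e b b' : e \in A -> connect (adj A) (endpoint e b) (endpoint e b').
Proof.
move=> eA; have h := conn_ends eA.
by case: b; case: b'; rewrite ?connect0 // conn_sym.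
Qed.

Definition vtx x p := x :: unzip2 p.
Definition wend x p := last x (unzip2 p).

Lemma walk_cat x p q : walk x (p ++ q) = walk x p && walk (wend x p) q.
Proof. by elim: p x => //= -[e y] p IH x; rewrite IH andbA. Qed.

Lemma wend_cat x p q : wend x (p ++ q) = wend (wend x p) q.
Proof. by rewrite /wend /unzip2 map_cat last_cat. Qed.

Lemma wend_in x p : wend x p \in vtx x p.
Proof. exact: mem_last. Qed.

Lemma mem_vtx_cat x p q z :
  (z \in vtx x (p ++ q)) = (z \in vtx x p) || (z \in unzip2 q).
Proof. by rewrite /vtx /unzip2 map_cat !inE mem_cat orbA. Qed.

Lemma vtx_split x p y : y \in vtx x p ->
  exists p1 p2, p = p1 ++ p2 /\ wend x p1 = y.
Proof.
elim: p x => [|[e z] p IH] x; rewrite /vtx /= inE; first by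
  move/eqP->; exists [::], [::].
case/orP=> [/eqP->|/IH[p1 [p2 [-> h]]]]; first by exists [::], ((e, z) :: p).
by exists ((e, z) :: p1), p2.
Qed.

Lemma walk_conn A x p : walk x p -> {subset unzip1 p <= A} ->
  forall y, y \in vtx x p -> connect (adj A) x y.
Proof.
elim: p x => [|[e z] p IH] x /=.
  by move=> _ _ y; rewrite inE => /eqP->.
case/andP=> j w s y; rewrite inE => /orP[/eqP->|yp]; first exact: connect0.
apply: (connect_trans (connect1 _) (IH z w _ y yp)).
  by apply/adjP; exists e => //; apply: s; rewrite mem_head.
by move=> f fp; apply: s; rewrite inE fp orbT.
Qed.

Lemma conn_walk A x y : connect (adj A) x y ->
  exists p, [/\ walk x p, {subset unzip1 p <= A} & wend x p = y].
Proof.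
case/connectP=> s; elim: s x => [|z s IH] x /=.
  by move=> _ ->; exists [::].
case/andP=> /adjP[e eA j] ps ly; have [p [w sp wy]] := IH z ps ly.
exists ((e, z) :: p); split=> //=; first by rewrite j.
by move=> f; rewrite inE => /orP[/eqP->//|/sp].
Qed.

Lemma walk_ends x p e b : walk x p -> e \in unzip1 p -> endpoint e b \in vtx x p.
Proof.
elim: p x => [|[f z] p IH] x //= /andP[j w].
rewrite inE => /orP[/eqP->|ep]; last by rewrite inE IH ?orbT.
by case/orP: j {IH} => /andP[/eqP h1 /eqP h2]; case: b; rewrite ?h1 ?h2 !inE eqxx ?orbT.
Qed.

Lemma walk_rev x p : walk x p ->
  exists q, [/\ walk (wend x p) q, wend (wend x p) q = x, unzip1 q = rev (unzip1 p),
    vtx (wend x p) q = rev (vtx x p) & size q = size p].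
Proof.
elim: p x => [|[e z] p IH] x /=; first by exists [::].
case/andP=> j /IH[q [w wq u1 u2 sq]].
exists (q ++ [:: (e, x)]); split.
- by rewrite walk_cat w wq /= joinsC j.
- by rewrite /wend /= /unzip2 map_cat last_cat.
- by rewrite /unzip1 map_cat -[map _ q]/(unzip1 q) u1 rev_cons cats1.
- have -> : vtx x ((e, z) :: p) = x :: vtx z p by [].
  rewrite rev_cons -u2 /vtx /unzip2 map_cat /= -cats1 //.
by rewrite size_cat sq addn1.
Qed.

Lemma uniq_vtx_edges x p : walk x p -> uniq (vtx x p) -> uniq (unzip1 p).
Proof.
elim: p x => [|[e z] p IH] x //= /andP[j w] /andP[nx u].
rewrite (IH z) // andbT; apply/negP=> ep.
case/joins_end: j => b [h1 h2].
by have := walk_ends b w ep; rewrite h1 => hx; case/negP: nx.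
Qed.

Definition eset_of p : {set E} := [set e in unzip1 p].

Lemma card_eset_of p : uniq (unzip1 p) -> #|eset_of p| = size p.
Proof. by move=> u; rewrite cardsE (card_uniqP u) size_map. Qed.

Lemma card_eset_of_le p : #|eset_of p| <= size p.
Proof. by rewrite cardsE (leq_trans (card_size _)) // size_map. Qed.

Lemma xsum_eset_of P p : uniq (unzip1 p) ->
  xsum P (eset_of p) = \big[addb/false]_(e <- unzip1 p) P e.
Proof. by move=> u; rewrite big_uniq //; apply: eq_bigl => e; rewrite inE. Qed.

Lemma odeg_eset_of x p v : walk x p -> uniq (unzip1 p) ->
  odeg (eset_of p) v = (x == v) (+) (wend x p == v).
Proof.
move=> w u; rewrite /odeg xsum_eset_of //; elim: p x w {u} => [|[e z] p IH] x /=.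
  by rewrite big_nil addbb.
case/andP=> j w; rewrite big_cons (IH _ w) (joins_inc _ j) /wend /=.
by case: (x == v); case: (z == v); case: (_ == v).
Qed.

(** Three reductions shorten a walk and keep its ends in [X] and [Y]: cut out a closed subwalk, drop
    everything before a later vertex of [X], drop everything after an earlier vertex of [Y]. This
    provides the connecting paths of barbells and the ears. *)
Lemma minwalk A X Y x p : walk x p -> {subset unzip1 p <= A} -> x \in X -> wend x p \in Y ->
  exists x' p', [/\ walk x' p', {subset unzip1 p' <= A}, x' \in X, wend x' p' \in Y &
   [/\ uniq (vtx x' p'), size p' <= size p,
      (forall z, z \in vtx x' p' -> z \in X -> z = x') &
      (forall z, z \in vtx x' p' -> z \in Y -> z = wend x' p')]].
Proof.
have [n] := ubnP (size p); elim: n x p => // n IH x p lpn w s xX yY.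
have ssub q : size q < size p -> forall x0, walk x0 q -> {subset unzip1 q <= A} ->
    x0 \in X -> wend x0 q \in Y ->
  exists x' p', [/\ walk x' p', {subset unzip1 p' <= A}, x' \in X, wend x' p' \in Y &
   [/\ uniq (vtx x' p'), size p' <= size p,
      (forall z, z \in vtx x' p' -> z \in X -> z = x') &
      (forall z, z \in vtx x' p' -> z \in Y -> z = wend x' p')]].
  move=> lq x0 wq sq xq yq.
  have [|x' [p' [h1 h2 h3 h4 [h5 h6 h7 h8]]]] := IH x0 q _ wq sq xq yq; first lia.
  by exists x', p'; split=> //; split=> //; apply: leq_trans h6 (ltnW lq).
case uP: (uniq (vtx x p)); last first.
  have [y [p1 [p2 [p3 [ep n2 e1 e2]]]]] : exists y p1 p2 p3,
     [/\ p = p1 ++ p2 ++ p3, p2 <> [::], wend x p1 = y & wend y p2 = y].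
    elim: (p) (x) uP => [|[e z] q IHq] x0 //=.
    case hx: (x0 \in vtx z q) => /=.
      move=> _; have [q1 [q2 [-> ey]]] := vtx_split hx.
      by exists x0, [::], ((e, z) :: q1), q2; split.
    move=> /IHq[y [p1 [p2 [p3 [-> n2 e1 e2]]]]].
    by exists y, ((e, z) :: p1), p2, p3.
  have sz : size (p1 ++ p3) < size p.
    by rewrite ep !size_cat; case: (p2) n2 => //= a b _; lia.
  have := w; rewrite {1}ep !walk_cat e1 e2 => /and3P[w1 w2 w3].
  apply: (ssub _ sz x) => //.
  - by rewrite walk_cat w1 e1.
  - move=> f; rewrite /unzip1 map_cat mem_cat => h; apply: s.
    by rewrite ep /unzip1 !map_cat !mem_cat; case/orP: h => ->; rewrite ?orbT.
  - by move: yY; rewrite ep !wend_cat e1 e2.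
case hX: (has (mem X) (unzip2 p)).
  case/hasP: hX => z zp zX.
  have zv : z \in vtx x p by rewrite inE zp orbT.
  have [p1 [p2 [ep e1]]] := vtx_split zv.
  have sz : size p2 < size p.
    rewrite ep size_cat; case: p1 ep e1 => [|a p1] ep e1 /=; last lia.
    by move: uP; rewrite /vtx /= (_ : x = z) ?zp.
  have := w; rewrite {1}ep walk_cat e1 => /andP[_ w2].
  apply: (ssub _ sz z) => // [f fp|]; last by move: yY; rewrite ep wend_cat e1.
  by apply: s; rewrite ep /unzip1 map_cat mem_cat [f \in map _ p2]fp orbT.
case hY: (has (mem Y) (belast x (unzip2 p))).
  case/hasP: hY => z zp zY.
  have zv : z \in vtx x p by apply: mem_belast.
  have [p1 [p2 [ep e1]]] := vtx_split zv.
  have sz : size p1 < size p.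
    rewrite ep size_cat; case: p2 ep => [|a p2] ep /=; last lia.
    have : uniq (vtx x p) by [].
    rewrite /vtx lastI rcons_uniq => /andP[h _]; case/negP: h.
    by rewrite -[last _ _]/(wend x p) {1}ep cats0 e1.
  have := w; rewrite {1}ep walk_cat => /andP[w1 _].
  apply: (ssub _ sz x) => //; last by rewrite e1.
  move=> f fp; apply: s; by rewrite ep /unzip1 map_cat mem_cat [f \in map _ p1]fp.
exists x, p; split=> //; split=> // z.
  rewrite inE => /orP[/eqP //|zp] zX; case/hasP: hX; by exists z.
rewrite /vtx lastI mem_rcons inE => /orP[/eqP //|zp] zY; case/hasP: hY; by exists z.
Qed.

Lemma conn_path A x y : connect (adj A) x y ->
  exists p, [/\ walk x p, {subset unzip1 p <= A}, wend x p = y & uniq (vtx x p)].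
Proof.
case/conn_walk=> p [w s e].
have [||x' [p' [h1 h2 h3 h4 [h5 h6 h7 h8]]]] := @minwalk A [set x] [set y] x p w s.
- by rewrite inE.
- by rewrite inE e.
by exists p'; move: h3 h4; rewrite !inE => /eqP ex /eqP ey; subst x'; split.
Qed.

Lemma conn_join A x y : connect (adj A) x y ->
  exists B, B \subset A /\ forall v, odeg B v = (x == v) (+) (y == v).
Proof.
case/conn_path=> p [w s e u]; exists (eset_of p); split.
  by apply/subsetP=> f; rewrite inE => /s.
by move=> v; rewrite (odeg_eset_of _ w (uniq_vtx_edges w u)) e.
Qed.

Definition cc A x : {set V} := [set y | connect (adj A) x y].

Lemma cut_cc A x : A :&: cut (cc A x) = set0.
Proof.
apply/setP=> e; rewrite !inE; apply/negP=> /andP[eA].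
have h := conn_ends eA.
case c1: (connect _ x (endpoint e false)); case c2: (connect _ x _) => //= _.
  by rewrite (connect_trans c1 h) in c2.
by rewrite (connect_trans c2) // conn_sym // in c1.
Qed.

(** No edge of [A] leaves the component of [x], so by [handshake] this component has an even number
    of odd vertices. *)
Lemma odd_mate A x : odeg A x ->
  exists y, [/\ y != x, odeg A y & connect (adj A) x y].
Proof.
move=> ox; have h := handshake A (cc A x).
have h0 : xsum (mem (cut (cc A x))) A = false.
  apply: xsumF => e eA; apply/negP=> ec.
  have : e \in A :&: cut (cc A x) by rewrite in_setI eA.
  by rewrite cut_cc inE.
move: h; rewrite h0 xsum_odd.
set Z := [set _ in _ | _] => oz.
have xZ : x \in Z by rewrite !inE connect0.
have : #|Z :\ x| != 0.
  by apply/eqP=> z0; move: oz; rewrite (cardsD1 x) xZ z0.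
rewrite cards_eq0 => /set0Pn[y]; rewrite !inE => /and3P[n c o].
by exists y.
Qed.

End Basics.

(** * Lifting modular flows to integer flows *)

Section Flows.
Variable G : graph.
Notation E := (edge G).
Notation V := (vertex G).
Local Open Scope ring_scope.

Section Boundary.
Variable A : zmodType.
Implicit Types (f g : E -> A) (v : V).

(** Net outflow when every edge is oriented from its [false] end to its [true] end; loops cancel. *)
Definition bd f v : A :=
  \sum_e (f e *+ (endpoint e false == v) - f e *+ (endpoint e true == v)).

Lemma eq_bd f g v : f =1 g -> bd f v = bd g v.
Proof. by move=> h; apply: eq_bigr => e _; rewrite h. Qed.

Lemma bdD f g v : bd (fun e => f e + g e) v = bd f v + bd g v.
Proof.
by rewrite /bd -big_split; apply: eq_bigr => e _ /=; rewrite !mulrnDl opprD addrACA.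
Qed.

Lemma bdN f v : bd (fun e => - f e) v = - bd f v.
Proof.
by rewrite /bd -sumrN; apply: eq_bigr => e _; rewrite !mulNrn opprB opprK addrC.
Qed.

Lemma bdB f g v : bd (fun e => f e - g e) v = bd f v - bd g v.
Proof. by rewrite bdD bdN. Qed.

Lemma bd0 v : bd (fun=> 0) v = 0.
Proof. by rewrite /bd big1 // => e _; rewrite !mul0rn subrr. Qed.

Lemma bd_sum (I : finType) (P : pred I) (F : I -> E -> A) v :
  bd (fun e => \sum_(i | P i) F i e) v = \sum_(i | P i) bd (F i) v.
Proof.
rewrite /bd exchange_big; apply: eq_bigr => e _.
by rewrite -!sumrMnl -sumrB.
Qed.

Lemma bd_one e0 (c : A) v :
  bd (fun e => if e == e0 then c else 0) v =
  c *+ (endpoint e0 false == v) - c *+ (endpoint e0 true == v).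
Proof.
rewrite /bd (bigD1 e0) //= eqxx big1 ?addr0 // => e /negPf->.
by rewrite !mul0rn subrr.
Qed.

Lemma bd_cut f (X : {set V}) :
  \sum_(v in X) bd f v =
  \sum_e (f e *+ (endpoint e false \in X) - f e *+ (endpoint e true \in X)).
Proof.
rewrite /bd exchange_big; apply: eq_bigr => e _.
have aux x : \sum_(v in X) f e *+ (x == v) = f e *+ (x \in X).
  rewrite sumrMnr; congr (_ *+ _); case xX: (x \in X).
    rewrite (bigD1 x) //= eqxx big1 // => u /andP[_]; by rewrite eq_sym => /negPf->.
  by rewrite big1 // => u uX; case: eqP => // xu; rewrite xu uX in xX.
by rewrite sumrB !aux.
Qed.

End Boundary.

Lemma bd_total (A : zmodType) (f : E -> A) : \sum_v bd f v = 0.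
Proof.
have := bd_cut f setT; rewrite (eq_bigl predT) => [->|v]; last by rewrite inE.
by rewrite big1 // => e _; rewrite !inE subrr.
Qed.

Lemma bdMz (R : pzRingType) (c : R) (f : E -> R) v : bd (fun e => c * f e) v = c * bd f v.
Proof.
by rewrite /bd mulr_sumr; apply: eq_bigr => e _; rewrite mulrBr !mulrnAr.
Qed.

Section Lift.
Variable g : E -> int.

(** Edges point the way their nonzero value actually flows, so lowering values by [k] times their
    sign along a directed path moves excess from its start to its end. *)
Definition arc : rel V := fun x y => [exists e,
  [&& 0 < g e, endpoint e false == x & endpoint e true == y] ||
  [&& g e < 0, endpoint e true == x & endpoint e false == y]].

Lemma flip_path x p : path arc x p -> uniq (x :: p) ->
  exists F : {set E}, [/\ forall e, e \in F -> forall b, endpoint e b \in x :: p,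
    forall e, e \in F -> g e != 0 &
    forall u, bd (fun e => if e \in F then sgz (g e) else 0) u =
      (x == u)%:R - (last x p == u)%:R].
Proof.
elim: p x => [|y p IH] x /=.
  move=> _ _; exists set0; split=> [e|e|u]; rewrite ?inE //.
  by rewrite subrr -[RHS](bd0 _ u); apply: eq_bd => e; rewrite inE.
case/andP=> a pp /andP[nx u]; have [F [h1 h2 h3]] := IH y pp u.
case/existsP: a => e0 he0.
have ends : forall b, endpoint e0 b \in [:: x; y].
  by case/orP: he0 => /and3P[_ /eqP h /eqP h'] []; rewrite ?h ?h' !inE eqxx ?orbT.
have xe : exists b, endpoint e0 b = x.
  by case/orP: he0 => /and3P[_ /eqP h /eqP h']; [exists false | exists true].
have nF : e0 \notin F.
  by apply/negP=> /h1 h; case: xe => b hb; have := h b; rewrite hb; apply/negP.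
exists (e0 |: F); split.
- move=> e /setU1P[->|eF] b; last by rewrite inE h1 ?orbT.
  by have := ends b; rewrite !inE orbA => ->.
- move=> e /setU1P[->|/h2 //]; by case/orP: he0 => /and3P[h _ _]; lia.
move=> v; rewrite (eq_bd (g := fun e => (if e == e0 then sgz (g e0) else 0) +
   (if e \in F then sgz (g e) else 0))); last first.
  move=> e; rewrite !inE; case: eqP => [->|_]; rewrite ?(negPf nF) ?addr0 ?add0r //.
rewrite bdD h3 bd_one.
case/orP: he0 => /and3P[h /eqP-> /eqP->].
  by rewrite gtr0_sgz // addrA subrK.
by rewrite ltr0_sgz // !mulNrn opprK [- _ + _]addrC addrA subrK.
Qed.

(** No flow leaves the set reachable from [v] along [arc], so its total boundary is at most 0, and
    the positive excess of [v] forces a reachable [w] with negative boundary. A value between 0 and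
    [k] in absolute value stays below [k] after [k] times its sign is subtracted. *)
Lemma flow_push (k : nat) v : (forall e, `|g e| < k%:Z) -> 0 < bd g v ->
  exists w (g' : E -> int), [/\ bd g w < 0, forall e, (k%:Z %| g' e - g e)%Z,
    forall e, `|g' e| < k%:Z &
    forall u, bd g' u = bd g u - k%:Z * ((v == u)%:R - (w == u)%:R)].
Proof.
move=> gk gv; pose A := [set y | connect arc v y].
have vA : v \in A by rewrite inE connect0.
have clos x y : x \in A -> arc x y -> y \in A.
  by rewrite !inE => c a; apply: (connect_trans c); apply: connect1.
have [w wA gw] : exists2 w, w \in A & bd g w < 0.
  apply/exists_inP; apply: contraT => /exists_inPn h.
  have : 0 < \sum_(u in A) bd g u.
    rewrite (bigD1 v) //= ltr_wpDr // sumr_ge0 // => u /andP[uA _].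
    by rewrite leNgt h.
  rewrite bd_cut ltNge => /negP[]; rewrite sumr_le0 // => e _.
  case sA: (_ \in A); case tA: (_ \in A); rewrite ?subrr // ?mulr0n ?mulr1n ?subr0 ?sub0r.
    rewrite leNgt; apply/negP=> ge; move/negP: tA; apply.
    by apply: (clos (endpoint e false)) => //; apply/existsP; exists e; rewrite ge !eqxx.
  rewrite oppr_le0 leNgt; apply/negP=> ge; move/negP: sA; apply.
  by apply: (clos (endpoint e true)) => //; apply/existsP; exists e; rewrite ge !eqxx orbT.
move: wA; rewrite inE => /connectP[p pp wE].
case/shortenP: pp wE => q pq uq _ wE.
have [F [h1 h2 h3]] := flip_path pq uq.
exists w, (fun e => g e - k%:Z * (if e \in F then sgz (g e) else 0)); split=> //.
- by move=> e; rewrite [_ - _]addrC addKr rpredN; apply: dvdz_mulr; apply: dvdzz.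
- move=> e; case eF: (e \in F); last by rewrite mulr0 subr0.
  by have := gk e; have := h2 e eF; case: sgzP => //; lia.
by move=> u; rewrite bdB bdMz h3 -wE.
Qed.

End Lift.

(* Tutte: push the excess of a bounded representative along directed paths, each
   push replacing g by g - k sgn g. *)
Lemma flow_lift (k : nat) (g0 : E -> int) : (0 < k)%N ->
  (forall v, (k%:Z %| bd g0 v)%Z) ->
  exists g : E -> int, [/\ forall e, (k%:Z %| g e - g0 e)%Z,
    forall e, `|g e| < k%:Z & forall v, bd g v = 0].
Proof.
move=> k0 dv.
suff : forall n (g : E -> int), (\sum_v absz (bd g v) < n)%N ->
   (forall e, (k%:Z %| g e - g0 e)%Z) -> (forall e, `|g e| < k%:Z) ->
   exists g : E -> int, [/\ forall e, (k%:Z %| g e - g0 e)%Z,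
     forall e, `|g e| < k%:Z & forall v, bd g v = 0].
  move=> h; apply: (h _ (fun e => (g0 e %% k%:Z)%Z) (ltnSn _)) => e.
    by rewrite /modz addrC addKr rpredN; apply: dvdz_mull; apply: dvdzz.
  have kn : k%:Z != 0 by lia.
  by have := modz_ge0 (g0 e) kn; have := ltz_mod (g0 e) kn; lia.
elim=> // n IH g sn gm gk.
have dg v : (k%:Z %| bd g v)%Z.
  rewrite -(subrK (bd g0 v) (bd g v)); apply: rpredD; last exact: dv.
  rewrite -bdB; apply: rpred_sum => e _.
  by apply: rpredB; apply: rpredMn; apply: gm.
case: (pickP (fun v => 0 < bd g v)) => [v gv|npos]; last first.
  exists g; split=> // v; apply/eqP; rewrite -oppr_eq0.
  have s0 : \sum_v - bd g v = 0 by rewrite sumrN bd_total oppr0.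
  apply/eqP; apply: (psumr_eq0P _ s0) => // u _.
  by rewrite oppr_ge0 leNgt npos.
have [w [g' [gw h1 h2 h3]]] := flow_push gk gv.
have nvw : v != w by apply/eqP=> e; move: gv gw; rewrite e; lia.
apply: (IH g') => //; last first.
  move=> e; rewrite -(subrK (g e) (g' e)) -addrA.
  by apply: rpredD; [apply: h1 | apply: gm].
move: sn; rewrite ltnS; apply: leq_trans.
(* All boundaries are multiples of [k], so a push brings both [bd g v] and [bd g w] closer to 0
   without overshooting. *)
have [a ea] : exists a, bd g v = a * k%:Z by apply/dvdzP.
have [b eb] : exists b, bd g w = b * k%:Z by apply/dvdzP.
rewrite (bigD1 v) // [X in (_ < X)%N](bigD1 v) //= -addSn leq_add //.
  rewrite h3 eqxx eq_sym (negPf nvw) subr0 mulr1 ea.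
  have : 0 < a by move: gv; rewrite ea; nia.
  nia.
apply: leq_sum => u uv; rewrite h3 [v == u]eq_sym (negPf uv) sub0r.
case: eqP => [<-|_]; last by rewrite oppr0 mulr0 subr0.
rewrite eb; have : b < 0 by move: gw; rewrite eb; nia.
nia.
Qed.

End Flows.

(** * Seymour's 6-flow theorem *)

Section SixFlowBase.
Variable G : graph.
Notation E := (edge G).
Notation V := (vertex G).
Notation F3 := 'F_3.
Implicit Types (X Y Z U : {set V}) (e : E).
Local Open Scope ring_scope.

Definition inside X : {set E} :=
  [set e | (endpoint e false \in X) && (endpoint e true \in X)].

Definition between X Y : {set E} :=
  [set e | (endpoint e false \in X) && (endpoint e true \in Y) ||
           (endpoint e true \in X) && (endpoint e false \in Y)].

Lemma inside_end X e b : e \in inside X -> endpoint e b \in X.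
Proof. by rewrite inE => /andP[]; case: b. Qed.

Lemma inside_sub X Y : X \subset Y -> inside X \subset inside Y.
Proof.
by move=> /subsetP s; apply/subsetP=> e; rewrite !inE => /andP[/s-> /s->].
Qed.

Lemma conn_flow (K : {set E}) x y : connect (adj K) x y ->
  exists f : E -> F3, (forall e, e \notin K -> f e = 0) /\
    forall v, bd f v = (x == v)%:R - (y == v)%:R.
Proof.
case/conn_walk=> p [w s <-]; elim: p x w s => [|[e z] p IH] x /=.
  by move=> _ _; exists (fun=> 0); split=> // v; rewrite bd0 subrr.
case/andP=> j w s.
have [|f [f1 f2]] := IH z w; first by move=> g gp; apply: s; rewrite inE gp orbT.
have eK : e \in K by apply: s; rewrite mem_head.
have [c hc] : exists c : F3, forall v,
    c *+ (endpoint e false == v) - c *+ (endpoint e true == v) = (x == v)%:R - (z == v)%:R.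
  case/orP: j => /andP[/eqP-> /eqP->]; [exists 1 | exists (-1)] => // v.
  by rewrite !mulNrn opprK addrC.
exists (fun g => (if g == e then c else 0) + f g); split.
  move=> g gK; rewrite f1 // addr0; case: eqP => // ge; by rewrite ge eK in gK.
by move=> v; rewrite bdD bd_one hc f2 addrA subrK.
Qed.

Lemma f3_avoid (a b : F3) : exists k : F3, k != a /\ k != b.
Proof.
case: (eqVneq b (a + 1)) => [->|ne].
  exists (a - 1); split; first by rewrite -subr_eq0 addrC addKr oppr_eq0.
  by rewrite -subr_eq0 opprD addrACA subrr add0r.
exists (a + 1); split; last by rewrite eq_sym.
by rewrite -subr_eq0 addrC addKr.
Qed.

(* Seymour's closure argument, strengthened to arbitrary forbidden values h so that
   it survives the extension of U by a vertex or by a connected even subgraph. *)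
Definition flexible U (C : {set E}) : Prop :=
  [/\ evenset C, C \subset inside U,
     (forall x y, x \in U -> y \in U -> connect (adj (inside U)) x y) &
     forall h : E -> F3, exists f : E -> F3, [/\ forall e, e \notin inside U -> f e = 0,
       forall v, bd f v = 0 & forall e, e \in inside U -> e \notin C -> f e != h e]].

Lemma flexible1 x : flexible [set x] set0.
Proof.
split.
- exact: even0.
- exact: sub0set.
- by move=> y z /set1P-> /set1P->; apply: connect0.
(* The edges inside a single vertex are loops, on which every assignment is a flow. *)
move=> h; exists (fun e => if e \in inside [set x] then h e + 1 else 0); split.
- by move=> e /negPf->.
- move=> v; rewrite /bd big1 // => e _; case: ifP; last by rewrite !mul0rn subrr.
  by rewrite !inE => /andP[/eqP-> /eqP->]; rewrite subrr.
by move=> e -> _; rewrite -subr_eq0 addrC addKr.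
Qed.

(** Edges outside the connected set [K], other than [e2], get their values from circulations
    completed inside [K]. One circulation through both [e1] and [e2] then has a free multiplier with
    only two forbidden values in F_3. Finally the flexibility of [U], applied to the shifted
    forbidden values, repairs the edges inside [U] and touches nothing else. *)
Lemma flexibleU U C Y (D : {set E}) e1 e2 u1 y1 u2 y2 :
  flexible U C -> [disjoint U & Y] -> evenset D -> D \subset inside Y ->
  (forall x y, x \in Y -> y \in Y -> connect (adj D) x y) ->
  e1 != e2 -> joins e1 u1 y1 -> joins e2 u2 y2 ->
  u1 \in U -> u2 \in U -> y1 \in Y -> y2 \in Y ->
  flexible (U :|: Y) (C :|: D).
Proof.
case=> eC sC cU hU dUY eD sD cD n12 j1 j2 u1U u2U y1Y y2Y.
have UYF x : x \in U -> x \in Y -> False.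
  by move=> xU xY; have /pred0P/(_ x) := dUY; rewrite /= xU xY.
pose K := e1 |: (inside U :|: D).
have sUW : inside U \subset inside (U :|: Y) by apply/inside_sub/subsetUl.
have sDW : D \subset inside (U :|: Y) by apply: (subset_trans sD); apply/inside_sub/subsetUr.
have jW e u y : joins e u y -> u \in U -> y \in Y -> e \in inside (U :|: Y).
  by case/orP=> /andP[/eqP h /eqP h'] uU yY; rewrite inE h h' !inE uU yY !orbT.
have jU e u y : joins e u y -> u \in U -> y \in Y -> e \notin inside U /\ e \notin inside Y.
  move=> j uU yY; case/joins_end: j => b [h h']; split; apply/negP=> eI.
    by have := inside_end (~~ b) eI; rewrite h' => /UYF; apply.
  by have := inside_end b eI; rewrite h => /(UYF _ uU).
have sKW : K \subset inside (U :|: Y).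
  rewrite subUset sub1set (jW _ _ _ j1) //=; apply/subsetP=> e /setUP[]; exact: subsetP.
have cK x y : x \in U :|: Y -> y \in U :|: Y -> connect (adj K) x y.
  suff h z : z \in U :|: Y -> connect (adj K) u1 z.
    by move=> /h h1 /h h2; apply: connect_trans h2; rewrite conn_sym.
  case/setUP=> zZ.
    apply: conn_sub (cU _ _ u1U zZ); exact: (subset_trans (subsetUl _ _) (subsetUr _ _)).
  apply: (connect_trans (y := y1)); last first.
    apply: conn_sub (cD _ _ y1Y zZ); exact: (subset_trans (subsetUr _ _) (subsetUr _ _)).
  by apply/connect1/adjP; exists e1 => //; rewrite setU11.
have e2K : e2 \notin K.
  rewrite !inE eq_sym (negPf n12) /=; have [h1 h2] := jU _ _ _ j2 u2U y2Y.
  move: h1; rewrite inE => /negPf->; apply/negP=> /(subsetP sD); exact/negP.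
split.
- rewrite -symd_disj; first exact: even_symd.
  apply/pred0P=> e /=; apply/negP=> /andP[/(subsetP sC) eU /(subsetP sD) eY].
  by have := inside_end false eU; move/UYF; apply; apply: inside_end eY.
- rewrite subUset sDW andbT; exact: subset_trans sUW.
- by move=> x y xU yU; apply: conn_sub (cK x y xU yU).
move=> h.
have /fin_all_exists[q hq] g : exists q : E -> F3, g \in inside (U :|: Y) ->
    [/\ forall v, bd q v = 0, g \notin K -> q g = 1 &
        forall e, e \notin K -> e != g -> q e = 0].
  case gW: (g \in inside _); last by exists (fun=> 0).
  have [l [l1 l2]] := conn_flow (cK _ _ (inside_end true gW) (inside_end false gW)).
  exists (fun e => (if e == g then 1 else 0) + l e) => _; split.
  - by move=> v; rewrite bdD bd_one l2 addrA subrK subrr.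
  - by move=> gK; rewrite eqxx l1 // addr0.
  by move=> e eK /negPf->; rewrite l1 // addr0.
pose Gs := [set g in inside (U :|: Y) | (g \notin K) && (g != e2)].
have GsP g : g \in Gs -> [/\ g \in inside (U :|: Y), g \notin K & g != e2].
  by rewrite in_set => /and3P.
pose f1 e := \sum_(g in Gs) (h g + 1) * q g e.
have f1b v : bd f1 v = 0.
  rewrite bd_sum big1 // => g /GsP[gW _ _].
  by rewrite bdMz; have [-> _ _] := hq g gW; rewrite mulr0.
have f1G e : e \in Gs -> f1 e = h e + 1.
  move=> eG; have [eW eK _] := GsP _ eG; rewrite /f1 (bigD1 e) //= big1 ?addr0 => [|g /andP[]].
    by have [_ -> //] := hq e eW; rewrite mulr1.
  case/GsP=> gW _ _ ng; by have [_ _ -> //] := hq g gW; rewrite ?mulr0 // eq_sym.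
have f1N e : e \notin K -> e \notin Gs -> f1 e = 0.
  move=> eK eG; rewrite /f1 big1 // => g gG.
  have [gW _ _] := GsP _ gG; have [_ _ -> //] := hq g gW; first by rewrite mulr0.
  by apply/eqP=> eg; rewrite eg gG in eG.
have e2W := jW _ _ _ j2 u2U y2Y.
have [Qb Q2 Q0] := hq e2 e2W.
(* Only [e1] and [e2] carry [q e2] across the cut of [U], so its value 1 on [e2] forces a nonzero
   value on [e1]. *)
have Q1 : q e2 e1 != 0.
  apply/eqP=> q0; have := bd_cut (q e2) U.
  rewrite big1 // (bigD1 e2) //= big1 => [|e ne2].
    rewrite Q2 // addr0; case/orP: j2 => /andP[/eqP-> /eqP->]; rewrite u2U.
      by case yU: (y2 \in U); [case: (UYF _ yU y2Y) | rewrite subr0 => /esym/eqP].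
    case yU: (y2 \in U); [case: (UYF _ yU y2Y) | rewrite sub0r => /esym/eqP].
    by rewrite oppr_eq0.
  case eK: (e \in K); last by rewrite Q0 ?eK // !mul0rn subrr.
  move: eK; rewrite !inE => /or3P[/eqP->|/andP[-> ->]|/(subsetP sD) eY].
  - by rewrite q0 !mul0rn subrr.
  - by rewrite subrr.
  have nU b : (endpoint e b \in U) = false.
    by apply/negP=> eU; apply: (UYF _ eU); apply: inside_end eY.
  by rewrite !nU subrr.
have [k [k1 k2]] := f3_avoid ((h e1 - f1 e1) / q e2 e1) (h e2).
pose f2 e := f1 e + k * q e2 e.
have [f3 [f3s f3b f3h]] := hU (fun e => h e - f2 e).
exists (fun e => f2 e + f3 e); split.
- move=> e eW; have eK : e \notin K by apply: contra eW; apply: subsetP.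
  have ne2 : e != e2 by apply: contraNneq eW => ->.
  rewrite f3s ?addr0; last by apply: contra eW; apply: subsetP.
  by rewrite /f2 f1N ?Q0 ?mulr0 ?addr0 //; by apply: contra eW => /GsP[].
- by move=> v; rewrite bdD /f2 bdD bdMz f1b Qb f3b mulr0 !addr0.
move=> e eW; rewrite inE negb_or => /andP[eC' eD'].
case eU: (e \in inside U).
  by apply: contraNneq (f3h e eU eC') => <-; rewrite [f2 e + _]addrC addrK.
rewrite f3s ?eU // addr0.
case: (eqVneq e e2) => [->|ne2].
  rewrite /f2 f1N ?add0r ?Q2 ?mulr1 //; by apply/negP=> /GsP[_ _]; rewrite eqxx.
case: (eqVneq e e1) => [->|ne1].
  apply: contraNneq k1 => /(congr1 (fun t => t - f1 e1)).
  by rewrite /f2 addrC addKr => <-; rewrite mulfK.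
have eK : e \notin K by rewrite in_setU1 (negPf ne1) in_setU eU (negPf eD').
have eG : e \in Gs by rewrite in_set eW eK ne2.
by rewrite /f2 f1G // Q0 // mulr0 addr0 -subr_eq0 addrC addKr.
Qed.

Lemma betweenC X Y : between X Y = between Y X.
Proof. by apply/setP=> e; rewrite !inE orbC ![_ && (_ \in X)]andbC. Qed.

Section TwoEdgeConnected.
Variable X : {set V}.
Hypothesis X2 : forall Z, Z \subset X -> Z != set0 -> Z != X -> (1 < #|between Z (X :\: Z)|)%N.

Lemma conn_del e0 x y : x \in X -> y \in X -> connect (adj (inside X :\ e0)) x y.
Proof.
move=> xX yX; apply: contraT => nc.
pose Z := cc (inside X :\ e0) x :&: X.
have := X2 (subsetIr _ _ : Z \subset X).
have ZX : Z != X.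
  apply: contraNneq nc => ZX; have : y \in Z by rewrite ZX.
  by rewrite in_setI in_set => /andP[].
have Z0 : Z != set0 by apply/set0Pn; exists x; rewrite !inE connect0.
move=> /(_ Z0 ZX) h.
suff : between Z (X :\: Z) \subset [set e0].
  by move/subset_leq_card; rewrite cards1; lia.
apply/subsetP=> e eb; rewrite inE; apply: contraT => ne.
have [b bZ nbZ] : exists2 b, endpoint e b \in Z & endpoint e (~~ b) \in X :\: Z.
  by move: eb; rewrite inE => /orP[] /andP[h1 h2]; [exists false | exists true].
move: bZ nbZ; rewrite !inE => /andP[c bX] /andP[nbZ nX].
case/negP: nbZ; rewrite nX andbT; apply: (connect_trans c); apply: conn_end.
rewrite !inE ne /=; by case: (b) bX nX => /= -> ->.
Qed.

(** The two walks form one closed trail through [x] and [z]; its edge set is even and connected, as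
    [flexibleU] demands of [D]. *)
Definition twolinked x z := exists p q,
  [/\ walk x p, wend x p = z, walk z q, wend z q = x &
      uniq (unzip1 p ++ unzip1 q) /\ {subset unzip1 (p ++ q) <= inside X}].

Lemma twolinked_step x z w e0 : x \in X -> twolinked x z -> e0 \in inside X -> joins e0 z w ->
  twolinked x w.
Proof.
move=> xX [p [q [wp ep wq eq [u s]]]] e0X j.
have sp : {subset unzip1 p <= inside X}.
  by move=> f fp; apply: s; rewrite /unzip1 map_cat mem_cat [f \in map _ p]fp.
have sq : {subset unzip1 q <= inside X}.
  by move=> f fq; apply: s; rewrite /unzip1 map_cat mem_cat [f \in map _ q]fq orbT.
have zX : z \in X by case/joins_end: j => b [<- _]; apply: inside_end.
have wX : w \in X by case/joins_end: j => b [_ <-]; apply: inside_end.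
(* If [w] already lies on the closed trail, the same trail is split at [w] instead of [z]. *)
case wv: (w \in vtx x (p ++ q)).
  move: wv; rewrite mem_vtx_cat => /orP[/vtx_split|wq']; last first.
    have /vtx_split[q1 [q2 [eq12 e1]]] : w \in vtx z q by rewrite inE wq' orbT.
    exists (p ++ q1), q2; move: wq eq u s.
    rewrite eq12 walk_cat wend_cat e1 walk_cat ep => /andP[w1 w2] ex u s; split=> //.
    - by rewrite wp w1.
    - by rewrite wend_cat ep.
    by split; [rewrite /unzip1 !map_cat -catA in u * | rewrite -catA].
  case=> p1 [p2 [ep12 e1]].
  exists p1, (p2 ++ q); move: wp ep u s.
  rewrite ep12 walk_cat wend_cat e1 => /andP[w1 w2] ez u s; split=> //.
  - by rewrite walk_cat w2 ez.
  - by rewrite wend_cat ez.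
  by split; [rewrite /unzip1 !map_cat -catA in u * | rewrite catA].
(* Otherwise a path from [w] to its first vertex on the trail, avoiding [e0], forms together with
   [e0] a detour attached to the trail at [z]. It replaces or extends a portion of [p] or [q],
   according to where it arrives. *)
have [r [wr sr er]] := conn_walk (conn_del e0 wX zX).
pose Y := [set y in vtx x (p ++ q)].
have zY : wend w r \in Y by rewrite inE er mem_vtx_cat -ep wend_in.
have [w' [r' [wr' sr' w'w rY [ur _ _ hY]]]] := minwalk wr sr (set11 w) zY.
move: w'w; rewrite inE => /eqP ww; subst w'.
have e0nr : e0 \notin unzip1 r' by apply/negP=> /sr'; rewrite !inE eqxx.
have uer : uniq (unzip1 r') := uniq_vtx_edges wr' ur.
have pqY f b : f \in unzip1 (p ++ q) -> endpoint f b \in Y.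
  by move=> fp; rewrite inE; apply: walk_ends fp; rewrite walk_cat wp ep.
have e0n : e0 \notin unzip1 (p ++ q).
  apply/negP=> h; case/joins_end: j => b [_ h2]; have := pqY _ (~~ b) h.
  by rewrite h2 inE wv.
(* An edge shared with the trail would have both ends on it, hence both equal to the last vertex of
   [r'], which a path excludes. *)
have rn f : f \in unzip1 r' -> f \notin unzip1 (p ++ q).
  move=> fr; apply/negP=> fp.
  have e0' := hY _ (walk_ends false wr' fr) (pqY _ _ fp).
  have e1' := hY _ (walk_ends true wr' fr) (pqY _ _ fp).
  elim: (r') (w) wr' ur fr e0' e1' {wr sr er zX wX wv j zY rY sr' e0nr uer hY} => //
    [[g v] r1 IH] w0 /= /andP[jg wr1] /andP[nw u1].
  rewrite inE => /orP[/eqP->|fr] e0' e1'.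
    case/joins_end: jg => b [h1 h2].
    have : w0 = v by rewrite -h1 -h2; case: (b) => /=; rewrite e0' e1'.
    by move=> e; rewrite e inE eqxx in nw.
  exact: IH wr1 u1 fr e0' e1'.
have sr2 : {subset unzip1 r' <= inside X}.
  by move=> f /sr'; rewrite inE => /andP[].
have rn' f : f \in unzip1 r' -> (f \in unzip1 p = false) * (f \in unzip1 q = false).
  move/rn; rewrite /unzip1 map_cat mem_cat negb_or => /andP[/negPf h1 /negPf h2].
  by rewrite /unzip1 h1 h2.
have e0n' : (e0 \in unzip1 p = false) * (e0 \in unzip1 q = false).
  move: e0n; rewrite /unzip1 map_cat mem_cat negb_or => /andP[/negPf h1 /negPf h2].
  by rewrite /unzip1 h1 h2.
have [up [hpq uq]] : uniq (unzip1 p) /\ (forall f, f \in unzip1 p -> f \in unzip1 q -> False)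
    /\ uniq (unzip1 q).
  move: u; rewrite cat_uniq => /and3P[-> h ->]; split=> //; split=> // f fp fq.
  by case/hasP: h; exists f.
move: rY; rewrite inE mem_vtx_cat => /orP[/vtx_split[p1 [p2 [e12 e1]]]|rq].
  have [r2 [wr2 er2 e2 _ _]] := walk_rev wr'.
  exists (p1 ++ r2), ((e0, z) :: q); split.
  - by move: wp; rewrite e12 !walk_cat e1 wr2 => /andP[-> _].
  - by rewrite wend_cat e1.
  - by rewrite /= joinsC j.
  - exact: eq.
  have sp1 f : f \in unzip1 p1 -> f \in unzip1 p.
    by move=> h; rewrite e12 /unzip1 map_cat mem_cat [f \in map _ p1]h.
  have up1 : uniq (unzip1 p1) by move: up; rewrite e12 /unzip1 map_cat cat_uniq => /and3P[].
  split.
    rewrite /unzip1 map_cat /= -/unzip1 -/(unzip1 p1) -/(unzip1 r2) -/(unzip1 q) e2.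
    rewrite cat_uniq cat_uniq up1 rev_uniq uer /= uq e0n' andbT /=.
    rewrite mem_cat mem_rev (negPf e0nr) orbF; apply/and3P; split.
    - apply/hasPn=> f; rewrite mem_rev => /rn'[h _]; apply/negP=> /sp1; by rewrite h.
    - apply/norP; split; first by apply/negP=> /sp1; rewrite e0n'.
      apply/hasPn=> f fq; rewrite mem_cat mem_rev negb_or; apply/andP; split.
        by apply/negP=> /sp1 fp; apply: hpq fp fq.
      by apply/negP=> /rn'[_]; rewrite fq.
    by [].
  move=> f; rewrite /unzip1 !map_cat /= !mem_cat inE -/(unzip1 p1) -/(unzip1 r2) e2 mem_rev.
  case/or3P=> [/orP[/sp1/sp|/sr2]|/eqP->|/sq] //.
have /vtx_split[q1 [q2 [e12 e1]]] : wend w r' \in vtx z q by rewrite inE rq orbT.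
exists (p ++ [:: (e0, w)]), (r' ++ q2).
have sq2 f : f \in unzip1 q2 -> f \in unzip1 q.
  by move=> h; rewrite e12 /unzip1 map_cat mem_cat [f \in map _ q2]h orbT.
have uq2 : uniq (unzip1 q2) by move: uq; rewrite e12 /unzip1 map_cat cat_uniq => /and3P[].
split.
- by rewrite walk_cat wp ep /= j.
- by rewrite wend_cat.
- by move: wq; rewrite e12 !walk_cat e1 wr' => /andP[_ ->].
- by move: eq; rewrite e12 !wend_cat e1.
split.
  rewrite /unzip1 !map_cat /= -/(unzip1 p) -/(unzip1 q2) -/(unzip1 r').
  rewrite cat_uniq cat_uniq up /= cat_uniq uer uq2 !andbT e0n' /=.
  apply/andP; split.
    apply/hasPn=> f; rewrite !mem_cat inE => /orP[fr|fq].
      rewrite (rn' _ fr).1 /=; apply: contraNneq e0nr => <-; exact: fr.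
    apply/norP; split; last by apply/eqP=> fe; rewrite -fe in e0n'; rewrite sq2 // in e0n'; case: e0n'.
    by apply/negP=> fp; apply: hpq fp (sq2 _ fq).
  by apply/hasPn=> f /sq2 fq; apply/negP=> /rn'[_]; rewrite fq.
move=> f; rewrite /unzip1 !map_cat /= !mem_cat inE.
case/orP=> [/orP[/sp|/eqP->]|/orP[/sr2|/sq2/sq]] //.
Qed.

Lemma twolinkedT x z : x \in X -> z \in X -> twolinked x z.
Proof.
move=> xX zX.
have tl0 : twolinked x x by exists [::], [::]; split.
case: (eqVneq x z) => [<- //|nxz].
have nX : [set x] != X by apply: contraNneq nxz => xX'; move: zX; rewrite -xX' inE eq_sym.
have /card_gt0P[e _] : (0 < #|between [set x] (X :\: [set x])|)%N.
  by apply/ltnW/X2 => //; [rewrite sub1set | apply/set0Pn; exists x; rewrite inE].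
have : connect (adj (inside X)) x z by apply: conn_sub (conn_del e xX zX); apply: subsetDl.
case/conn_walk=> r [wr sr <-].
suff : forall z0, walk z0 r -> twolinked x z0 -> twolinked x (wend z0 r) by apply.
elim: r sr {wr} => [|[g v] r IH] sr z0 //= /andP[j wr] tl.
apply: (IH _ v) => // [f fr|]; first by apply: sr; rewrite inE fr orbT.
by apply: twolinked_step tl _ j => //; apply: sr; rewrite mem_head.
Qed.

End TwoEdgeConnected.
End SixFlowBase.

(** * Seymour's theorem when all cuts have at least three edges *)

Section SixFlow3Connected.
Variable G : graph.
Notation E := (edge G).
Notation V := (vertex G).
Notation F3 := 'F_3.
Implicit Types (X Y Z U W : {set V}) (e : E).
(** [V0] is the set of vertices that are still present: the contractions in [six_flow] keep the
    vertex type and remove a vertex from [V0]. *)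
Variable V0 : {set V}.
Hypothesis V0ends : forall e b, endpoint e b \in V0.
Hypothesis cut3 : forall X, X \subset V0 -> X != set0 -> X != V0 -> 2 < #|cut X|.

Lemma betweenP X Y e :
  reflect (exists b, endpoint e b \in X /\ endpoint e (~~ b) \in Y) (e \in between X Y).
Proof.
rewrite inE; apply: (iffP orP).
  by case=> /andP[h1 h2]; [exists false | exists true].
by case=> [[] [h1 h2]]; [right | left]; apply/andP.
Qed.



Lemma flexible_grow U C : U \subset V0 -> U != set0 -> U != V0 -> flexible U C ->
  exists U' C', [/\ U' \subset V0, U \proper U' & flexible U' C'].
Proof.
move=> sU U0 UV fU; pose W := V0 :\: U.
have W0 : W != set0.
  by apply: contraNneq UV => w0; rewrite eqEsubset sU -setD_eq0 -/W w0 eqxx.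
(* A minimal such [X] is a leaf of the tree of 2-edge-connected pieces of a component of [W]; as at
   most one of its three or more cut edges stays in [W], at least two lead to [U]. *)
pose P X := [&& X \subset W, X != set0 & #|between X (W :\: X)| <= 1].
have PW : P W.
  rewrite /P subxx W0 setDv (_ : between _ _ = set0) ?cards0 //.
  by apply/setP=> e; rewrite !inE !andbF.
have [X /and3P[sX X0 oX] minX] := arg_minnP (fun X => #|X|) PW.
(* By minimality both [Z] and its complement in [X] have two edges to the rest of [W]. With at most
   one edge between them, each would have an edge to [W :\: X], but only one such edge exists. *)
have X2 Z : Z \subset X -> Z != set0 -> Z != X -> 1 < #|between Z (X :\: Z)|.
  move=> sZ Z0 ZX; rewrite ltnNge; apply/negP=> o1.
  have small Y : Y \subset X -> Y != set0 -> Y != X -> 1 < #|between Y (W :\: Y)|.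
    move=> sY Y0 YX; rewrite ltnNge; apply/negP=> oY.
    have : #|X| <= #|Y| by apply: minX; rewrite /P (subset_trans sY sX) Y0.
    by rewrite leqNgt proper_card // properEneq YX.
  have h1 := small _ sZ Z0 ZX.
  have h2 : 1 < #|between (X :\: Z) (W :\: (X :\: Z))|.
    apply: small; first exact: subsetDl.
      by apply: contraNneq ZX => /eqP; rewrite setD_eq0 eqEsubset sZ.
    apply: contraNneq Z0 => e; rewrite -subset0; apply/subsetP=> z zZ.
    by have := subsetP sZ z zZ; rewrite -e inE zZ.
  have split Y : Y \subset X -> between Y (X :\: Y) = between Z (X :\: Z) ->
      1 < #|between Y (W :\: Y)| -> exists2 e, e \in between Y (W :\: X) & true.
    move=> sY eY h; apply/exists_inP; apply: contraTT h => /exists_inPn h.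
    rewrite -leqNgt (leq_trans _ o1) // subset_leq_card // -eY.
    apply/subsetP=> e /betweenP[b [h3 h4]]; apply/betweenP; exists b; split=> //.
    move: h4; rewrite !inE => /andP[-> w] /=; apply: contraT => nX.
    have /h : e \in between Y (W :\: X) by apply/betweenP; exists b; rewrite !inE nX w.
    by [].
  have [e1 e1Z _] := split _ sZ erefl h1.
  have [e2 e2Z _] : exists2 e, e \in between (X :\: Z) (W :\: X) & true.
    apply: split h2; first exact: subsetDl.
    by rewrite betweenC (_ : X :\: (X :\: Z) = Z) // setDDr setDv set0U; apply/setIidPr.
  have mono Y : Y \subset X -> between Y (W :\: X) \subset between X (W :\: X).
    move=> /subsetP sY; apply/subsetP=> e /betweenP[b [/sY h3 h4]].
    by apply/betweenP; exists b.
  have : #|[set e1; e2]| <= 1.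
    apply: leq_trans oX; apply: subset_leq_card; rewrite subUset !sub1set.
    by rewrite (subsetP (mono Z sZ)) // (subsetP (mono _ (subsetDl X Z))).
  rewrite cards2; case: eqP => // e12 _; subst e2.
  have /betweenP[b [h3 h4]] := e1Z; have /betweenP[b' [h5 h6]] := e2Z.
  move: h5 h6; case: (eqVneq b b') => [<-|nb]; first by rewrite inE h3.
  have -> : b' = ~~ b by case: (b) nb; case: (b').
  by rewrite inE => /andP[_ bX]; move: h4; rewrite inE bX.
have XU1 : 1 < #|between X U|.
  have sXV : X \subset V0 by apply: (subset_trans sX); apply: subsetDl.
  have XV : X != V0.
    apply: contraNneq U0 => e; rewrite -subset0; apply/subsetP=> u uU.
    have := subsetP sX u; rewrite e (subsetP sU) // inE uU => /(_ isT) //.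
  have h := cut3 sXV X0 XV.
  have : #|cut X| <= #|between X U| + #|between X (W :\: X)|.
    apply: leq_trans (leq_card_setU _ _); apply: subset_leq_card.
    apply/subsetP=> e ec.
    have [b [h1 h2]] : exists b, endpoint e b \in X /\ endpoint e (~~ b) \notin X.
      move: ec; rewrite inE; case h1: (_ \in X); case h2: (_ \in X) => //= _.
        by exists false; rewrite h1 h2.
      by exists true; rewrite h1 h2.
    rewrite inE; case eU: (endpoint e (~~ b) \in U).
      by apply/orP; left; apply/betweenP; exists b.
    by apply/orP; right; apply/betweenP; exists b; rewrite !inE h2 eU V0ends.
  lia.
have [e1 [e2 [e1B e2B n12]]] : exists e1 e2,
    [/\ e1 \in between X U, e2 \in between X U & e1 != e2].
  have [e1 e1B] : exists e, e \in between X U by apply/card_gt0P; lia.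
  have [e2] : exists e, e \in between X U :\ e1.
    by apply/card_gt0P; move: XU1; rewrite (cardsD1 e1) e1B; lia.
  by rewrite in_setD1 eq_sym => /andP[n e2B]; exists e1, e2.
have /betweenP[b1 [x1X u1U]] := e1B; have /betweenP[b2 [x2X u2U]] := e2B.
have [p [q [wp ep wq eq [u s]]]] := twolinkedT X2 x1X x2X.
set x1 := endpoint e1 b1 in x1X wp eq *; set x2 := endpoint e2 b2 in x2X ep wq *.
pose Y := [set y in vtx x1 (p ++ q)].
have wpq : walk x1 (p ++ q) by rewrite walk_cat wp ep.
have upq : uniq (unzip1 (p ++ q)) by rewrite /unzip1 map_cat.
have dUX y : y \in U -> y \in X -> False.
  by move=> yU yX; have := subsetP sX y yX; rewrite inE yU.
have sYX : Y \subset X.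
  apply/subsetP=> y; rewrite inE; elim: (p ++ q) (x1) x1X wpq s => [|[e z] r IH] x xX /=.
    by move=> _ _; rewrite inE => /eqP->.
  case/andP=> j wr s; rewrite inE => /orP[/eqP->//|]; apply: IH => //.
    case/joins_end: j => b [_ <-]; apply: inside_end; apply: s; exact: mem_head.
  by move=> f fr; apply: s; rewrite inE fr orbT.
exists (U :|: Y), (C :|: eset_of (p ++ q)); split.
- by rewrite subUset sU (subset_trans sYX) // (subset_trans sX) // subsetDl.
- rewrite properE subsetUl /=; apply/negP=> /subsetP/(_ x1); rewrite !inE eqxx orbT.
  by move=> /(_ isT) xU; apply: dUX xU x1X.
apply: (flexibleU fU _ _ _ _ n12 (u1 := endpoint e1 (~~ b1)) (y1 := x1)
   (u2 := endpoint e2 (~~ b2)) (y2 := x2)) => //.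
- by apply/pred0P=> y /=; apply/negP=> /andP[yU /(subsetP sYX)]; apply: dUX.
- by move=> v; rewrite (odeg_eset_of v wpq upq) wend_cat ep eq addbb.
- by apply/subsetP=> f; rewrite in_set => fr; rewrite in_set; apply/andP; split;
    rewrite in_set; apply: walk_ends wpq fr.
- have h y : y \in Y -> connect (adj (eset_of (p ++ q))) x1 y.
    by rewrite inE; apply: walk_conn wpq _ _ => f fr; rewrite inE.
  by move=> y z /h h1 /h; apply: connect_trans; rewrite conn_sym.
- by rewrite joinsC joins_endpoint.
- by rewrite joinsC joins_endpoint.
- by rewrite inE mem_head.
by rewrite inE mem_vtx_cat -ep wend_in.
Qed.

Lemma flexible_all x0 : x0 \in V0 -> exists C, flexible V0 C.
Proof.
move=> x0V.
suff h : forall n U C, #|V0 :\: U| < n -> U \subset V0 -> U != set0 -> flexible U C ->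
    exists C, flexible V0 C.
  apply: (h _ [set x0] set0 (ltnSn _)); first by rewrite sub1set.
    by apply/set0Pn; exists x0; rewrite inE.
  exact: flexible1.
elim=> // n IH U C lt sU U0 fU.
case: (eqVneq U V0) => [<-|UV]; first by exists C.
have [U' [C' [sU' pU fU']]] := flexible_grow sU U0 UV fU.
apply: (IH U' C') => //.
  apply: leq_trans (_ : #|V0 :\: U| <= n) => //; apply: proper_card.
  have [s [x xU' xU]] := properP pU; apply/properP; split; first exact: setDS.
  by exists x; rewrite !inE ?xU ?xU' //= (subsetP sU').
by apply: contraNneq U0 => e; rewrite -subset0 -e; apply: proper_sub.
Qed.

End SixFlow3Connected.

Lemma cut_symd (G : graph) (X Y : {set vertex G}) : cut (symd X Y) = symd (cut X) (cut Y).
Proof.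
apply/setP=> e; rewrite in_symd !inE.
by do 2!case: (endpoint e _ \in _); do 2!case: (endpoint e _ \in _).
Qed.

(* Seymour's 6-flow theorem, with Z_6 split as Z_2 x Z_3.  Cuts of size at most 2
   are removed by contracting one of their edges, whose flow value is forced. *)
Theorem six_flow (V E : finType) (ep : E -> bool -> V) (V0 : {set V}) :
  V0 != set0 -> (forall e b, ep e b \in V0) ->
  let G := Graph ep in
  (forall X : {set vertex G}, X \subset V0 -> X != set0 -> X != V0 -> cut X != set0) ->
  exists (C : {set edge G}) (f : edge G -> 'F_3),
    [/\ evenset C, forall v, (bd f v = 0)%R &
      forall e, (forall X : {set vertex G}, cut X != [set e]) -> (e \in C) || (f e != 0)%R].
Proof.
have [n] := ubnP #|V0|; elim: n ep V0 => // n IH ep V0 lt V00 V0ends G cut1.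
pose small (X : {set vertex G}) := [&& X \subset V0, X != set0, X != V0 & #|cut X| <= 2].
case: (pickP small) => [X /and4P[sX X0 XV cX2]|nsm]; last first.
  have [x0 x0V] := set0Pn _ V00.
  have [|C [eC sC cC hC]] := @flexible_all G V0 V0ends _ x0 x0V.
    by move=> X h1 h2 h3; rewrite ltnNge; have := nsm X; rewrite /small h1 h2 h3 /= => ->.
  have [f [f1 f2 f3]] := hC (fun=> 0%R).
  exists C, f; split=> // e _; case eX: (e \in C) => //=; apply: f3; last by rewrite eX.
  by rewrite inE !V0ends.
have [e0 e0X] := set0Pn _ (cut1 X sX X0 XV).
pose x := ep e0 false; pose y := ep e0 true.
have nxy : x != y.
  by apply: contraTneq e0X => xy; rewrite inE -[endpoint e0 false]/x xy addbb.
(* Contraction of [e0] by renaming [y] to [x]: the edge becomes a loop. *)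
pose m (v : V) := if v == y then x else v.
pose ep' e b := m (ep e b); pose V1 := V0 :\ y.
pose G' := Graph ep'.
have my v : (m v == y) = false.
  by rewrite /m; case: ifP => // _; apply: negbTE.
have cut' (Z : {set vertex G'}) : exists Y : {set vertex G}, cut Y = cut Z /\
    forall v, (v \in Y) = (m v \in Z).
  exists [set v | m v \in Z]; split=> [|v]; last by rewrite inE.
  by apply/setP=> e; rewrite !inE.
have V1lt : #|V1| < n.
  by move: lt; rewrite (cardsD1 y V0) V0ends add1n ltnS.
have [|||C' [f' [eC' bf' h']]] := IH ep' V1 V1lt.
- by apply/set0Pn; exists x; rewrite !inE nxy V0ends.
- by move=> e b; rewrite !inE my /= /ep' /m; case: ifP => _; apply: V0ends.
- move=> Z sZ Z0 ZV; have [Y [<- hY]] := cut' Z.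
  have mV v : v \in V0 -> m v \in V1.
    by move=> vV; rewrite !inE my /= /m; case: ifP => _ //; apply: V0ends.
  rewrite (_ : cut Y = cut (Y :&: V0)); last first.
    have VE (e : edge G) b : endpoint e b \in V0 by apply: V0ends.
    by apply/setP=> e; rewrite !inE !VE !andbT.
  have [z zZ] := set0Pn _ Z0.
  have mz w : w \in V1 -> m w = w by rewrite !inE /m => /andP[/negPf->].
  apply: cut1; first exact: subsetIr.
    apply/set0Pn; exists z; rewrite inE hY mz ?zZ ?(subsetP sZ) //=.
    by have := subsetP sZ z zZ; rewrite inE => /andP[].
  apply: contraNneq ZV => e; rewrite eqEsubset sZ; apply/subsetP=> w wV.
  have : w \in Y :&: V0 by rewrite e; move: wV; rewrite inE => /andP[].
  by rewrite inE hY mz // => /andP[].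
pose C0 := C' :\ e0.
pose f0 e := (if e == e0 then 0 else f' e)%R.
(* Undoing the contraction, the parity at [y] decides whether [e0] belongs to [C], and conservation
   at [y] determines the value [r] of the flow on [e0]. *)
pose C : {set edge G} := if odeg (G := G) C0 y then e0 |: C0 else C0.
pose r := bd (G := G) f0 y.
pose f (e : edge G) := (f0 e + if e == e0 then r else 0)%R.
have oC v : odeg (G := G) C0 v = (v \in [set x; y]) && odeg (G := G) C0 y.
  have old u : u != y -> odeg (G := G') C' u =
      odeg (G := G) C0 u (+) ((u == x) && odeg (G := G) C0 y).
    move=> uy; rewrite /odeg /C0 /xsum.
    have -> : (u == x) && (\big[addb/false]_(e in C' :\ e0) inc (G := G) y e) =
       \big[addb/false]_(e in C' :\ e0) ((u == x) && inc (G := G) y e).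
      by case: (u == x) => //=; rewrite big1.
    rewrite -big_split /=.
    transitivity (\big[addb/false]_(e in C' :\ e0) inc (G := G') u e).
      case eC: (e0 \in C'); last first.
        by rewrite (_ : C' :\ e0 = C') //; apply/setP=> e; rewrite !inE; case: eqP => // ->; rewrite eC.
      rewrite (big_setD1 e0) //= [X in X (+) _](_ : _ = false) //.
      by rewrite /inc /= /ep' /m -/x -/y eqxx (negPf nxy) addbb.
    apply: eq_bigr => e _; rewrite /inc /= /ep' /m.
    have aux w : ((if w == y then x else w) == u) = (w == u) (+) ((u == x) && (w == y)).
      case: (w =P y) => [->|]; last by rewrite andbF addbF.
      by rewrite [y == u]eq_sym (negPf uy) andbT eq_sym.
    by rewrite !aux; case: (u == x) => /=; rewrite ?addbF // !addbA; congr (_ (+) _); rewrite -!addbA; congr (_ (+) _); rewrite addbC.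
  rewrite !inE; case: (eqVneq v y) => [->|vy]; first by rewrite orbT.
  have := old v vy; rewrite eC' orbF.
  by case: (odeg (G := G) C0 v); case: (_ && _).
have evC : evenset C.
  move=> v; rewrite /C; case o: (odeg (G := G) C0 y); last by rewrite oC o andbF.
  have -> : e0 |: C0 = symd [set e0] C0.
    by apply/setP=> e; rewrite in_symd !inE; case: (e == e0).
  rewrite (odeg_symd (G := G)) oC o andbT.
  rewrite /odeg xsum1 /inc /= -/x -/y !inE ![v == _]eq_sym.
  by case: (eqVneq x v) => [xv|_]; [rewrite -xv eq_sym (negPf nxy) | case: (y == v)].
have bf v : (bd (G := G) f v = 0)%R.
  rewrite bdD bd_one /= -/x -/y.
  have old u : u != y -> bd (G := G') f' u =
      (bd (G := G) f0 u + (if u == x then r else 0))%R.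
    move=> uy; have -> : ((if u == x then r else 0) = \sum_(e : E)
        (if u == x then f0 e *+ (ep e false == y) - f0 e *+ (ep e true == y) else 0))%R.
      by case: eqP => // _; rewrite big1.
    rewrite /bd -big_split /=; apply: eq_bigr => e _.
    rewrite /ep' /m /f0; case: (eqVneq e e0) => [->|_].
      by rewrite -/x -/y eqxx (negPf nxy) !mul0rn !subrr if_same addr0.
    have aux w : (f' e *+ ((if w == y then x else w) == u) =
       f' e *+ (w == u) + (if u == x then f' e *+ (w == y) else 0))%R.
      case: (w =P y) => [->|_]; last by rewrite mulr0n if_same addr0.
      by rewrite [y == u]eq_sym (negPf uy) add0r eq_sym; case: eqP.
    by rewrite !aux; case: (u == x); rewrite ?addr0 // opprD addrACA.
  case: (eqVneq v y) => [->|vy].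
    by rewrite (negPf nxy) mulr0n mulr1n sub0r; apply: subrr.
  rewrite mulr0n subr0; have := old v vy; rewrite bf' eq_sym => ->.
  by congr (_ + _)%R; case: eqP.
have Coff e : e != e0 -> (e \in C) = (e \in C').
  by move=> ne; rewrite /C /C0; case: ifP => _; rewrite !inE (negPf ne).
have foff e : e != e0 -> f e = f' e.
  by move=> ne; rewrite /f /f0 (negPf ne) addr0.
have good e : e != e0 -> (forall X : {set vertex G}, cut X != [set e]) ->
    (e \in C) || (f e != 0)%R.
  move=> ne nb; rewrite Coff // foff //; apply: h' => Z.
  by have [Y [<- _]] := cut' Z; apply: nb.
exists C, f; split=> // e nb; case: (eqVneq e e0) => [ee|ne]; last exact: good.
(* As [e0] is no bridge, the small cut consists of [e0] and a second edge [e1], which is no bridge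
   either. Even sets contain both or none of them, and flows vanish on both or none, so [e0]
   inherits the conclusion from [e1]. *)
subst e; have [e1 e1X n1] : exists2 e1, e1 \in cut X & e1 != e0.
  have : cut X :\ e0 != set0.
    apply: contraNneq (nb X) => h; apply/eqP/setP=> e.
    have := congr1 (fun A : {set edge G} => e \in A) h; rewrite in_setD1 in_set1 in_set0.
    by case: (eqVneq e e0) => [->|].
  by case/set0Pn=> e1; rewrite in_setD1 => /andP[]; exists e1.
have cX : cut X = [set e0; e1].
  apply/esym/eqP; rewrite eqEcard subUset !sub1set e0X e1X cards2 eq_sym n1.
  exact: cX2.
have nb1 (Y : {set vertex G}) : cut Y != [set e1].
  apply: contraNneq (nb (symd X Y)) => h; rewrite cut_symd cX h; apply/eqP/setP=> e.
  rewrite in_symd !inE; case: (eqVneq e e1) => [->|_]; last by rewrite orbF addbF.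
  by rewrite orbT (negPf n1).
have := good e1 n1 nb1.
have -> : (e1 \in C) = (e0 \in C).
  have := even_cut X evC; rewrite cX.
  case h0: (e0 \in C); case h1: (e1 \in C) => //.
    rewrite (_ : C :&: _ = [set e0]) ?cards1 //.
    by apply/setP=> e; rewrite !inE; case: eqP => [->|]; rewrite ?h0 //=; case: eqP => [->|]; rewrite ?h1 ?andbF.
  rewrite (_ : C :&: _ = [set e1]) ?cards1 //.
  by apply/setP=> e; rewrite !inE; case: (e =P e1) => [->|]; rewrite ?h1 ?orbT //= orbF; case: eqP => [->|]; rewrite ?h0 ?andbF.
case: (e0 \in C) => //=; apply: contraNneq => fe0; apply/eqP.
have := bd_cut f X; rewrite big1 => [|v _]; last exact: bf.
rewrite (bigD1 e1) //= big1 => [|e ne]; last first.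
  case eX: (e \in cut X).
    move: eX; rewrite cX !inE (negPf ne) orbF => /eqP->; by rewrite fe0 !mul0rn subrr.
  by move: eX; rewrite inE; case: (_ \in X); case: (_ \in X) => //= _; rewrite subrr.
move: e1X; rewrite inE addr0; case: (_ \in X); case: (_ \in X) => //= _.
  by rewrite subr0.
by rewrite sub0r => /esym/eqP; rewrite oppr_eq0 => /eqP.
Qed.

(** * Short covers by even sets *)

Section EvenTriple.
Variable G : graph.
Notation E := (edge G).
Notation V := (vertex G).
Notation F3 := 'F_3.

Section Parity.
Local Open Scope ring_scope.

Definition oddz (z : int) : bool := odd `|z|%N.

Lemma oddzD x y : oddz (x + y) = oddz x (+) oddz y.
Proof. by rewrite /oddz; lia. Qed.

Lemma odd_bd (g : E -> int) v : oddz (bd g v) = odeg [set e | oddz (g e)] v.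
Proof.
rewrite /bd (big_morph oddz oddzD (erefl _)) /odeg /xsum [RHS]big_mkcond.
apply: eq_bigr => e _; rewrite inE /inc /oddz.
case: (_ == v); case: (_ == v); rewrite ?mulr0n ?mulr1n ?subr0 ?sub0r ?subrr ?abszN /=;
  case: (odd _) => //=.
Qed.

Lemma dvdz2_oddz z : (2%:Z %| z)%Z = ~~ oddz z.
Proof. by rewrite dvdzE dvdn2. Qed.

Lemma bd_intr (R : pzRingType) (g : E -> int) v :
  bd (fun e => (g e)%:~R : R) v = (bd g v)%:~R.
Proof.
rewrite /bd rmorph_sum; apply: eq_bigr => e _ /=.
by rewrite rmorphB !rmorphMn.
Qed.

Lemma even_flow (C : {set E}) : evenset C ->
  exists h : E -> int, [/\ forall e, oddz (h e) = (e \in C), forall e, `|h e| < 2 &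
    forall v, bd h v = 0].
Proof.
move=> eC; pose c e : int := (e \in C)%:R.
have oc : [set e | oddz (c e)] = C.
  by apply/setP=> e; rewrite inE /c; case: (e \in C).
have [//|v|h [h1 h2 h3]] := @flow_lift G 2 c.
  by rewrite dvdz2_oddz odd_bd oc eC.
exists h; split=> // e; have := h1 e; rewrite dvdz2_oddz.
by rewrite oddzD /c; case: (e \in C); case: (oddz (h e)).
Qed.

(** The flow modulo 3 becomes two even sets in the manner of a nowhere-zero 4-flow. Before that it
    is shifted along [C] so that a third of [C] need not be covered again; [short_even_cover] lives
    on this third. *)
Lemma triple_of_flow (C : {set E}) (f : E -> F3) : evenset C -> (forall v, bd f v = 0) ->
  exists D1 D2 : {set E}, [/\ evenset D1, evenset D2,
    forall e, (e \in C) || (f e != 0) = (e \in C :|: (D1 :|: D2)) &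
    (#|C| <= 3 * #|C :\: (D1 :|: D2)|)%N].
Proof.
move=> eC bf; have [h [h1 h2 h3]] := even_flow eC.
(* Off [C] the shift changes nothing. An edge of [C] has [h e] equal to 1 or -1 and so vanishes for
   one of the three multipliers; some multiplier therefore kills at least a third of [C]. *)
pose fj (j : F3) e := f e + j * (h e)%:~R.
have bfj j v : bd (fj j) v = 0.
  by rewrite bdD bdMz bd_intr h3 bf mulr0 addr0.
have hC e : e \in C -> exists j, fj j e == 0.
  rewrite -h1 => oh; exists (- (f e / (h e)%:~R)).
  rewrite /fj mulNr mulfVK ?subrr //.
  have : h e = 1 \/ h e = -1 by move: oh (h2 e); rewrite /oddz; lia.
  by case=> ->; rewrite ?rmorphN ?oppr_eq0 oner_neq0.
have [j hj] : exists j, (#|C| <= 3 * #|[set e in C | fj j e == 0%R]|)%N.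
  apply/existsP; apply: contraT => /existsPn hn.
  have : (\sum_(j : F3) 3 * #|[set e in C | fj j e == 0%R]| < \sum_(j : F3) #|C|)%N.
    rewrite (bigD1 0) // [X in (_ < X)%N](bigD1 0) //= -addSn leq_add //.
      by rewrite ltnNge hn.
    by apply: leq_sum => j _; rewrite ltnW // ltnNge hn.
  rewrite sum_nat_const card_Fp // -big_distrr /= ltn_mul2l /= ltnNge => /negP[].
  have -> : (#|C| = \sum_(e in C) 1)%N by rewrite sum1_card.
  have -> : (\sum_(j : F3) #|[set e in C | fj j e == 0%R]| =
             \sum_(j : F3) \sum_(e in C) (fj j e == 0%R))%N.
    apply: eq_bigr => j _; rewrite -sum1_card big_mkcond [RHS]big_mkcond.
    by apply: eq_bigr => e _; rewrite inE; case: (e \in C); case: eqP.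
  rewrite exchange_big; apply: leq_sum => e /hC[j hj].
  by rewrite (bigD1 j) //= hj.
have [//|v|g [g1 g2 g3]] := @flow_lift G 3 (fun e => (fj j e : nat)%:Z).
  have p3 : 3 \in [pchar F3] by apply: pchar_Fp.
  rewrite (dvdz_pcharf p3) -bd_intr -[X in _ == X](bfj j v); apply/eqP/eq_bd => e.
  exact: natr_Zp.
have gz e : (fj j e == 0) = (g e == 0).
  have := g1 e; have := g2 e; set x := fj j e; have := ltn_ord x.
  have -> : (x == 0) = ((x : nat) == 0%N) by [].
  rewrite /Zp_trunc /= => lt3 gl /dvdzP[q]; lia.
pose D1 := [set e | oddz (g e)].
have eD1 : evenset D1 by move=> v; rewrite -odd_bd g3.
have [k [k1 k2 k3]] := even_flow eD1.
(* The values of [g] lie between -2 and 2. The odd ones are caught by [D1]; where [g e] is 2 or -2,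
   [k e] is 0 and the halved flow is odd, so [D2] catches them. *)
pose w e := ((g e + k e) %/ 2)%Z.
have w2 e : 2 * w e = g e + k e.
  have : (2%:Z %| g e + k e)%Z by rewrite dvdz2_oddz oddzD k1 inE addbb.
  by rewrite /w mulrC => /divzK.
have bw v : bd w v = 0.
  have : 2 * bd w v = 0 by rewrite -bdMz (eq_bd _ w2) bdD g3 k3.
  lia.
pose D2 := [set e | oddz (w e)].
have eD2 : evenset D2 by move=> v; rewrite -odd_bd bw.
have supp e : (e \in D1 :|: D2) = (g e != 0).
  have := w2 e; have := k1 e; have := k2 e; have := g2 e.
  by rewrite !inE /oddz; lia.
have suppC e : e \notin C -> (g e != 0) = (f e != 0).
  move=> eC'; rewrite -gz /fj (_ : h e = 0) ?mulr0 ?addr0 //.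
  by have := h1 e; have := h2 e; rewrite (negPf eC') /oddz; lia.
exists D1, D2; split=> //.
- move=> e; rewrite in_setU supp; case eC': (e \in C) => //=.
  by rewrite suppC ?eC'.
rewrite (leq_trans hj) // leq_mul2l /= subset_leq_card //.
by apply/subsetP=> e; rewrite inE in_setD supp gz negbK andbC.
Qed.

End Parity.

Lemma even_triple (N : {set E}) : (0 < #|V|) ->
  (forall X : {set V}, X != set0 -> X != setT -> ~~ (cut X \subset N)) ->
  exists C D1 D2 : {set E}, [/\ [/\ evenset C, evenset D1 & evenset D2],
    (forall e, e \notin N -> (forall X : {set V}, cut X :\: N != [set e]) ->
       e \in C :|: (D1 :|: D2)), [disjoint C :|: (D1 :|: D2) & N] &
    #|C| <= 3 * #|C :\: (D1 :|: D2)|].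
Proof.
move=> V0 cutN.
(* The edges of [N] are deleted by turning them into loops; whatever [C] and [f] are on these loops
   is discarded below without changing parities or boundaries. *)
pose ep (e : E) b := if e \in N then endpoint e false else endpoint e b.
pose H := Graph ep.
have cutH (X : {set V}) : cut (G := H) X = cut X :\: N.
  by apply/setP=> e; rewrite !inE /= /ep; case: (e \in N); rewrite ?addbb ?andbF.
have [||X _ X0 XT|C [f [eC bf hf]]] := @six_flow V E ep setT.
- by rewrite -cards_eq0 cardsT -lt0n.
- by move=> e b; rewrite inE.
- by rewrite cutH setD_eq0 cutN.
pose C' : {set E} := C :\: N; pose f' (e : E) : F3 := if e \in N then 0%R else f e.
have eC' : evenset C'.
  move=> v; rewrite -[RHS](eC v) /odeg /xsum [LHS]big_mkcond [RHS]big_mkcond.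
  apply: eq_bigr => e _; rewrite inE /inc /= /ep; case: (e \in N) => //=.
  by rewrite addbb if_same.
have bf' v : bd f' v = 0%R.
  rewrite -[RHS](bf v) /bd; apply: eq_bigr => e _; rewrite /f' /= /ep.
  by case: (e \in N) => //=; rewrite !mul0rn !subrr.
have [D1 [D2 [e1 e2 cov le]]] := triple_of_flow eC' bf'.
exists C', D1, D2; split=> //.
  move=> e eN nb; rewrite -cov /f' inE eN (negPf eN); apply: hf => X.
  by rewrite cutH; apply: nb.
by apply/pred0P=> e /=; rewrite -cov /f' inE; case: (e \in N); rewrite ?eqxx ?andbF.
Qed.

Section Triple.
Variables C D1 D2 : {set E}.
Let U := C :|: (D1 :|: D2).

(** The seven sets are the nonzero combinations of the three over GF(2). A nonzero vector of GF(2)^3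
    has product 1 with exactly four of the seven nonzero functionals. *)
Lemma fano_count (K : {set E}) :
  #|K :&: C| + #|K :&: D1| + #|K :&: D2| + #|K :&: symd C D1| + #|K :&: symd C D2| +
  #|K :&: symd D1 D2| + #|K :&: symd C (symd D1 D2)| = 4 * #|K :&: U|.
Proof.
have c (A : {set E}) : #|K :&: A| = \sum_(e in K) (e \in A).
  rewrite -sum1_card big_mkcond [RHS]big_mkcond; apply: eq_bigr => e _.
  by rewrite inE; case: (e \in K); case: (e \in A).
rewrite !c -!big_split big_distrr; apply: eq_bigr => e _.
rewrite !in_symd /U !inE /=.
by case: (e \in C); case: (e \in D1); case: (e \in D2).
Qed.

Hypotheses (eC : evenset C) (eD1 : evenset D1) (eD2 : evenset D2).

(** Exchanging [J] along an even set shows that [J] contains at most half of it; adding this over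
    the seven sets of [fano_count] counts each edge of [U] four times on both sides. *)
Lemma half_join (J : {set E}) : (forall Z, evenset Z -> Z \subset U -> #|J| <= #|symd J Z|) ->
  2 * #|J :&: U| <= #|U|.
Proof.
move=> minJ.
have h Z : evenset Z -> Z \subset U -> 2 * #|J :&: Z| <= #|Z|.
  by move=> eZ sZ; have := minJ Z eZ sZ; have := card_symd J Z; lia.
have sC : C \subset U by apply: subsetUl.
have s1 : D1 \subset U by rewrite /U setUCA subsetUl.
have s2 : D2 \subset U by rewrite /U setUA subsetUr.
have e12 := even_symd eD1 eD2; have s12 := symd_sub s1 s2.
have := fano_count J; have := fano_count setT; rewrite !setTI.
have := h _ eC sC; have := h _ eD1 s1; have := h _ eD2 s2; have := h _ e12 s12.
have := h _ (even_symd eC eD1) (symd_sub sC s1).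
have := h _ (even_symd eC eD2) (symd_sub sC s2).
have := h _ (even_symd eC e12) (symd_sub sC s12); lia.
Qed.

(* One of the nine covers {C, A, B}, {C + A, A, B} with A <> B among D1, D2, D1 + D2
   has at most the average length. *)
Lemma short_even_cover : #|C| <= 3 * #|C :\: (D1 :|: D2)| ->
  exists A1 A2 A3 : {set E}, [/\ [/\ evenset A1, evenset A2 & evenset A3],
    A1 :|: A2 :|: A3 = U & 3 * (#|A1| + #|A2| + #|A3|) <= 5 * #|U|].
Proof.
pose n a b c := #|[set e | [&& (e \in C) == a, (e \in D1) == b & (e \in D2) == c]]|.
pose D3 := symd D1 D2.
have count (A : {set E}) (phi : bool -> bool -> bool -> bool) :
    (forall e, (e \in A) = phi (e \in C) (e \in D1) (e \in D2)) ->
  #|A| = phi true true true * n true true true + phi true true false * n true true false +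
    phi true false true * n true false true + phi true false false * n true false false +
    phi false true true * n false true true + phi false true false * n false true false +
    phi false false true * n false false true + phi false false false * n false false false.
  move=> hA; rewrite /n -!sum1_card !(big_mkcond (fun e => e \in _)).
  rewrite !big_distrr -!big_split; apply: eq_bigr => e _ /=; rewrite hA !inE.
  by case: (e \in C); case: (e \in D1); case: (e \in D2); rewrite /= ?muln0 ?muln1 ?addn0 ?add0n;
    case: (phi _ _ _).
have := count C (fun a b c => a) (fun=> erefl).
have := count D1 (fun a b c => b) (fun=> erefl).
have := count D2 (fun a b c => c) (fun=> erefl).
have := count D3 (fun a b c => b (+) c) (in_symd _ _).
have := count (symd C D1) (fun a b c => a (+) b) (in_symd _ _).
have := count (symd C D2) (fun a b c => a (+) c) (in_symd _ _).
have hC3 e : (e \in symd C D3) = (e \in C) (+) ((e \in D1) (+) (e \in D2)).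
  by rewrite !in_symd.
have hR e : (e \in C :\: (D1 :|: D2)) = ~~ ((e \in D1) || (e \in D2)) && (e \in C).
  by rewrite !inE.
have hU e : (e \in U) = [|| e \in C, e \in D1 | e \in D2] by rewrite !inE.
have := count _ (fun a b c => a (+) (b (+) c)) hC3.
have := count _ (fun a b c => ~~ (b || c) && a) hR.
have := count _ (fun a b c => [|| a, b | c]) hU.
rewrite /= !mul1n !mul0n => cU cR cC3 cC2 cC1 cD3 cD2 cD1 cC.
have e3 : evenset D3 := even_symd eD1 eD2.
have opt A1 A2 A3 : evenset A1 -> evenset A2 -> evenset A3 -> A1 :|: A2 :|: A3 = U ->
   3 * (#|A1| + #|A2| + #|A3|) <= 5 * #|U| ->
   exists A1 A2 A3 : {set E}, [/\ [/\ evenset A1, evenset A2 & evenset A3],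
    A1 :|: A2 :|: A3 = U & 3 * (#|A1| + #|A2| + #|A3|) <= 5 * #|U|].
  by move=> h1 h2 h3 h4 h5; exists A1, A2, A3.
have cmp (A1 A2 A3 : {set E}) : (forall e, (e \in A1) || (e \in A2) || (e \in A3) = (e \in U)) ->
  A1 :|: A2 :|: A3 = U by move=> h; apply/setP=> e; rewrite 2!in_setU h.
move=> z.
case: (leqP (3 * (#|C| + #|D1| + #|D2|)) (5 * #|U|)) => [|l1].
  apply: opt => //; apply: cmp => e; rewrite hU ?in_symd.
  by case: (e \in C); case: (e \in D1); case: (e \in D2).
case: (leqP (3 * (#|C| + #|D1| + #|D3|)) (5 * #|U|)) => [|l2].
  apply: opt => //; apply: cmp => e; rewrite hU ?in_symd.
  by case: (e \in C); case: (e \in D1); case: (e \in D2).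
case: (leqP (3 * (#|C| + #|D2| + #|D3|)) (5 * #|U|)) => [|l3].
  apply: opt => //; apply: cmp => e; rewrite hU ?in_symd.
  by case: (e \in C); case: (e \in D1); case: (e \in D2).
case: (leqP (3 * (#|symd C D1| + #|D1| + #|D2|)) (5 * #|U|)) => [|l4].
  apply: opt => //; first exact: even_symd.
  apply: cmp => e; rewrite hU ?in_symd.
  by case: (e \in C); case: (e \in D1); case: (e \in D2).
case: (leqP (3 * (#|symd C D1| + #|D1| + #|D3|)) (5 * #|U|)) => [|l5].
  apply: opt => //; first exact: even_symd.
  apply: cmp => e; rewrite hU ?in_symd.
  by case: (e \in C); case: (e \in D1); case: (e \in D2).
case: (leqP (3 * (#|symd C D2| + #|D2| + #|D1|)) (5 * #|U|)) => [|l6].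
  apply: opt => //; first exact: even_symd.
  apply: cmp => e; rewrite hU ?in_symd.
  by case: (e \in C); case: (e \in D1); case: (e \in D2).
case: (leqP (3 * (#|symd C D2| + #|D2| + #|D3|)) (5 * #|U|)) => [|l7].
  apply: opt => //; first exact: even_symd.
  apply: cmp => e; rewrite hU ?in_symd.
  by case: (e \in C); case: (e \in D1); case: (e \in D2).
case: (leqP (3 * (#|symd C D3| + #|D3| + #|D1|)) (5 * #|U|)) => [|l8].
  apply: opt => //; first exact: even_symd.
  apply: cmp => e; rewrite hU ?in_symd.
  by case: (e \in C); case: (e \in D1); case: (e \in D2).
case: (leqP (3 * (#|symd C D3| + #|D3| + #|D2|)) (5 * #|U|)) => [|l9].
  apply: opt => //; first exact: even_symd.
  apply: cmp => e; rewrite hU ?in_symd.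
  by case: (e \in C); case: (e \in D1); case: (e \in D2).
(* The average is weighted: 1/6 for each of the three covers using [C], 1/12 for each of the six
   others. An edge of [U] outside [C] then costs 5/3, an edge in [C] only costs 1, and an edge of
   [C] in [D1] or [D2] costs 2. By hypothesis there are at most twice as many edges of the last kind
   as of the second, which gives 5/3 overall. *)
exfalso; lia.
Qed.

End Triple.
End EvenTriple.

(** * Cycles and circuits of cubic graphs *)

Section Degrees.
Variable G : graph.
Notation E := (edge G).
Notation V := (vertex G).
Implicit Types (A B C D Q : {set E}) (X Y : {set V}) (e : E) (x y z v : V)
  (p q : seq (E * V)).

Definition hdeg A v : nat := sdegree (spanning A) v.

Lemma hdegE A v :
  hdeg A v = \sum_(e in A) ((endpoint e false == v) + (endpoint e true == v)).
Proof.
rewrite /hdeg /sdegree -sum1_card big_mkcond /=.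
rewrite (eq_bigr (fun h : E * bool => ((h.1 \in A) && (endpoint h.1 h.2 == v) : nat))); last first.
  by move=> h _; rewrite inE; case: (_ && _).
rewrite -(pair_bigA _ (fun e b => ((e \in A) && (endpoint e b == v) : nat))) /= [RHS]big_mkcond.
by apply: eq_bigr => e _; rewrite big_bool /=; case: (e \in A); rewrite //= addnC.
Qed.

Lemma odd_hdeg A v : odd (hdeg A v) = odeg A v.
Proof.
rewrite hdegE (big_morph odd oddD (erefl _)) /odeg /xsum; apply: eq_bigr => e _.
by rewrite oddD /inc; case: (_ == v); case: (_ == v).
Qed.

Lemma hdegU A B v : [disjoint A & B] -> hdeg (A :|: B) v = hdeg A v + hdeg B v.
Proof.
move=> d; rewrite !hdegE !(big_mkcond (fun e => e \in _)) -big_split /=.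
apply: eq_bigr => e _; rewrite inE.
by have /pred0P/(_ e) := d; rewrite /=; case: (e \in A); case: (e \in B); rewrite ?addn0.
Qed.

Lemma hdeg_sub A B v : A \subset B -> hdeg A v <= hdeg B v.
Proof.
move=> /setIidPr AB; rewrite -(setID B A) AB hdegU ?leq_addr //.
by apply/pred0P=> e; rewrite /= !inE; case: (e \in A).
Qed.

Lemma sum_hdeg A : \sum_v hdeg A v = 2 * #|A|.
Proof.
under eq_bigr do rewrite hdegE.
rewrite exchange_big /= -sum1_card big_distrr /=; apply: eq_bigr => e _.
rewrite big_split /=.
have h x : \sum_v (x == v) = 1.
  rewrite (bigD1 x) //= eqxx big1 // => v; by rewrite eq_sym => /negPf->.
by rewrite !h.
Qed.

Definition vs A : {set V} := [set v | 0 < hdeg A v].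

Lemma vsP A v : reflect (exists e b, e \in A /\ endpoint e b = v) (v \in vs A).
Proof.
rewrite inE /hdeg /sdegree; apply: (iffP card_gt0P) => [[[e b]]|[e [b [eA eb]]]].
  by rewrite inE /= => /andP[eA /eqP h]; exists e, b.
by exists (e, b); rewrite inE /= eA eb eqxx.
Qed.

Lemma vs_end A e b : e \in A -> endpoint e b \in vs A.
Proof. by move=> eA; apply/vsP; exists e, b. Qed.

Lemma vs_sub A B : A \subset B -> vs A \subset vs B.
Proof.
by move=> s; apply/subsetP=> v; rewrite !inE => h; apply: leq_trans h (hdeg_sub v s).
Qed.

Lemma vsU A B : vs (A :|: B) = vs A :|: vs B.
Proof.
apply/setP=> v; rewrite in_setU; apply/vsP/orP.
  by case=> e [b [/setUP[eA|eB] <-]]; [left|right]; apply: vs_end.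
by case=> /vsP[e [b [eA eb]]]; exists e, b; rewrite inE eA ?orbT.
Qed.

Lemma vs0 : vs set0 = set0.
Proof. by apply/setP=> v; rewrite !inE hdegE big_set0. Qed.

Lemma vs_disj A B : [disjoint vs A & vs B] -> [disjoint A & B].
Proof.
move=> /pred0P d; apply/pred0P=> e /=; apply/negP=> /andP[eA eB].
by have := d (endpoint e false); rewrite /= !vs_end.
Qed.

Lemma conn_vs A x y : connect (adj A) x y -> x \in vs A -> y \in vs A.
Proof.
case/connectP=> s ps -> {y}; elim: s x ps => //= y s IH x /andP[/adjP[e eA j] ps] _.
by apply: IH ps _; case/joins_end: j => b [_ <-]; apply: vs_end.
Qed.

Definition ecomp A x : {set E} := [set e in A | connect (adj A) x (endpoint e false)].

Lemma ecomp_sub A x : ecomp A x \subset A.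
Proof. by apply/subsetP=> e; rewrite inE => /andP[]. Qed.

Lemma mem_ecomp A x e b : e \in A -> (e \in ecomp A x) = connect (adj A) x (endpoint e b).
Proof.
move=> eA; rewrite inE eA /=; have h := conn_end false b eA; have h' := conn_end b false eA.
by apply/idP/idP=> c; [apply: connect_trans c h | apply: connect_trans c h'].
Qed.

Lemma odeg_ecomp A x v : odeg (ecomp A x) v = connect (adj A) x v && odeg A v.
Proof.
rewrite /odeg /xsum.
have -> : connect (adj A) x v && (\big[addb/false]_(e in A) inc v e) =
   \big[addb/false]_(e in A) (connect (adj A) x v && inc v e).
  by case: (connect _ _ _) => //=; rewrite big1.
rewrite big_mkcond [RHS]big_mkcond; apply: eq_bigr => e _.
case eA: (e \in A); last by rewrite inE eA.
case iv: (inc v e); last by rewrite andbF if_same.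
have [b hb] : exists b, endpoint e b = v.
  move: iv; rewrite /inc; case: eqP => [h|_]; first by exists false.
  by case: eqP => // h _; exists true.
by rewrite (mem_ecomp x b eA) hb andbT; case: connect.
Qed.

Lemma even_ecomp A x : evenset A -> evenset (ecomp A x).
Proof. by move=> eA v; rewrite odeg_ecomp eA andbF. Qed.

Lemma conn_ecomp A x y : connect (adj A) x y -> connect (adj (ecomp A x)) x y.
Proof.
case/conn_walk=> p [w s <-]; elim/last_ind: p w s => [|p [e z] IH]; first by rewrite /wend.
rewrite -cats1 walk_cat wend_cat /= => /and3P[w j _] s.
have sp : {subset unzip1 p <= A}.
  by move=> f fp; apply: s; rewrite /unzip1 map_cat mem_cat [f \in map _ p]fp.
have eA : e \in A by apply: s; rewrite /unzip1 map_cat mem_cat mem_head orbT.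
apply: (connect_trans (IH w sp)); apply/connect1/adjP; exists e => //.
case/joins_end: j => b [h _]; rewrite (mem_ecomp x b eA) h.
by apply: walk_conn w sp _ (wend_in _ _).
Qed.

Lemma vs_ecomp A x v : x \in vs A -> (v \in vs (ecomp A x)) = connect (adj A) x v.
Proof.
move=> xA; apply/idP/idP.
  case/vsP=> e [b [eC <-]]; have eA := subsetP (ecomp_sub A x) e eC.
  by rewrite -(mem_ecomp x b eA).
move=> c; apply: (conn_vs (conn_ecomp c)).
by case/vsP: xA => e [b [eA <-]]; apply: vs_end; rewrite (mem_ecomp _ b eA).
Qed.

(** In a cubic graph a nonzero even degree is 2, so these are exactly the edge sets of cycles. *)
Definition edge_cycle A : Prop :=
  [/\ evenset A, A != set0 & forall x y, x \in vs A -> y \in vs A -> connect (adj A) x y].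

Lemma ecomp_cycle A x : evenset A -> x \in vs A -> edge_cycle (ecomp A x).
Proof.
move=> eA xA; split; first exact: even_ecomp.
  have : x \in vs (ecomp A x) by rewrite vs_ecomp // connect0.
  by apply: contraTneq => ->; rewrite vs0 inE.
move=> y z; rewrite !vs_ecomp // => /conn_ecomp h1 /conn_ecomp h2.
by apply: connect_trans h2; rewrite conn_sym.
Qed.

Lemma ecomp_eq A x y : connect (adj A) x y -> ecomp A x = ecomp A y.
Proof.
move=> c; apply/setP=> e; rewrite !inE; congr (_ && _).
have c' : connect (adj A) y x by rewrite conn_sym.
by apply/idP/idP; apply: connect_trans.
Qed.

Lemma ecomp_vs_disj A x y : x \in vs A -> y \in vs A -> ~~ connect (adj A) x y ->
  [disjoint vs (ecomp A x) & vs (ecomp A y)].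
Proof.
move=> xA yA nc; apply/pred0P=> v /=; rewrite !vs_ecomp //; apply/negP=> /andP[h1 h2].
by case/negP: nc; apply: (connect_trans h1); rewrite conn_sym.
Qed.

Fact subgraph_of_proof A e : e \in A -> forall b, endpoint e b \in vs A.
Proof. by move=> eA b; apply: vs_end. Qed.

Definition subgraph_of A : subgraph G := Subgraph (@subgraph_of_proof A).

End Degrees.

Section Cubic.
Variable G : graph.
Notation E := (edge G).
Notation V := (vertex G).
Implicit Types (A B C D Q : {set E}) (X Y : {set V}) (e : E) (x y z v : V)
  (p q : seq (E * V)).
Hypothesis cub : cubic G.

Lemma hdegT v : hdeg (G := G) setT v = 3.
Proof. by apply: cub; rewrite inE. Qed.

Lemma hdeg_le3 A v : hdeg A v <= 3.
Proof. by rewrite -(hdegT v) hdeg_sub // subsetT. Qed.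

Lemma card_edges : 2 * #|E| = 3 * #|V|.
Proof.
rewrite -cardsT -sum_hdeg (eq_bigr (fun=> 3)) => [|v _]; last exact: hdegT.
by rewrite sum_nat_const mulnC.
Qed.

Lemma even_hdeg A v : evenset A -> v \in vs A -> hdeg A v = 2.
Proof.
move=> eA; rewrite inE; have := eA v; rewrite -odd_hdeg.
by have := hdeg_le3 A v; case: (hdeg A v) => [|[|[|[|n]]]].
Qed.

Lemma card_vs A : evenset A -> #|vs A| = #|A|.
Proof.
move=> eA; apply/eqP; rewrite -(eqn_pmul2l (isT : 0 < 2)) -sum_hdeg -sum1_card big_distrr /=.
rewrite big_mkcond; apply/eqP/eq_bigr => v _; case vA: (v \in vs A).
  by rewrite even_hdeg.
by move: vA; rewrite inE; case: (hdeg A v).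
Qed.

(** An even set uses two of the three half-edges at each of its vertices, which leaves room for one
    more edge only. *)
Lemma leaf D e e' b b' : evenset D -> e \notin D -> e' \notin D -> e != e' ->
  endpoint e b = endpoint e' b' -> endpoint e b \notin vs D.
Proof.
move=> eD eN e'N ne h; apply/negP=> vD.
have d : [disjoint D & [set e; e']].
  by apply/pred0P=> f /=; rewrite !inE; case: eqP => [->|_]; [rewrite (negPf eN) | case: eqP => [->|]; rewrite ?(negPf e'N) ?andbF].
have := hdeg_le3 (D :|: [set e; e']) (endpoint e b); rewrite hdegU // even_hdeg //.
have d2 : [disjoint [set e] & [set e']] by rewrite disjoints1 inE.
have pos (f : E) c : 0 < (endpoint f false == endpoint f c) + (endpoint f true == endpoint f c).
  by case: c; rewrite eqxx ?addn1.
rewrite hdegU // !hdegE !big_set1.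
by have := pos e b; have := pos e' b'; rewrite -h; lia.
Qed.

Lemma edge_cycle_is_cycle A : edge_cycle A -> is_cycle (subgraph_of A).
Proof.
case=> eA A0 cA; split.
  split; last exact: cA.
  have [e eA'] := set0Pn _ A0; apply/set0Pn; exists (endpoint e false); exact: vs_end.
by move=> v vA; apply: (even_hdeg eA).
Qed.

(** At a vertex of [Q] both edges of [D] already belong to [Q], and connectivity spreads [Q] over
    [D]. It serves to identify cycles and arcs: an even subset of a cycle is empty or the whole
    cycle. *)
Lemma edge_cycle_min D Q : edge_cycle D -> evenset Q -> Q \subset D -> Q != set0 -> Q = D.
Proof.
case=> eD _ cD eQ sQ Q0; apply/eqP; rewrite eqEsubset sQ; apply/subsetP=> f fD.
have [e eQ'] := set0Pn _ Q0.
have stay g b : g \in D -> endpoint g b \in vs Q -> g \in Q.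
  move=> gD gv; apply: contraT => gN.
  have d : [disjoint Q & [set g]] by rewrite disjoint_sym disjoints1.
  have := hdeg_sub (endpoint g b) (_ : Q :|: [set g] \subset D).
  rewrite subUset sQ sub1set gD => /(_ isT); rewrite hdegU //.
  rewrite (even_hdeg eQ gv) (even_hdeg eD (vs_end b gD)) hdegE big_set1.
  by case: (b); rewrite eqxx ?addn1 ?add1n; lia.
have : endpoint f false \in vs Q.
  have := cD _ _ (vs_end false (subsetP sQ e eQ')) (vs_end false fD).
  case/connectP=> s; have := vs_end false eQ'.
  elim: s (endpoint e false) => [|y s IH] x xQ /=; first by move=> _ ->.
  case/andP=> /adjP[g gD j] ps ly; apply: (IH y) => //.
  case/joins_end: j => b [h <-]; apply: vs_end; apply: (stay g b gD); by rewrite h.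
exact: stay.
Qed.

Section Signed.
Variable sigma : signature G.

Definition neg A := xsum sigma A.

Lemma pos_circuit A : edge_cycle A -> ~~ neg A -> circuit sigma (subgraph_of A).
Proof.
by move=> cA nA; left; split; [apply: edge_cycle_is_cycle | rewrite -xsum_odd].
Qed.

Lemma barbell_circuit A1 A2 x p : edge_cycle A1 -> edge_cycle A2 -> neg A1 -> neg A2 ->
  [disjoint vs A1 & vs A2] -> walk x p -> uniq (vtx x p) -> x \in vs A1 -> wend x p \in vs A2 ->
  (forall z, z \in vtx x p -> z \in vs A1 -> z = x) ->
  (forall z, z \in vtx x p -> z \in vs A2 -> z = wend x p) ->
  circuit sigma (subgraph_of (A1 :|: A2 :|: eset_of p)).
Proof.
move=> c1 c2 n1 n2 d w u x1 y2 h1 h2; right.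
have Pp e : e \in eset_of p -> forall b, endpoint e b \in [set v in vtx x p].
  by rewrite inE => ep b; rewrite in_set; apply: walk_ends ep.
exists (subgraph_of A1), (subgraph_of A2), (Subgraph Pp), x, (wend x p); split.
- split; [split; first exact: edge_cycle_is_cycle | split; first exact: edge_cycle_is_cycle | exact: vs_disj];
    by rewrite -xsum_odd.
- by exists p; split.
- split=> /=.
  + apply/setP=> z; rewrite in_setI in_set1 [z \in [set v in _]]in_set.
    by apply/andP/eqP=> [[]zA zp|->]; [apply: h1 | rewrite mem_head].
  + apply/setP=> z; rewrite in_setI in_set1 [z \in [set v in _]]in_set.
    by apply/andP/eqP=> [[]zA zp|->]; [apply: h2 | rewrite wend_in].
  by rewrite (disjoint_setI0 d) sub0set.
- rewrite /= !vsU; apply/setP=> z; rewrite in_setU [RHS]in_setU.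
  case zA: (z \in vs A1 :|: vs A2) => //=; apply/idP/idP.
    case/vsP=> e [b [eE <-]]; exact: Pp.
  rewrite in_set inE => /orP[/eqP zx|zp]; first by move: zA; rewrite zx inE x1.
  move: (w) zp; elim: (p) (x) => //= -[e v] q IH x0 /andP[j wq].
  rewrite inE => /orP[/eqP->|zq].
    by apply/vsP; case/joins_end: j => b [_ h]; exists e, (~~ b); rewrite inE mem_head.
  have := IH v wq zq; apply/subsetP/vs_sub/subsetP=> f; rewrite !inE => ->; exact: orbT.
by [].
Qed.

(** Covers of parts of the graph, with an upper bound for the length so that the bounds of several
    parts can be added. *)
Definition cov (U : {set E}) (n : nat) : Prop :=
  exists F : seq {set E}, [/\ forall A, A \in F -> circuit sigma (subgraph_of A),
    forall e, e \in U -> exists2 A, A \in F & e \in A & \sum_(A <- F) #|A| <= n].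

Lemma cov0 : cov set0 0.
Proof. by exists [::]; split=> // [e|]; rewrite ?inE // big_nil. Qed.

Lemma covU (U W : {set E}) n m : cov U n -> cov W m -> cov (U :|: W) (n + m).
Proof.
move=> [F [f1 f2 f3]] [F' [g1 g2 g3]]; exists (F ++ F'); split.
- by move=> A; rewrite mem_cat => /orP[/f1|/g1].
- by move=> e /setUP[/f2|/g2] [A AF eA]; exists A; rewrite // mem_cat AF ?orbT.
by rewrite big_cat leq_add.
Qed.

Lemma cov_sub (U W : {set E}) n m : W \subset U -> n <= m -> cov U n -> cov W m.
Proof.
move=> /subsetP s nm [F [f1 f2 f3]]; exists F; split=> //; last exact: leq_trans nm.
by move=> e /s /f2.
Qed.

Lemma cov_circuit (U A : {set E}) n : circuit sigma (subgraph_of A) -> U \subset A -> #|A| <= n -> cov U n.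
Proof.
move=> c /subsetP s l; exists [:: A]; split=> [B|e /s eA|].
- by rewrite inE => /eqP->.
- by exists A; rewrite ?inE.
by rewrite big_seq1.
Qed.

Lemma cov_bigcup (I : finType) (P : {set I}) (U : I -> {set E}) (n : I -> nat) :
  (forall i, i \in P -> cov (U i) (n i)) -> cov (\bigcup_(i in P) U i) (\sum_(i in P) n i).
Proof.
have [k] := ubnP #|P|; elim: k P => // k IH P lt h.
case: (set_0Vmem P) => [->|[i iP]]; first by rewrite !big_set0; apply: cov0.
rewrite (big_setD1 i) // [\sum_(_ in P) _](big_setD1 i) //=; apply: covU; first exact: h.
apply: IH => [|j /setD1P[_ /h] //]; move: lt; rewrite (cardsD1 i P) iP; lia.
Qed.

Lemma cov_even A : evenset A -> (forall x, x \in vs A -> ~~ neg (ecomp A x)) -> cov A #|A|.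
Proof.
have [k] := ubnP #|A|; elim: k A => // k IH A lt eA h.
case: (set_0Vmem A) => [->|[e eA']]; first by rewrite cards0; apply: cov0.
have xA := vs_end false eA'; set x := endpoint e false in xA.
have sC := ecomp_sub A x.
have eR : evenset (A :\: ecomp A x) by rewrite -symd_setD //; apply: even_symd => //; apply: even_ecomp.
have eC : e \in ecomp A x by rewrite inE eA' connect0.
have card : #|A| = #|ecomp A x| + #|A :\: ecomp A x|.
  by rewrite -(cardsID (ecomp A x) A) (setIidPr sC).
rewrite card -{1}(setID A (ecomp A x)) (setIidPr sC); apply: covU.
  by apply: (@cov_circuit _ (ecomp A x)) => //; apply: pos_circuit (h x xA); apply: ecomp_cycle.
apply: IH => //.
  by have : 0 < #|ecomp A x|; [apply/card_gt0P; exists e | lia].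
move=> y yR; have yA := subsetP (vs_sub (subsetDl A (ecomp A x))) y yR.
suff -> : ecomp (A :\: ecomp A x) y = ecomp A y by apply: h.
have nxy : ~~ connect (adj A) x y.
  case/vsP: yR => f [b [/setDP[fA fN] <-]].
  by rewrite -(mem_ecomp x b fA).
have sy : ecomp A y \subset A :\: ecomp A x.
  apply/subsetP=> f; rewrite !inE => /andP[fA c]; rewrite fA /= andbT.
  apply: contra nxy => c'; apply: (connect_trans c'); by rewrite conn_sym.
have eCy : evenset (ecomp (A :\: ecomp A x) y) by apply: even_ecomp.
apply: (edge_cycle_min (ecomp_cycle eA yA) eCy).
  apply/subsetP=> f; rewrite inE => /andP[/setDP[fA _] c]; rewrite inE fA /=.
  by apply: conn_sub c; apply: subsetDl.
by case: (ecomp_cycle eR yR).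
Qed.

End Signed.
End Cubic.

(** * Joining negative cycles by barbells *)

Section Joins.
Variable G : graph.
Notation E := (edge G).
Notation V := (vertex G).
Implicit Types (A B C D K J S : {set E}) (X Y T : {set V}) (e : E) (x y z v : V).

Lemma tjoin_exists K T : (forall x y, connect (adj K) x y) -> ~~ odd #|T| ->
  exists J, J \subset K /\ forall v, odeg J v = (v \in T).
Proof.
move=> cK; have [n] := ubnP #|T|; elim: n T => // n IH T lt oT.
case: (set_0Vmem T) => [->|[x xT]].
  by exists set0; split=> [|v]; rewrite ?sub0set // inE; apply: even0.
have card1 : #|T| = #|T :\ x|.+1 by rewrite (cardsD1 x) xT.
case: (set_0Vmem (T :\ x)) => [T0|[y yT]]; first by rewrite card1 T0 cards0 in oT.
have card2 : #|T :\ x| = #|T :\ x :\ y|.+1 by rewrite (cardsD1 y) yT.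
have [||J [sJ hJ]] := IH (T :\ x :\ y); first by lia.
  by move: oT; rewrite card1 card2 /= negbK.
have [B [sB hB]] := conn_join (cK x y).
exists (symd J B); split; first exact: symd_sub.
move=> v; rewrite odeg_symd hJ hB !inE.
move: yT; rewrite !inE => /andP[nyx yT].
case: (eqVneq v y) => [->|nvy] /=; first by rewrite eq_sym (negPf nyx) ?eqxx yT.
rewrite addbF.
by case: (eqVneq v x) => [->|nvx]; rewrite ?eqxx ?xT //= ?addbF.
Qed.

Lemma min_join K T : (forall x y, connect (adj K) x y) -> ~~ odd #|T| ->
  exists J, [/\ J \subset K, forall v, odeg J v = (v \in T) &
    forall Z, evenset Z -> Z \subset K -> #|J| <= #|symd J Z|].
Proof.
move=> cK oT; pose P J := (J \subset K) && [forall v, odeg J v == (v \in T)].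
have [J0 [s0 h0]] := tjoin_exists cK oT.
have P0 : P J0 by rewrite /P s0; apply/forallP=> v; rewrite h0.
have [J /andP[sJ /forallP hJ] minJ] := arg_minnP (fun A => #|A|) P0.
exists J; split=> // [v|Z eZ sZ]; first exact/eqP.
by apply: minJ; rewrite /P symd_sub //; apply/forallP=> v; rewrite odeg_symd eZ addbF.
Qed.

End Joins.

Section Cubic.
Variable G : graph.
Notation E := (edge G).
Notation V := (vertex G).
Implicit Types (A B C D K J S : {set E}) (X Y T : {set V}) (e : E) (x y z v : V)
  (p q : seq (E * V)).
Hypothesis cub : cubic G.
Hypothesis tec : forall X, X != set0 -> X != setT -> 1 < #|cut X|.
Variable sigma : signature G.

Lemma connT x y : connect (adj setT) x y.
Proof.
apply: contraT => nc.
have X0 : cc setT x != set0 by apply/set0Pn; exists x; rewrite inE connect0.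
have XT : cc setT x != setT.
  by apply: contraNneq nc => h; have : y \in cc setT x; [rewrite h inE | rewrite inE].
by have := tec X0 XT; rewrite -[cut _]setTI cut_cc cards0.
Qed.

(** With [N] empty there is no bridge, so the three even sets cover all edges and [half_join]
    applies to the whole edge set. *)
Lemma half_tjoin T : ~~ odd #|T| ->
  exists J, (forall v, odeg J v = (v \in T)) /\ 2 * #|J| <= #|E|.
Proof.
case: (set_0Vmem T) => [-> _|[t _] oT].
  by exists set0; split=> [v|]; rewrite ?cards0 // inE; apply: even0.
have [|X X0 XT|C [D1 [D2 [[eC e1 e2] cov _ _]]]] := @even_triple G set0.
- by apply/card_gt0P; exists t.
- by apply/negP=> /subset_leq_card; rewrite cards0; have := tec X0 XT; lia.
have U1 : C :|: (D1 :|: D2) = setT.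
  apply/setP=> e; rewrite [RHS]inE; apply: cov => [|X]; first by rewrite inE.
  rewrite setD0; apply/eqP=> h.
  have eX : e \in cut X by rewrite h set11.
  have X0 : X != set0 by apply: contraTneq eX => ->; rewrite !inE.
  have XT : X != setT by apply: contraTneq eX => ->; rewrite !inE.
  by have := tec X0 XT; rewrite h cards1.
have [J [_ hJ minJ]] := min_join connT oT.
exists J; split=> //.
have := half_join eC e1 e2 (J := J); rewrite U1 setIT cardsT; apply=> Z eZ _.
by apply: minJ; rewrite // subsetT.
Qed.

Lemma barbell_cov C1 C2 x p : edge_cycle C1 -> edge_cycle C2 -> neg sigma C1 -> neg sigma C2 ->
  [disjoint vs C1 & vs C2] -> walk x p -> x \in vs C1 -> wend x p \in vs C2 ->
  cov sigma (C1 :|: C2) (#|C1| + #|C2| + size p).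
Proof.
move=> c1 c2 n1 n2 d w x1 y2.
have [x' [p' [w' _ x1' y2' [u' s' h1 h2]]]] := minwalk w (fun e _ => in_setT e) x1 y2.
apply: (cov_circuit (barbell_circuit cub c1 c2 n1 n2 d w' u' x1' y2' h1 h2)).
  exact: subsetUl.
rewrite (leq_trans (leq_card_setU _ _)) // leq_add ?leq_card_setU //.
exact: leq_trans (card_eset_of_le p') s'.
Qed.

Section Negatives.
Variable S : {set E}.
Hypothesis eS : evenset S.

Definition negreps T : Prop :=
  (forall t, t \in T -> t \in vs S /\ neg sigma (ecomp S t)) /\
  (forall t t', t \in T -> t' \in T -> t != t' -> ~~ connect (adj S) t t').

Lemma negreps_sub T T' : T' \subset T -> negreps T -> negreps T'.
Proof. by move=> /subsetP s [h1 h2]; split=> [t /s /h1|t t' /s + /s]; [|exact: h2]. Qed.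

(** A path in [J] between two odd vertices becomes the connecting path of a barbell. Its removal
    leaves a join of the remaining representatives, so that all paths together cost at most
    [#|J|]. *)
Lemma pair_cover T J : negreps T -> (forall v, odeg J v = (v \in T)) ->
  cov sigma (\bigcup_(t in T) ecomp S t) (\sum_(t in T) #|ecomp S t| + #|J|).
Proof.
have [n] := ubnP #|T|; elim: n T J => // n IH T J lt nT hJ.
case: (set_0Vmem T) => [->|[t1 t1T]].
  by rewrite !big_set0; apply: cov_sub (cov0 _); rewrite ?sub0set.
have ot1 : odeg J t1 by rewrite hJ.
have [t2 [n21 ot2 c12]] := odd_mate ot1; rewrite hJ in ot2.
have [p [w s ep u]] := conn_path c12.
have upe := uniq_vtx_edges w u.
pose J' := J :\: eset_of p.
have sP : eset_of p \subset J by apply/subsetP=> f; rewrite inE => /s.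
have hJ' v : odeg J' v = (v \in T :\ t1 :\ t2).
  rewrite -[J'](symd_setD sP) odeg_symd hJ (odeg_eset_of _ w upe) ep !inE.
  case: (eqVneq v t2) => [->|nv2] /=; first by rewrite ot2 ?eqxx eq_sym (negPf n21).
  rewrite addbF.
  by case: (eqVneq v t1) => [->|nv1] /=; rewrite ?t1T ?eqxx //= ?addbF.
have t2T1 : t2 \in T :\ t1 by rewrite !inE n21.
have cT1 : #|T| = #|T :\ t1|.+1 by rewrite (cardsD1 t1) t1T.
have cT2 : #|T :\ t1| = #|T :\ t1 :\ t2|.+1 by rewrite (cardsD1 t2) t2T1.
have [h1 h2] := nT; have [t1S n1] := h1 _ t1T; have [t2S n2] := h1 _ ot2.
have l3 : #|T :\ t1 :\ t2| < n by move: lt; rewrite cT1 cT2 ltnS => /ltnW.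
have n3 : negreps (T :\ t1 :\ t2).
  by apply: negreps_sub nT; apply: subset_trans (subsetDl _ _) (subsetDl _ _).
have b : cov sigma (ecomp S t1 :|: ecomp S t2) (#|ecomp S t1| + #|ecomp S t2| + size p).
  apply: (barbell_cov (x := t1)) => //; try exact: ecomp_cycle.
  - by apply: ecomp_vs_disj => //; apply: h2 => //; rewrite eq_sym.
  - by rewrite vs_ecomp ?connect0.
  by rewrite ep vs_ecomp ?connect0.
apply: cov_sub (covU b (IH _ J' l3 n3 hJ')).
  by rewrite (big_setD1 t1) // (big_setD1 t2) //= setUA.
rewrite [X in _ <= X + _](big_setD1 t1) // [X in _ <= _ + X + _](big_setD1 t2) //=.
have : #|J| = size p + #|J'|.
  by rewrite -(cardsID (eset_of p) J) (setIidPr sP) card_eset_of.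
move=> ->; move: #|ecomp S t1| #|ecomp S t2| (size p) #|J'| (\sum_(_ in _) _) => k1 k2 k3 k4 k5.
clear; lia.
Qed.

End Negatives.

Definition nball X : {set V} := [set y | (y \in X) || [exists x in X, adj setT x y]].
Definition ball X r := iter r nball X.

Lemma ball_sub X r : X \subset ball X r.
Proof.
elim: r => //= r IH; apply: (subset_trans IH); apply/subsetP=> y yB; by rewrite inE yB.
Qed.

Lemma ball_walk X r y : y \in ball X r ->
  exists x p, [/\ walk x p, x \in X, wend x p = y & size p <= r].
Proof.
elim: r y => [|r IH] y /=; first by move=> yX; exists y, [::].
rewrite inE => /orP[/IH[x [p [w xX e l]]]|/exists_inP[z /IH[x [p [w xX e l]]] /adjP[f _ j]]].
  by exists x, p; split=> //; apply: leqW.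
exists x, (p ++ [:: (f, y)]); split=> //.
- by rewrite walk_cat w e /= j.
- by rewrite wend_cat.
by rewrite size_cat addn1.
Qed.

(** If the new layer were a single vertex, it would be an end of every edge of [cut X] and of
    [cut (nball X)]. These cuts are disjoint and have at least two edges each, too many for degree
    3. *)
Lemma nball_card X : X != set0 -> nball X != setT -> #|X| + 2 <= #|nball X|.
Proof.
move=> X0 NT; have sX : X \subset nball X by apply/subsetP=> y yB; rewrite inE yB.
have XT : X != setT by apply: contraNneq NT => h; rewrite -subTset -{1}h.
have N0 : nball X != set0 by apply: contraNneq X0 => h; rewrite -subset0 -h.
have c1 := tec X0 XT; have c2 := tec N0 NT.
rewrite -(cardsID X (nball X)) (setIidPr sX) leq_add2l leqNgt; apply/negP=> lt.
have nb e b : endpoint e b \in X -> endpoint e (~~ b) \in nball X.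
  move=> eX; rewrite inE; apply/orP; right; apply/exists_inP; exists (endpoint e b) => //.
  by apply/adjP; exists e; rewrite ?joins_endpoint.
have inL e : e \in cut X -> exists b, endpoint e b \in nball X :\: X.
  rewrite inE; case h1: (endpoint e false \in X); case h2: (endpoint e true \in X) => //= _.
    by exists true; rewrite inE h2 (nb e false).
  by exists false; rewrite inE h1 (nb e true).
have [e1 e1X] : exists e, e \in cut X by apply/card_gt0P; lia.
have [b1 v1] := inL _ e1X; set v := endpoint e1 b1 in v1.
have Lv u : u \in nball X :\: X -> u = v.
  move=> uL; apply/eqP; apply: contraTT lt => nuv; rewrite -leqNgt.
  have : #|[set u; v]| <= #|nball X :\: X|.
    by apply: subset_leq_card; rewrite subUset !sub1set uL.
  by rewrite cards2 nuv.
have inL2 e : e \in cut (nball X) -> exists b, endpoint e b \in nball X :\: X.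
  rewrite inE; case h1: (endpoint e false \in nball X); case h2: (endpoint e true \in nball X) => //= _.
    by exists false; rewrite inE h1 andbT; apply/negP=> /nb; rewrite h2.
  by exists true; rewrite inE h2 andbT; apply/negP=> /nb; rewrite h1.
have deg A : (forall e, e \in A -> exists b, endpoint e b \in nball X :\: X) -> #|A| <= hdeg A v.
  move=> h; rewrite hdegE -sum1_card; apply: leq_sum => e /h[b /Lv <-].
  by case: b; rewrite eqxx ?addn1.
have d : [disjoint cut X & cut (nball X)].
  apply/pred0P=> e /=; apply/negP=> /andP[].
  rewrite inE; case h1: (endpoint e false \in X); case h2: (endpoint e true \in X) => //= _.
    by rewrite inE (nb e false h1) (subsetP sX _ h1).
  by rewrite inE (nb e true h2) (subsetP sX _ h2).
have := hdeg_le3 cub (cut X :|: cut (nball X)) v; rewrite hdegU //.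
have := deg _ inL; have := deg _ inL2; move: c1 c2.
by move: #|cut X| #|cut _| (hdeg _ _) (hdeg _ _) => k1 k2 k3 k4; clear; lia.
Qed.

Lemma ball_card X r : X != set0 -> ball X r != setT -> #|X| + 2 * r <= #|ball X r|.
Proof.
move=> X0; elim: r => [|r IH] /= NT; first by rewrite muln0 addn0.
have B0 : ball X r != set0.
  by apply: contraNneq X0 => h; rewrite -subset0 -h ball_sub.
have BT : ball X r != setT.
  apply: contraNneq NT => h; rewrite -subTset; apply/subsetP=> y _.
  by rewrite inE -/(ball X r) h inE.
by have := IH BT; have := nball_card B0 NT; rewrite /ball /=; lia.
Qed.

Fact ball_arith c c' R k k' : ~ (R < c /\ R < c') -> k <= (R - c)./2 ->
  k' <= (R - c')./2 -> k + k' + minn c c' <= R.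
Proof. by clear; lia. Qed.

Fact ball_arith2 c R b : c + 2 * (R - c)./2 <= b -> R <= b.+1.
Proof. by clear; lia. Qed.

Definition close C1 C2 R := exists x p,
  [/\ walk x p, x \in vs C1, wend x p \in vs C2 & size p + minn #|C1| #|C2| <= R].

(* Otherwise the balls of radius (R - |C|)/2 around the three cycles are disjoint; each
   layer of a ball has at least two vertices, so each ball has at least R - 1. *)
Lemma three_balls C1 C2 C3 : edge_cycle C1 -> edge_cycle C2 -> edge_cycle C3 ->
  [disjoint vs C1 & vs C2] -> [disjoint vs C1 & vs C3] -> [disjoint vs C2 & vs C3] ->
  let R := #|V| %/ 3 + 2 in [\/ close C1 C2 R, close C1 C3 R | close C2 C3 R].
Proof.
move=> c1 c2 c3 d12 d13 d23 R.
pose B C := ball (vs C) ((R - #|C|)./2).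
have meet C C' : edge_cycle C -> edge_cycle C' -> [disjoint vs C & vs C'] -> ~~ [disjoint B C & B C'] ->
    close C C' R.
  move=> [eC _ _] [eC' _ _] d /pred0Pn[w /= /andP[w1 w2]].
  have [x [p [wp xC ep lp]]] := ball_walk w1; have [y [q [wq yC eq lq]]] := ball_walk w2.
  have [q' [wq' eq' _ _ sq']] := walk_rev wq; rewrite eq in wq' eq'.
  exists x, (p ++ q'); split=> //; first by rewrite walk_cat wp ep.
    by rewrite wend_cat ep eq'.
  rewrite size_cat sq'.
  (* Subtraction is truncated: if both cycles were longer than [R], both balls would be the cycles
     themselves, which are disjoint. *)
  have : ~ (R < #|C| /\ R < #|C'|).
    case=> l1 l2; move: w1 w2; rewrite /B.
    rewrite (eqP (ltnW l1 : R - #|C| == 0)) (eqP (ltnW l2 : R - #|C'| == 0)).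
    by move=> /= w1 w2; have /pred0P/(_ w) := d; rewrite /= w1 w2.
  by move=> h; apply: ball_arith h lp lq.
case m12: [disjoint B C1 & B C2]; last by apply: Or31; apply: meet; rewrite ?m12.
case m13: [disjoint B C1 & B C3]; last by apply: Or32; apply: meet; rewrite ?m13.
case m23: [disjoint B C2 & B C3]; last by apply: Or33; apply: meet; rewrite ?m23.
exfalso.
have big C C' : edge_cycle C -> edge_cycle C' -> [disjoint B C & B C'] -> R <= #|B C|.+1.
  move=> [eC C0 _] [eC' C0' _] d; have := @ball_card (vs C) ((R - #|C|)./2).
  rewrite (card_vs cub eC) -/(B C).
  have v0 : vs C != set0.
    by have [e eC1] := set0Pn _ C0; apply/set0Pn; exists (endpoint e false); apply: vs_end.
  have BT : B C != setT.
    apply/eqP=> h; have [e eC1] := set0Pn _ C0'.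
    have /pred0P/(_ (endpoint e false)) := d; rewrite /= h inE /=.
    by rewrite (subsetP (ball_sub _ _)) // vs_end.
  by move/(_ v0 BT); apply: ball_arith2.
have b1 := big _ _ c1 c2 m12; have b3 := big _ _ c3 c1; rewrite disjoint_sym in b3.
have {}b3 := b3 m13; have b2 := big _ _ c2 c3 m23.
(* Three disjoint balls of size at least [R - 1] have at least [3 * (#|V| %/ 3 + 1)] vertices, more
   than [#|V|]. The rounding of the radius accounts for the missing 1. *)
have : #|B C1| + #|B C2| + #|B C3| <= #|V|.
  have := max_card (mem (B C1 :|: B C2 :|: B C3)); rewrite -[#|mem _|]/(#|_|).
  rewrite !cardsU (disjoint_setI0 m12) setIUl (disjoint_setI0 m13) (disjoint_setI0 m23).
  by rewrite setU0 cards0 !subn0.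
rewrite /R in b1 b2 b3 *; move: b1 b2 b3; move: #|V| #|B C1| #|B C2| #|B C3| => k1 k2 k3 k4.
by clear; lia.
Qed.

(* A negative cycle t is joined to a close one t', so that t' is used twice. *)
Lemma odd_cover S T : evenset S -> negreps S T -> odd #|T| -> 2 < #|T| ->
  cov sigma (\bigcup_(t in T) ecomp S t)
    (\sum_(t in T) #|ecomp S t| + #|E| %/ 2 + (#|V| %/ 3 + 2)).
Proof.
move=> eS nT oT T3; have [h1 h2] := nT.
suff [t [t' [tT t'T ntt [x [p [w xC yC l]]]]]] : exists t t', [/\ t \in T, t' \in T, t != t' &
    exists x p, [/\ walk x p, x \in vs (ecomp S t), wend x p \in vs (ecomp S t') &
      size p + #|ecomp S t'| <= #|V| %/ 3 + 2]].
  have [tS nt] := h1 _ tT; have [t'S nt'] := h1 _ t'T.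
  have oT' : ~~ odd #|T :\ t| by move: oT; rewrite (cardsD1 t) tT.
  have [J [hJ lJ]] := half_tjoin oT'.
  have cv := pair_cover eS (negreps_sub (subsetDl T [set t]) nT) hJ.
  have b := barbell_cov (ecomp_cycle eS tS) (ecomp_cycle eS t'S) nt nt'
    (ecomp_vs_disj tS t'S (h2 _ _ tT t'T ntt)) w xC yC.
  apply: cov_sub (covU b cv).
    by rewrite (big_setD1 t) //= -setUA setUS // subsetUr.
  rewrite [X in _ <= X + _ + _](big_setD1 t) //=.
  move: lJ l; move: #|ecomp S t| #|ecomp S t'| (size p) #|J| #|E| (#|V| %/ 3 + 2).
  by move: (\sum_(_ in _) _) => k1 k2 k3 k4 k5 k6 k7; clear; lia.
(* The shorter of the two cycles is the one used twice; hence the minimum in [close]. *)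
have wlog t t' : t \in T -> t' \in T -> t != t' -> close (ecomp S t) (ecomp S t') (#|V| %/ 3 + 2) ->
   exists t t', [/\ t \in T, t' \in T, t != t' &
    exists x p, [/\ walk x p, x \in vs (ecomp S t), wend x p \in vs (ecomp S t') &
      size p + #|ecomp S t'| <= #|V| %/ 3 + 2]].
  move=> tT t'T ntt [x [p [w xC yC l]]].
  case: (leqP #|ecomp S t'| #|ecomp S t|) => c.
    exists t, t'; split=> //; exists x, p; split=> //.
    by move: l; rewrite minnC (minn_idPl c).
  exists t', t; split=> //; first by rewrite eq_sym.
  have [q [wq eq _ _ sq]] := walk_rev w; exists (wend x p), q; split=> //; first by rewrite eq.
  by move: l; rewrite sq (minn_idPl (ltnW c)).
have [t1 t1T] : exists t, t \in T by apply/card_gt0P; lia.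
have [t2 t2T] : exists t, t \in T :\ t1.
  by apply/card_gt0P; move: T3; rewrite (cardsD1 t1) t1T; lia.
have [t3 t3T] : exists t, t \in T :\ t1 :\ t2.
  by apply/card_gt0P; move: T3; rewrite (cardsD1 t1) t1T (cardsD1 t2 (T :\ t1)) t2T; lia.
move: t2T t3T; rewrite !inE => /andP[n21 t2T] /and3P[n32 n31 t3T].
have iC t : t \in T -> edge_cycle (ecomp S t) by move=> /h1[tS _]; apply: ecomp_cycle.
have dj t t' : t \in T -> t' \in T -> t' != t -> [disjoint vs (ecomp S t) & vs (ecomp S t')].
  move=> tT t'T n; have [tS _] := h1 _ tT; have [t'S _] := h1 _ t'T.
  by apply: ecomp_vs_disj => //; apply: h2 => //; rewrite eq_sym.
have [] := three_balls (iC _ t1T) (iC _ t2T) (iC _ t3T) (dj _ _ t1T t2T n21)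
  (dj _ _ t1T t3T n31) (dj _ _ t2T t3T n32); apply: wlog => //; by rewrite eq_sym.
Qed.

End Cubic.

(** * Covering a single negative cycle *)

Section Potentials.
Variable G : graph.
Notation E := (edge G).
Notation V := (vertex G).
Implicit Types (A B C D K Z : {set E}) (e : E) (x y z v : V) (p q : seq (E * V)).
Variable sigma : signature G.

(** Harary's balance criterion: [h v] is the sign of a path from the representative of the component
    to [v], and the paths to the two ends of an edge form an even set together with it. *)
Lemma potential K : (forall Z, evenset Z -> Z \subset K -> ~~ neg sigma Z) ->
  exists h : V -> bool, forall e, e \in K ->
    sigma e = h (endpoint e false) (+) h (endpoint e true).
Proof.
move=> hK; pose r := fingraph.root (adj K).
have /fin_all_exists[A hA] v : exists B, B \subset K /\ forall w, odeg B w = (r v == w) (+) (v == w).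
  by apply: conn_join; rewrite conn_sym; apply: connect_root.
exists (fun v => neg sigma (A v)) => e eK.
set x := endpoint e false; set y := endpoint e true.
have rxy : r x = r y.
  by apply/eqP; rewrite (root_connect (conn_sym K)); apply: conn_ends.
have [[sx ox] [sy oy]] := (hA x, hA y).
pose Z := symd (symd (A x) (A y)) [set e].
have eZ : evenset Z.
  move=> w; rewrite !odeg_symd ox oy rxy /odeg xsum1 /inc -/x -/y.
  by case: (_ == w); case: (x == w); case: (y == w).
have := hK Z eZ; rewrite !symd_sub ?sub1set // => /(_ isT).
rewrite /neg !xsum_symd xsum1.
by case: (xsum _ _); case: (xsum _ _); case: (sigma e).
Qed.

Lemma neg_walk K (h : V -> bool) x p :
  (forall e, e \in K -> sigma e = h (endpoint e false) (+) h (endpoint e true)) ->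
  walk x p -> {subset unzip1 p <= K} -> uniq (unzip1 p) ->
  neg sigma (eset_of p) = h x (+) h (wend x p).
Proof.
move=> hK w s u; rewrite /neg xsum_eset_of //; elim: p x w s {u} => [|[e z] p IH] x /=.
  by rewrite big_nil /wend addbb.
case/andP=> j w s; rewrite big_cons (IH z w) => [|f fp]; last by apply: s; rewrite inE fp orbT.
rewrite hK ?s ?mem_head // /wend /=.
case/orP: j => /andP[/eqP-> /eqP->]; case: (h x); case: (h z); by case: (h _).
Qed.

End Potentials.

Section Single.
Variable G : graph.
Notation E := (edge G).
Notation V := (vertex G).
Implicit Types (A B C D K Z : {set E}) (X Y T : {set V}) (e : E) (u v w x y z : V)
  (p q : seq (E * V)).
Hypothesis cub : cubic G.
Hypothesis tec : forall X : {set V}, X != set0 -> X != setT -> 1 < #|cut X|.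
Variable sigma : signature G.

Lemma even_vs_disj A B : evenset A -> evenset B -> [disjoint A & B] -> [disjoint vs A & vs B].
Proof.
move=> eA eB d; apply/pred0P=> v /=; apply/negP=> /andP[vA vB].
by have := hdeg_le3 cub (A :|: B) v; rewrite hdegU // !(even_hdeg cub).
Qed.

Lemma neg_cycle Z : evenset Z -> neg sigma Z ->
  exists Q : {set E}, [/\ Q \subset Z, edge_cycle Q & neg sigma Q].
Proof.
have [n] := ubnP #|Z|; elim: n Z => // n IH Z lt eZ nZ.
have [e eZ'] : exists e, e \in Z.
  by case: (set_0Vmem Z) nZ => [->|[e] ? _]; [rewrite /neg xsum0 | exists e].
have xZ := vs_end false eZ'; set x := endpoint e false in xZ.
have iC := ecomp_cycle eZ xZ; have sC := ecomp_sub Z x.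
case nC: (neg sigma (ecomp Z x)); first by exists (ecomp Z x).
have [|||Q [sQ iQ nQ]] := IH (Z :\: ecomp Z x).
- have : #|Z :\: ecomp Z x| < #|Z|; last by lia.
  apply: proper_card; apply/properP; split; first exact: subsetDl.
  by exists e => //; rewrite !inE eZ' connect0.
- by rewrite -symd_setD //; apply: even_symd => //; case: iC.
- by rewrite -symd_setD // /neg xsum_symd -/(neg sigma _) nZ -/(neg sigma _) nC.
by exists Q; split=> //; apply: subset_trans sQ (subsetDl _ _).
Qed.

(** Cycles have as many edges as vertices and the path has one edge more than inner vertices, so the
    barbell has one edge more than vertices. *)
Lemma barbell_small C1 C2 : edge_cycle C1 -> edge_cycle C2 -> neg sigma C1 -> neg sigma C2 ->
  [disjoint vs C1 & vs C2] -> cov sigma (C1 :|: C2) #|V|.+1.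
Proof.
move=> c1 c2 n1 n2 d.
have [[e1 e1C] [e2 e2C]] : (exists e, e \in C1) /\ (exists e, e \in C2).
  by case: c1 c2 => [_ /set0Pn h _] [_ /set0Pn h' _].
have [x1 x2] := (vs_end false e1C, vs_end false e2C).
have [p [w _ ep]] := conn_walk (connT tec (endpoint e1 false) (endpoint e2 false)).
rewrite -ep in x2.
have [x' [p' [w' _ x1' y2' [u' s' h1 h2]]]] := minwalk w (fun e _ => in_setT e) x1 x2.
apply: (cov_circuit (barbell_circuit cub c1 c2 n1 n2 d w' u' x1' y2' h1 h2)).
  exact: subsetUl.
have lc : #|C1 :|: C2 :|: eset_of p'| <= #|C1| + #|C2| + size p'.
  rewrite (leq_trans (leq_card_setU _ _)) // leq_add ?leq_card_setU //.
  exact: card_eset_of_le.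
apply: (leq_trans lc).
case: c1 c2 => eC1 _ _ [eC2 _ _]; rewrite -(card_vs cub eC1) -(card_vs cub eC2).
pose P := [set z in vtx x' p'].
have cP : #|P| = (size p').+1 by rewrite cardsE (card_uniqP u') /= size_map.
have := max_card (mem (vs C1 :|: vs C2 :|: P)); rewrite -[#|mem _|]/(#|_|).
rewrite !cardsU (disjoint_setI0 d) cards0 subn0 cP.
have : #|(vs C1 :|: vs C2) :&: P| <= 2.
  apply: leq_trans (_ : #|[set x'; wend x' p']| <= _); last by rewrite cards2; case: eqP.
  apply: subset_leq_card; apply/subsetP=> z; rewrite inE => /andP[zC]; rewrite in_set => zP.
  by case/setUP: zC => zC; rewrite !inE; [rewrite -(h1 z zP zC) eqxx | rewrite -(h2 z zP zC) eqxx orbT].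
lia.
Qed.

Variable D : {set E}.
Hypotheses (cD : edge_cycle D) (nD : neg sigma D).
Let O := ~: D.
Let eD : evenset D. Proof. by case: cD. Qed.

Section Arcs.
Variable h : V -> bool.
Hypothesis hO : forall e, e \in O -> sigma e = h (endpoint e false) (+) h (endpoint e true).

(* The arc of D which a walk from u to v outside D completes to a positive cycle. *)
Definition isarc B u v :=
  [&& B \subset D, [forall w, odeg B w == (u == w) (+) (v == w)] & neg sigma B == h u (+) h v].

(** As [D] is negative, its two arcs between [u] and [v] have opposite signs and exactly one
    qualifies; for [u = v] it is the empty arc. The default is never reached for vertices of [D]. *)
Definition arcB u v : {set E} := odflt set0 [pick B | isarc B u v].

Lemma arc_uniq B B' u v : isarc B u v -> isarc B' u v -> B = B'.
Proof.
move=> /and3P[s /forallP o /eqP n] /and3P[s' /forallP o' /eqP n'].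
have eZ : evenset (symd B B') by move=> w; rewrite odeg_symd (eqP (o w)) (eqP (o' w)) addbb.
have nZ : neg sigma (symd B B') = false by rewrite /neg xsum_symd -!/(neg sigma _) n n' addbb.
case: (set_0Vmem (symd B B')) => [Z0|[e eZ']].
  apply/setP=> e; have := in_symd B B' e; rewrite Z0 inE.
  by case: (e \in B); case: (e \in B').
have ZD : symd B B' = D.
  by apply: edge_cycle_min => //; [apply: symd_sub | apply/set0Pn; exists e].
by rewrite ZD nD in nZ.
Qed.

Lemma arcP u v : u \in vs D -> v \in vs D -> isarc (arcB u v) u v.
Proof.
move=> uD vD; rewrite /arcB; case: pickP => //= none.
case: cD => _ _ /(_ u v uD vD) /conn_join[B [sB oB]].
have oD : [forall w, odeg (symd D B) w == (u == w) (+) (v == w)].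
  by apply/forallP=> w; rewrite odeg_symd eD oB.
have := none B; have := none (symd D B); rewrite /isarc sB oD symd_sub //=.
rewrite (introT forallP) /= => [|w]; last by rewrite oB.
by rewrite /neg xsum_symd -!/(neg sigma _) nD; case: (neg sigma B); case: (h u); case: (h v).
Qed.

Lemma arc_sub u v : u \in vs D -> v \in vs D -> arcB u v \subset D.
Proof. by move=> uD vD; have /and3P[] := arcP uD vD. Qed.

Lemma odeg_arc u v w : u \in vs D -> v \in vs D -> odeg (arcB u v) w = (u == w) (+) (v == w).
Proof. by move=> uD vD; have /and3P[_ /forallP/(_ w)/eqP] := arcP uD vD. Qed.

Lemma neg_arc u v : u \in vs D -> v \in vs D -> neg sigma (arcB u v) = h u (+) h v.
Proof. by move=> uD vD; have /and3P[_ _ /eqP] := arcP uD vD. Qed.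

(** Prescribed ends and prescribed sign are additive over GF(2), so the symmetric difference
    qualifies as the arc from [u] to [w]. *)
Lemma arc_add u v w : u \in vs D -> v \in vs D -> w \in vs D ->
  symd (arcB u v) (arcB v w) = arcB u w.
Proof.
move=> uD vD wD; apply: (@arc_uniq _ _ u w); last exact: arcP.
apply/and3P; split; first by rewrite symd_sub ?arc_sub.
  apply/forallP=> z; rewrite odeg_symd !odeg_arc //.
  by case: (u == z); case: (v == z); case: (w == z).
rewrite /neg xsum_symd -!/(neg sigma _) !neg_arc //.
by case: (h u); case: (h v); case: (h w).
Qed.

Lemma arcC u v : u \in vs D -> v \in vs D -> arcB u v = arcB v u.
Proof.
move=> uD vD; apply: (@arc_uniq _ _ u v); first exact: arcP.
have /and3P[h1 /forallP h2 h3] := arcP vD uD; apply/and3P; split=> //.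
  by apply/forallP=> w; rewrite (eqP (h2 w)) addbC.
by rewrite (eqP h3) addbC.
Qed.

Lemma arcuu u : u \in vs D -> arcB u u = set0.
Proof.
move=> uD; apply: (@arc_uniq _ _ u u); first exact: arcP.
apply/and3P; split; rewrite ?sub0set //; last by rewrite /neg xsum0 addbb.
by apply/forallP=> w; rewrite addbb; apply/eqP/even0.
Qed.

Lemma arc_proper u v : u \in vs D -> v \in vs D -> arcB u v != D.
Proof.
move=> uD vD; apply: contraTneq nD => e; have := odeg_arc v uD vD; rewrite e eD eqxx.
by case: eqP => // uv _; rewrite -e -uv arcuu // /neg xsum0.
Qed.

Lemma arc_walk u v : u \in vs D -> v \in vs D -> u != v ->
  exists q, [/\ walk u q, uniq (vtx u q), wend u q = v & eset_of q = arcB u v].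
Proof.
move=> uD vD nuv; have o w := odeg_arc w uD vD.
have ou : odeg (arcB u v) u by rewrite o eqxx eq_sym (negPf nuv).
have [v' [nv' ov' c]] := odd_mate ou.
have ev : v' = v.
  by move: ov'; rewrite o eq_sym (negPf nv') /= => /eqP.
subst v'; have [q [w s eq uq]] := conn_path c; exists q; split=> //.
have sq : eset_of q \subset arcB u v by apply/subsetP=> f; rewrite inE => /s.
have upe := uniq_vtx_edges w uq.
have eZ : evenset (symd (arcB u v) (eset_of q)).
  by move=> z; rewrite odeg_symd o (odeg_eset_of _ w upe) eq addbb.
have sD : symd (arcB u v) (eset_of q) \subset D.
  by rewrite symd_sub ?(subset_trans sq) ?arc_sub.
case: (set_0Vmem (symd (arcB u v) (eset_of q))) => [Z0|[e eZ']].
  apply/setP=> e; have := in_symd (arcB u v) (eset_of q) e; rewrite Z0 in_set0.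
  by case: (e \in arcB u v); case: (e \in eset_of q).
have ZD := edge_cycle_min cub cD eZ sD (introT (set0Pn _) (ex_intro _ e eZ')).
have := arc_proper uD vD; rewrite eqEsubset arc_sub //= -ZD symd_setD //.
by rewrite subsetDl.
Qed.

(** The potential gives every path off [D] from [u] to [v] the sign [h u (+) h v], which is the sign
    of the arc; together they form a positive cycle. *)
Lemma ear_cov u v p : u \in vs D -> v \in vs D -> u != v -> walk u p ->
  {subset unzip1 p <= O} -> wend u p = v -> cov sigma (arcB u v) (size p + #|arcB u v|).
Proof.
move=> uD vD nuv w s ep.
have vY : wend u p \in [set v] by rewrite ep set11.
have [u' [p' [w' sp u'u ev [up lp _ _]]]] := minwalk w s (set11 u) vY.
move: u'u ev; rewrite !inE => /eqP eu /eqP ev; subst u'.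
have upe := uniq_vtx_edges w' up.
have [q [wq uq eq Bq]] := arc_walk uD vD nuv.
have sPO : eset_of p' \subset O by apply/subsetP=> f; rewrite inE => /sp.
have d : [disjoint eset_of p' & arcB u v].
  apply/pred0P=> f /=; apply/negP=> /andP[/(subsetP sPO) fO /(subsetP (arc_sub uD vD)) fD].
  by move: fO; rewrite inE fD.
pose X := eset_of p' :|: arcB u v.
have eX : evenset X.
  move=> z; rewrite /X -symd_disj // odeg_symd (odeg_eset_of _ w' upe) ev odeg_arc //.
  exact: addbb.
have nX : ~~ neg sigma X.
  rewrite /neg /X -symd_disj // xsum_symd -!/(neg sigma _) (neg_walk hO w' sp upe) ev neg_arc //.
  by rewrite addbb.
have cX z : z \in vs X -> connect (adj X) u z.
  rewrite vsU => /setUP[] /vsP[e [b [ePB <-]]].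
    apply: conn_sub (subsetUl _ _) _; apply: (walk_conn w') => [f fp|]; first by rewrite inE.
    by apply: walk_ends w' _; move: ePB; rewrite inE.
  apply: conn_sub (subsetUr _ _) _; rewrite -Bq in ePB *.
  apply: (walk_conn wq) => [f fp|]; first by rewrite inE.
  by apply: walk_ends wq _; move: ePB; rewrite inE.
have iX : edge_cycle X.
  split=> //; last by move=> x y /cX h1 /cX; apply: connect_trans; rewrite conn_sym.
  apply/eqP=> X0; have := odeg_arc u uD vD; rewrite (_ : arcB u v = set0).
    by rewrite even0 eqxx eq_sym (negPf nuv).
  by apply/eqP; rewrite -subset0 -X0 subsetUr.
apply: (cov_circuit (pos_circuit cub iX nX)); first exact: subsetUr.
by rewrite (leq_trans (leq_card_setU _ _)) // leq_add2r (leq_trans (card_eset_of_le _)).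
Qed.

(* If no even arc contains e0, switching along the linked classes leaves e0 as the
   only negative edge. *)
Lemma arcs_cover :
  (forall (g : V -> bool) e0, exists2 e, e != e0 &
     sigma e != g (endpoint e false) (+) g (endpoint e true)) ->
  forall e0, e0 \in D -> exists u v,
    [/\ u \in vs D, v \in vs D, connect (adj O) u v & e0 \in arcB u v].
Proof.
move=> far e0 e0D.
case: (boolP [exists u in vs D, [exists v in vs D, connect (adj O) u v && (e0 \in arcB u v)]]).
  by case/exists_inP=> u uD /exists_inP[v vD /andP[c e0B]]; exists u, v.
move=> none; exfalso.
have no u v : u \in vs D -> v \in vs D -> connect (adj O) u v -> e0 \notin arcB u v.
  move=> uD vD c; apply: contra none => e0B; apply/exists_inP; exists u => //.
  by apply/exists_inP; exists v; rewrite // c.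
have [|g hg] := @potential _ sigma (D :\ e0).
  move=> Z eZ sZ; case: (set_0Vmem Z) => [->|[e eZ']]; first by rewrite /neg xsum0.
  have ZD := edge_cycle_min cub cD eZ (subset_trans sZ (subsetDl _ _)) (introT (set0Pn _) (ex_intro _ e eZ')).
  by have := subsetP sZ e0; rewrite ZD e0D !inE eqxx => /(_ isT).
have kap u v : u \in vs D -> v \in vs D -> connect (adj O) u v ->
    g u (+) h u = g v (+) h v.
  move=> uD vD c; case: (eqVneq u v) => [-> //|nuv].
  have [q [wq uq eq Bq]] := arc_walk uD vD nuv.
  have := neg_arc uD vD; rewrite -Bq (neg_walk hg wq _ (uniq_vtx_edges wq uq)) ?eq.
    by case: (g u); case: (g v); case: (h u); case: (h v).
  move=> f fq; have fB : f \in arcB u v by rewrite -Bq inE.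
  rewrite in_setD1 (subsetP (arc_sub uD vD)) // andbT.
  by apply: contraNneq (no _ _ uD vD c) => <-.
(* By [kap] the difference of [g] and [h] is the same at all vertices of [D] linked to [w]. Adding
   it to [h] leaves [h] a potential off [D] and turns it into [g] on [D]. *)
pose cl w := [exists u in vs D, connect (adj O) w u && (g u (+) h u)].
have [e ne] := far (fun w => h w (+) cl w) e0; case/negP; apply/eqP.
case eD': (e \in D).
  have cw w : w \in vs D -> h w (+) cl w = g w.
    move=> wD; suff -> : cl w = g w (+) h w by case: (h w); case: (g w).
    apply/exists_inP/idP=> [[u uD /andP[l]]|k]; first by rewrite (kap w u).
    by exists w; rewrite ?connect0.
  by rewrite !cw ?vs_end // hg // in_setD1 ne.
have eO : e \in O by rewrite inE eD'.
have -> : cl (endpoint e true) = cl (endpoint e false).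
  apply: eq_existsb => u; congr (_ && (_ && _)).
  have l := conn_ends eO; have l' : connect (adj O) (endpoint e true) (endpoint e false) by rewrite conn_sym.
  by apply/idP/idP; apply: connect_trans.
by rewrite hO // addbACA addbb addbF.
Qed.

End Arcs.
End Single.

(** * Three ears through one component outside [D] *)

Section Single.
Variable G : graph.
Notation E := (edge G).
Notation V := (vertex G).
Implicit Types (A B C K Z Q : {set E}) (X Y T U : {set V}) (e f : E) (u v w x y z : V)
  (p q : seq (E * V)).
Hypothesis cub : cubic G.
Variable sigma : signature G.
Variable D : {set E}.
Hypotheses (cD : edge_cycle D) (nD : neg sigma D).
Let O := ~: D.
Let eD : evenset D. Proof. by case: cD. Qed.

Lemma cycle_tour A x : edge_cycle A -> x \in vs A -> exists p,
  [/\ walk x p, wend x p = x, {subset unzip1 p <= A}, size p = #|A| &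
      forall y, y \in vs A -> y \in vtx x p].
Proof.
move=> iA xA; have [eA _ _] := iA; have [e [b [eA' hb]]] := vsP _ _ xA.
pose y := endpoint e (~~ b).
have je : joins e x y by rewrite -hb joins_endpoint.
suff [r [wr er sr ur Ar]] : exists r, [/\ walk y r, wend y r = x, {subset unzip1 r <= A :\ e},
    uniq (unzip1 r) & e |: eset_of r = A].
  exists ((e, y) :: r); split=> //=; first by rewrite je.
  - move=> f; rewrite inE => /orP[/eqP-> //|/sr]; by rewrite inE => /andP[].
  - rewrite -Ar cardsU1 card_eset_of // (_ : e \notin _) //.
    by apply/negP; rewrite inE => /sr; rewrite !inE eqxx.
  move=> z /vsP[f [c [fA <-]]].
  have fp : f \in unzip1 ((e, y) :: r).
    by move: fA; rewrite -Ar !inE.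
  by apply: walk_ends fp; rewrite /= je.
case: (eqVneq x y) => [xy|nxy].
  exists [::]; split=> //.
  rewrite (_ : eset_of _ = set0) ?setU0; last by apply/setP=> f; rewrite !inE.
  apply: (edge_cycle_min cub iA); rewrite ?sub1set //; last by apply/set0Pn; exists e; rewrite inE.
  by move=> z; rewrite /odeg xsum1 (joins_inc _ je) xy addbb.
have oB z : odeg (A :\ e) z = (x == z) (+) (y == z).
  rewrite -symd_setD ?sub1set // odeg_symd eA /odeg xsum1; exact: joins_inc je.
have oy : odeg (A :\ e) y by rewrite oB eqxx (negPf nxy).
have [x' [nx' ox' c]] := odd_mate oy.
have xx : x = x' by move: ox'; rewrite oB [y == x']eq_sym (negPf nx') addbF => /eqP.
subst x'; have [r [wr sr er ur]] := conn_path c; have ue := uniq_vtx_edges wr ur.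
exists r; split=> //.
have eN : e \notin eset_of r by apply/negP; rewrite inE => /sr; rewrite !inE eqxx.
have rA : eset_of r \subset A.
  by apply/subsetP=> f; rewrite inE => /sr; rewrite inE => /andP[].
apply: (edge_cycle_min cub iA).
- rewrite -symd_disj ?disjoints1 // => z; rewrite odeg_symd (odeg_eset_of _ wr ue) er.
  by rewrite /odeg xsum1 (joins_inc _ je); case: (x == z); case: (y == z).
- by rewrite subUset sub1set eA'.
by apply/set0Pn; exists e; rewrite setU11.
Qed.

Lemma interior_notD u p y : walk u p -> uniq (vtx u p) -> {subset unzip1 p <= O} ->
  y \in vtx u p -> y != u -> y != wend u p -> y \notin vs D.
Proof.
move=> w up s yp nu nz; have ue := uniq_vtx_edges w up.
have [p1 [p2 [ep e1]]] := vtx_split yp; subst p.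
case/lastP: p1 => [|p1 [e1' y1]] in w up s ue e1 nz yp *.
  by rewrite /wend /= in e1; rewrite e1 eqxx in nu.
case: p2 => [|[e2 y2] p2] in w up s ue nz yp *.
  by rewrite cats0 e1 eqxx in nz.
move: e1; rewrite -cats1 wend_cat /wend /= => e1; subst y1.
move: w; rewrite -cats1 -catA walk_cat /= => /and3P[_ j1 /andP[j2 _]].
have ne : e1' != e2.
  move: ue; rewrite -cats1 -catA /unzip1 map_cat cat_uniq /= => /and3P[_ _ /andP[+ _]].
  by rewrite inE negb_or => /andP[].
have nD1 : e1' \notin D.
  by have := s e1'; rewrite inE; apply; rewrite -cats1 -catA /unzip1 map_cat mem_cat mem_head orbT.
have nD2 : e2 \notin D.
  have := s e2; rewrite inE; apply.
  by rewrite -cats1 -catA /unzip1 map_cat mem_cat /= !inE eqxx !orbT.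
have [b1 [_ h1]] := joins_end j1; have [b2 [h2 _]] := joins_end j2.
by rewrite -h1; apply: (leaf cub (b' := b2) eD nD1 nD2 ne); rewrite h1 h2.
Qed.

Definition reach u v n := exists p,
  [/\ walk u p, {subset unzip1 p <= O}, wend u p = v & size p <= n].

Lemma reachC u v n : reach u v n -> reach v u n.
Proof.
case=> p [w s e l]; have [q [w' e' u1 _ sq]] := walk_rev w; rewrite e in w' e'.
by exists q; split=> //; rewrite ?sq // => f; rewrite u1 mem_rev; apply: s.
Qed.

Section Tour.
Variable RS : {set E}.
Hypotheses (eR : evenset RS) (sR : RS \subset O)
  (R4 : forall x, x \in vs RS -> 4 <= #|ecomp RS x|).
Variables u0 v0 w0 : V.
Hypothesis uD : u0 \in vs D.
Hypotheses (luv : connect (adj O) u0 v0) (luw : connect (adj O) u0 w0).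
Let Al := ~: vs D :|: [set u0; v0; w0].

Lemma RS_D x : x \in vs RS -> x \notin vs D.
Proof.
move=> xR; have d : [disjoint RS & D].
  by apply/pred0P=> f /=; apply/negP=> /andP[/(subsetP sR)]; rewrite inE => /negP.
by apply/negP=> xD; have /pred0P/(_ x) := even_vs_disj cub eR eD d; rewrite /= xR xD.
Qed.

(* The closed walk runs twice along a tree and once around each cycle of RS; such a
   cycle has at least 4 vertices, so a vertex of it costs 3/2 instead of 2. *)
Definition toured U := exists x c,
  [/\ [/\ walk x c, wend x c = x & {subset unzip1 c <= O}],
      (forall y, y \in U -> y \in vtx x c), U \subset Al,
      (forall y, y \in U -> y \in vs RS -> vs (ecomp RS y) \subset U) &
      2 * size c + 4 <= 4 * #|U :\: vs RS| + 3 * #|U :&: vs RS|].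

Lemma toured1 : toured [set u0].
Proof.
have uR : u0 \notin vs RS by apply: contraL uD; apply: RS_D.
exists u0, [::]; split=> //.
- by move=> y /set1P->; rewrite inE.
- by rewrite sub1set !inE eqxx orbT.
- by move=> y /set1P-> h; rewrite h in uR.
rewrite (_ : _ :\: _ = [set u0]) ?cards1 //.
by apply/setP=> y; rewrite in_setD in_set1; case: eqP => [->|]; rewrite ?uR ?andbF.
Qed.

Lemma toured_step U a b f : toured U -> a \in U -> b \notin U -> b \in Al ->
  f \in O -> joins f a b -> exists U', U \proper U' /\ toured U'.
Proof.
move=> [x [c [[wc ec sc] hU sU cl le]]] aU bU bA fO j.
have [c1 [c2 [ec12 e1]]] := vtx_split (hU a aU); subst c.
have ins r : walk b r -> wend b r = b -> {subset unzip1 r <= O} ->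
  let c' := c1 ++ (f, b) :: r ++ (f, a) :: c2 in
  [/\ [/\ walk x c', wend x c' = x & {subset unzip1 c' <= O}],
    forall y, y \in vtx x (c1 ++ c2) -> y \in vtx x c',
    forall y, y \in vtx b r -> y \in vtx x c' & size c' = size (c1 ++ c2) + (size r).+2].
  move=> wr er sr c'; move: wc ec; rewrite walk_cat wend_cat e1 => /andP[w1 w2] ec.
  split.
  - split.
    + by rewrite walk_cat w1 e1 /= j walk_cat er wr /= joinsC j.
    + rewrite wend_cat e1 (_ : wend a _ = wend b (r ++ (f, a) :: c2)) // wend_cat er.
      exact: ec.
    move=> g; rewrite /c' /unzip1 map_cat /= map_cat /= mem_cat inE mem_cat inE.
    have s1 g' : g' \in unzip1 c1 -> g' \in O.
      by move=> h; apply: sc; rewrite /unzip1 map_cat mem_cat [g' \in map _ c1]h.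
    have s2 g' : g' \in unzip1 c2 -> g' \in O.
      by move=> h; apply: sc; rewrite /unzip1 map_cat mem_cat [g' \in map _ c2]h orbT.
    by case/or3P=> [/s1|/eqP->|/or3P[/sr|/eqP->|/s2]].
  - move=> y; rewrite !mem_vtx_cat => /orP[->//|h].
    have h' : y \in unzip2 ((f, a) :: c2) by rewrite inE h orbT.
    by rewrite h' !orbT.
  - by move=> y; rewrite !mem_vtx_cat => ->; rewrite orbT.
  by rewrite /c' !size_cat /= size_cat /= !addnS -!addnA [size r + _]addnC.
case bR: (b \in vs RS); last first.
  have [|h1 h2 h3 h4] := ins [::] isT erefl; first by [].
  exists (b |: U); split.
    by apply/properP; split; [apply: subsetUr | exists b; rewrite ?setU11].
  exists x, (c1 ++ (f, b) :: [::] ++ (f, a) :: c2); split=> //.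
  - by move=> y /setU1P[->|/hU/h2 //]; apply: h3; rewrite inE.
  - by rewrite subUset sub1set bA.
  - move=> y /setU1P[->|yU yR]; first by rewrite bR.
    by apply: (subset_trans (cl y yU yR)); apply: subsetUr.
  have -> : (b |: U) :\: vs RS = b |: (U :\: vs RS).
    by apply/setP=> y; rewrite !in_setD !in_setU1 !in_setD; case: eqP => [->|]; rewrite ?bR.
  have -> : (b |: U) :&: vs RS = U :&: vs RS.
    by apply/setP=> y; rewrite !in_setI !in_setU1; case: eqP => [->|]; rewrite ?bR ?andbF.
  rewrite cardsU1 in_setD (negPf bU) andbF h4 /=.
  move: le; move: (size _) #|_| #|_| => k1 k2 k3; clear; lia.
have iQ := ecomp_cycle eR bR; set Q := ecomp RS b in iQ.
have sQR : Q \subset RS := ecomp_sub RS b.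
have bQ : b \in vs Q by rewrite vs_ecomp ?connect0.
have [r [wr er sr szr hr]] := cycle_tour iQ bQ.
have [|h1 h2 h3 h4] := ins r wr er; first by move=> g /sr /(subsetP sQR) /(subsetP sR).
have QU y : y \in vs Q -> y \notin U.
  move=> yQ; have yR := subsetP (vs_sub sQR) y yQ.
  move: yQ; rewrite vs_ecomp // => cby; apply: contra bU => yU.
  by apply: (subsetP (cl y yU yR)); rewrite vs_ecomp // conn_sym.
exists (vs Q :|: U); split.
  apply/properP; split; first exact: subsetUr.
  by exists b => //; rewrite in_setU bQ.
exists x, (c1 ++ (f, b) :: r ++ (f, a) :: c2); split=> //.
- by move=> y /setUP[/hr/h3|/hU/h2].
- rewrite subUset sU andbT; apply/subsetP=> y yQ; rewrite in_setU in_setC.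
  by rewrite RS_D // (subsetP (vs_sub sQR)).
- move=> y /setUP[yQ _|yU yR]; last by apply: (subset_trans (cl y yU yR)); apply: subsetUr.
  rewrite (_ : ecomp RS y = Q) ?subsetUl //; apply/esym/ecomp_eq.
  by move: yQ; rewrite vs_ecomp.
have -> : (vs Q :|: U) :\: vs RS = U :\: vs RS.
  apply/setP=> y; rewrite !in_setD !in_setU; case yR: (y \in vs RS) => //=.
  by case yQ: (y \in vs Q) => //; rewrite (subsetP (vs_sub sQR)) in yR.
have -> : #|(vs Q :|: U) :&: vs RS| = #|Q| + #|U :&: vs RS|.
  have [eQ _ _] := iQ; rewrite setIUl (setIidPl (vs_sub sQR)) cardsU (card_vs cub eQ).
  rewrite (_ : vs Q :&: (U :&: vs RS) = set0) ?cards0 ?subn0 //; apply/setP=> y; rewrite !in_setI in_set0.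
  by case yQ: (y \in vs Q) => //=; rewrite (negPf (QU _ yQ)).
(* The detour around [Q] adds [#|Q| + 2] steps; twice this number is at most [3 * #|Q|] precisely
   when [#|Q|] is at least 4. *)
have q4 : 4 <= #|Q| := R4 bR.
rewrite h4 szr; move: le q4; move: (size _) #|Q| #|_| #|_| => k1 k2 k3 k4; clear; lia.
Qed.

Lemma toured_grow U z : toured U -> u0 \in U -> z \in [set v0; w0] -> z \notin U ->
  exists U', U \proper U' /\ toured U'.
Proof.
move=> tU uU zvw zU.
have [p [w s ez up]] : exists p, [/\ walk u0 p, {subset unzip1 p <= O}, wend u0 p = z & uniq (vtx u0 p)].
  by apply: conn_path; move: zvw; rewrite !inE => /orP[] /eqP->.
have pA y : y \in vtx u0 p -> y \in Al.
  move=> yp; rewrite in_setU in_setC; apply/orP.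
  case: (eqVneq y u0) => [->|nu]; first by right; rewrite !inE eqxx.
  case: (eqVneq y z) => [->|nz]; first by right; move: zvw; rewrite !inE -orbA => ->; rewrite orbT.
  by left; apply: (interior_notD w up s yp nu); rewrite ez.
have [a [b [f [aU bU bp fO j]]]] : exists a b f,
    [/\ a \in U, b \notin U, b \in vtx u0 p, f \in O & joins f a b].
  have zU' : wend u0 p \notin U by rewrite ez.
  elim: (p) (u0) uU w s zU' => [|[f b] r IH] x xU /=; first by rewrite /wend /= xU.
  case/andP=> j wr s zU'; case bU: (b \in U).
    have [|a [b' [f' [h1 h2 h3 h4 h5]]]] := IH b bU wr _ zU'.
      by move=> g gr; apply: s; rewrite inE gr orbT.
    by exists a, b', f'; split=> //; rewrite inE h3 orbT.
  exists x, b, f; split=> //; first by rewrite bU.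
    by rewrite /vtx /= !in_cons eqxx orbT.
  by apply: s; rewrite mem_head.
exact: (toured_step tU aU bU (pA b bp) fO j).
Qed.

(** Rotated to start at [u0], the closed walk is cut by [v0] and [w0] into three walks. In either
    order, and up to reversal, they join the three pairs. *)
Lemma tour_split x c : walk x c -> wend x c = x -> {subset unzip1 c <= O} ->
  u0 \in vtx x c -> v0 \in vtx x c -> w0 \in vtx x c ->
  exists n1 n2 n3, [/\ n1 + n2 + n3 = size c, reach u0 v0 n1, reach v0 w0 n2 & reach u0 w0 n3].
Proof.
move=> wc ec sc uc vc wc'.
have [c' [w' e' s' sz [vc' wc0]]] : exists c', [/\ walk u0 c', wend u0 c' = u0, {subset unzip1 c' <= O},
    size c' = size c & v0 \in vtx u0 c' /\ w0 \in vtx u0 c'].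
  have [c1 [c2 [ec12 e1]]] := vtx_split uc; subst c.
  move: wc ec; rewrite walk_cat wend_cat e1 => /andP[w1 w2] ec.
  have sub y : y \in vtx x (c1 ++ c2) -> y \in vtx u0 (c2 ++ c1).
    rewrite mem_vtx_cat => /orP[yc1|yc2]; rewrite mem_vtx_cat; last first.
      by rewrite /vtx in_cons yc2 orbT.
    move: yc1; rewrite in_cons => /orP[/eqP->|->]; last by rewrite orbT.
    by have := wend_in u0 c2; rewrite ec => ->.
  exists (c2 ++ c1); split.
  - by rewrite walk_cat w2 ec w1.
  - by rewrite wend_cat ec e1.
  - move=> f; rewrite /unzip1 map_cat mem_cat orbC -mem_cat -map_cat; exact: sc.
  - by rewrite !size_cat addnC.
  by split; apply: sub.
have [a [b [ab ea]]] := vtx_split vc'; subst c'.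
move: w' e'; rewrite walk_cat wend_cat ea => /andP[wa wb] eb.
have sa : {subset unzip1 a <= O}.
  by move=> f fa; apply: s'; rewrite /unzip1 map_cat mem_cat [f \in map _ a]fa.
have sb : {subset unzip1 b <= O}.
  by move=> f fb; apply: s'; rewrite /unzip1 map_cat mem_cat [f \in map _ b]fb orbT.
have rA p x1 y1 : walk x1 p -> wend x1 p = y1 -> {subset unzip1 p <= O} -> reach x1 y1 (size p).
  by move=> h1 h2 h3; exists p; split.
move: wc0; rewrite mem_vtx_cat => /orP[/vtx_split[a1 [a2 [aa e1]]]|wb'].
  subst a; move: wa ea; rewrite walk_cat wend_cat e1 => /andP[wa1 wa2] ea.
  have sa1 : {subset unzip1 a1 <= O}.
    by move=> f fa; apply: sa; rewrite /unzip1 map_cat mem_cat [f \in map _ a1]fa.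
  have sa2 : {subset unzip1 a2 <= O}.
    by move=> f fa; apply: sa; rewrite /unzip1 map_cat mem_cat [f \in map _ a2]fa orbT.
  exists (size b), (size a2), (size a1); split.
  - by rewrite -sz !size_cat addnC addnA addnC [RHS]addnC addnCA addnA addnC.
  - by apply: reachC; apply: rA.
  - by apply: reachC; apply: rA.
  by apply: rA.
have /vtx_split[b1 [b2 [bb e1]]] : w0 \in vtx v0 b by rewrite inE wb' orbT.
subst b; move: wb eb; rewrite walk_cat wend_cat e1 => /andP[wb1 wb2] eb.
have sb1 : {subset unzip1 b1 <= O}.
  by move=> f fa; apply: sb; rewrite /unzip1 map_cat mem_cat [f \in map _ b1]fa.
have sb2 : {subset unzip1 b2 <= O}.
  by move=> f fa; apply: sb; rewrite /unzip1 map_cat mem_cat [f \in map _ b2]fa orbT.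
exists (size a), (size b1), (size b2); split.
- by rewrite -sz !size_cat addnA.
- exact: rA.
- exact: rA.
by apply: reachC; apply: rA.
Qed.

(** Apart from the three terminals the walk meets no vertex of [D]. The terminals contribute 12 to
    the count in [toured], whose initial 4 leaves the constant 8. *)
Lemma three_ears : exists n1 n2 n3, [/\ reach u0 v0 n1, reach v0 w0 n2, reach u0 w0 n3 &
  2 * (n1 + n2 + n3) + 4 * #|D| + #|RS| <= 4 * #|V| + 8].
Proof.
have [U [tU uU vU wU]] : exists U, [/\ toured U, u0 \in U, v0 \in U & w0 \in U].
  suff h : forall n U, #|~: U| < n -> toured U -> u0 \in U ->
      exists U, [/\ toured U, u0 \in U, v0 \in U & w0 \in U].
    by apply: (h _ [set u0] (ltnSn _) toured1); rewrite inE.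
  elim=> // n IH U lt tU uU.
  have step z : z \in [set v0; w0] -> z \notin U ->
      exists U, [/\ toured U, u0 \in U, v0 \in U & w0 \in U].
    move=> zvw zU; have [U' [pU tU']] := toured_grow tU uU zvw zU.
    apply: (IH U') => //; last by apply: (subsetP (proper_sub pU)).
    apply: leq_trans (_ : #|~: U| <= n) => //; apply: proper_card.
    by rewrite properC.
  case vU: (v0 \in U); last by apply: (step v0); rewrite ?inE ?eqxx ?vU.
  case wU: (w0 \in U); last by apply: (step w0); rewrite ?inE ?eqxx ?orbT ?wU.
  by exists U.
case: tU => x [c [[wc ec sc] hU sU _ le]].
have [n1 [n2 [n3 [sz r1 r2 r3]]]] := tour_split wc ec sc (hU _ uU) (hU _ vU) (hU _ wU).
exists n1, n2, n3; split=> //; rewrite sz.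
have c1 : #|U :&: vs RS| <= #|RS| by rewrite -(card_vs cub eR) subset_leq_card // subsetIr.
have c2 : #|U :\: vs RS| + #|D| + #|RS| <= #|V| + 3.
  have d : [disjoint vs D & vs RS].
    by apply/pred0P=> y /=; apply/negP=> /andP[yD /RS_D]; rewrite yD.
  have cDR : #|vs D :|: vs RS| = #|D| + #|RS|.
    by rewrite cardsU (disjoint_setI0 d) cards0 subn0 !(card_vs cub).
  have : #|U :\: vs RS| <= #|~: (vs D :|: vs RS)| + #|[set u0; v0; w0]|.
    apply: leq_trans (leq_card_setU _ _); apply: subset_leq_card.
    apply/subsetP=> y; rewrite in_setD => /andP[yR yU].
    have /setUP[yD|y3] := subsetP sU y yU; apply/setUP; [left | by right].
    by rewrite in_setC in_setU negb_or yR andbT; rewrite in_setC in yD.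
  have : #|[set u0; v0; w0]| <= 3.
    by rewrite (leq_trans (leq_card_setU _ _)) // cards1 cards2; case: eqP.
  have := cardsC (vs D :|: vs RS); rewrite cDR.
  move: #|U :\: _| #|~: _| #|[set u0; _; _]| #|D| #|RS| #|V| => k1 k2 k3 k4 k5 k6; clear; lia.
move: le c1 c2; move: #|U :\: _| #|U :&: _| (size c) #|D| #|RS| #|V| => k1 k2 k3 k4 k5 k6; clear; lia.
Qed.

End Tour.

Variable h : V -> bool.
Hypothesis hO : forall e, e \in O -> sigma e = h (endpoint e false) (+) h (endpoint e true).
Notation arcB := (arcB sigma D h).

Lemma reach_cov u v n : u \in vs D -> v \in vs D -> u != v -> reach u v n ->
  cov sigma (arcB u v) (n + #|arcB u v|).
Proof.
move=> uD vD nuv [p [w s e l]].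
apply: cov_sub (ear_cov cub cD nD hO uD vD nuv w s e) => //.
by rewrite leq_add2r.
Qed.

(** Each edge of [D] lies in exactly two of the three arcs, so any two cover [D]. The three covers
    by two ears have total length [2 * (n1 + n2 + n3) + 4 * #|D|], and the cheapest costs at most a
    third of it. *)
Lemma triple_cost (RS : {set E}) u v w : evenset RS -> RS \subset O ->
  (forall x, x \in vs RS -> 4 <= #|ecomp RS x|) ->
  u \in vs D -> v \in vs D -> w \in vs D ->
  connect (adj O) u v -> connect (adj O) v w -> arcB u v :|: arcB v w = D ->
  exists2 c, cov sigma D c & 3 * c + #|RS| <= 4 * #|V| + 8.
Proof.
move=> eR sR R4 uD vD wD luv lvw UD.
have [n1 [n2 [n3 [r1 r2 r3 le]]]] := three_ears eR sR R4 uD luv (connect_trans luv lvw).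
have B3 : symd (arcB u v) (arcB v w) = arcB u w by apply: arc_add.
have nuv : u != v.
  apply: contraNneq (arc_proper cub cD nD h vD wD) => uv.
  by rewrite -[X in _ == X]UD uv (arcuu cub cD nD h vD) set0U.
have nvw : v != w.
  apply: contraNneq (arc_proper cub cD nD h uD vD) => vw.
  by rewrite -[X in _ == X]UD -vw (arcuu cub cD nD h vD) setU0.
have nuw : u != w.
  apply: contraNneq (arc_proper cub cD nD h uD vD) => uw.
  by rewrite -[X in _ == X]UD -uw (arcC cub cD nD h vD uD) setUid.
have k1 := reach_cov uD vD nuv r1; have k2 := reach_cov vD wD nvw r2.
have k3 := reach_cov uD wD nuw r3.
have c3 := card_symd (arcB u v) (arcB v w); rewrite B3 in c3.
have c4 := cardsUI (arcB u v) (arcB v w); rewrite UD in c4.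
have hD e : e \in D -> (e \in arcB u v) || (e \in arcB v w).
  by move=> eD'; rewrite -in_setU UD.
have sub12 : D \subset arcB u v :|: arcB v w by rewrite UD.
have sub13 : D \subset arcB u v :|: arcB u w.
  apply/subsetP=> e /hD; rewrite in_setU -B3 in_symd.
  by case: (e \in arcB u v).
have sub23 : D \subset arcB v w :|: arcB u w.
  apply/subsetP=> e /hD; rewrite in_setU -B3 in_symd.
  by case: (e \in arcB u v); case: (e \in arcB v w).
have c12 := covU k1 k2; have c13 := covU k1 k3; have c23 := covU k2 k3.
set a1 := #|arcB u v| in c3 c4 c12 c13 c23; set a2 := #|arcB v w| in c3 c4 c12 c13 c23.
set a3 := #|arcB u w| in c3 c4 c12 c13 c23.
clearbody a1 a2 a3.
have [l|[l|l]] : 3 * (n1 + a1 + (n2 + a2)) + #|RS| <= 4 * #|V| + 8 \/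
   3 * (n1 + a1 + (n3 + a3)) + #|RS| <= 4 * #|V| + 8 \/
   3 * (n2 + a2 + (n3 + a3)) + #|RS| <= 4 * #|V| + 8.
- clear -le c3 c4; move: le c3 c4; move: #|_ :&: _| #|D| #|RS| #|V| => m4 m5 m6 m7.
  by lia.
- by exists (n1 + a1 + (n2 + a2)) => //; apply: cov_sub c12.
- by exists (n1 + a1 + (n3 + a3)) => //; apply: cov_sub c13.
by exists (n2 + a2 + (n3 + a3)) => //; apply: cov_sub c23.
Qed.

End Single.

(** * Ears from distinct components outside [D] *)

Section Hulls.
Variable G : graph.
Notation E := (edge G).
Notation V := (vertex G).
Implicit Types (A B C K Z Q : {set E}) (X Y T U : {set V}) (e f : E) (u v w x y z r : V)
  (p q : seq (E * V)).
Hypothesis cub : cubic G.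
Variable sigma : signature G.
Variable D : {set E}.
Hypotheses (cD : edge_cycle D) (nD : neg sigma D).
Let O := ~: D.
Let eD : evenset D. Proof. by case: cD. Qed.
Variable h : V -> bool.
Hypothesis hO : forall e, e \in O -> sigma e = h (endpoint e false) (+) h (endpoint e true).
Notation arcB := (arcB sigma D h).

(* Cutting D open at e0 numbers its vertices and the remaining edges. *)
Lemma arc_coords e0 : e0 \in D -> exists (pos : V -> nat) (idx : E -> nat),
  forall u v e, u \in vs D -> v \in vs D -> e \in D -> e != e0 ->
    (e \in arcB u v) = (e0 \in arcB u v) (+) ((idx e < pos u) (+) (idx e < pos v)).
Proof.
move=> e0D; have x0D := vs_end false e0D; set x := endpoint e0 false in x0D.
have [q [wq eq szq DE hq]] : exists q, [/\ walk x q, uniq (unzip1 q),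
    e0 \notin unzip1 q, e0 |: eset_of q = D & forall y, y \in vs D -> y \in vtx x q].
  have oB z : odeg (D :\ e0) z = (x == z) (+) (endpoint e0 true == z).
    by rewrite -symd_setD ?sub1set // odeg_symd eD /odeg xsum1.
  case: (eqVneq x (endpoint e0 true)) => [xy|nxy].
    have De : [set e0] = D.
      apply: (edge_cycle_min cub cD); rewrite ?sub1set //; last by apply/set0Pn; exists e0; rewrite inE.
      by move=> z; rewrite /odeg xsum1 /inc -/x -xy addbb.
    exists [::]; split=> //.
      by rewrite -De; apply/setP=> f; rewrite !inE orbF.
    move=> y /vsP[f [b [fD <-]]].
    by move: fD; rewrite -De => /set1P->; case: b; rewrite inE // -?xy.
  have ox : odeg (D :\ e0) x by rewrite oB eqxx eq_sym (negPf nxy).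
  have [y [ny oy c]] := odd_mate ox.
  have ey : y = endpoint e0 true by move: oy; rewrite oB eq_sym (negPf ny) => /eqP.
  have [q [wq sq eq uq]] := conn_path c; have ue := uniq_vtx_edges wq uq.
  have e0N : e0 \notin unzip1 q by apply/negP=> /sq; rewrite !inE eqxx.
  have qD : {subset unzip1 q <= D} by move=> f /sq; rewrite inE => /andP[].
  have DE : e0 |: eset_of q = D.
    apply: (edge_cycle_min cub cD); last by apply/set0Pn; exists e0; rewrite setU11.
      rewrite -symd_disj ?disjoints1 ?inE // => t; rewrite odeg_symd (odeg_eset_of _ wq ue) eq.
      by rewrite /odeg xsum1 /inc -/x ey; case: (x == t); case: (_ == t).
    by rewrite subUset sub1set e0D; apply/subsetP=> g; rewrite inE => /qD.
  exists q; split=> // z /vsP[f [b [fD <-]]].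
  move: fD; rewrite -DE => /setU1P[->|fq]; last by apply: walk_ends wq _; move: fq; rewrite inE.
  by case: b; rewrite ?mem_head // -ey -eq wend_in.
have sq : {subset unzip1 q <= D} by move=> f fq; rewrite -DE !inE fq orbT.
pose pos u := index u (vtx x q); pose idx e := index e (unzip1 q).
exists pos, idx => u v e uD vD eD' ne.
pose P u := eset_of (take (pos u) q).
have Pq z : z \in vs D -> walk x (take (pos z) q) /\ wend x (take (pos z) q) = z.
  move=> zD; split; first by move: wq; rewrite -{1}(cat_take_drop (pos z) q) walk_cat => /andP[].
  have zq := hq z zD; rewrite -[RHS](nth_index x zq) -/(pos z).
  have : pos z < size (vtx x q) by rewrite index_mem.
  rewrite /vtx /= size_map /wend.
  case: (pos z) => [|k] lk; first by rewrite take0.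
  rewrite /= (last_nth x) size_map size_takel // /unzip2 map_take /=.
  by rewrite nth_take.
have ut z : uniq (unzip1 (take (pos z) q)) by rewrite /unzip1 map_take take_uniq.
have memP z : e \in unzip1 q -> (e \in P z) = (idx e < pos z).
  by move=> eq0; rewrite inE /unzip1 map_take in_take.
have sP z : P z \subset D.
  by apply/subsetP=> f; rewrite inE /unzip1 map_take => /mem_take /sq.
pose J := symd (P u) (P v).
have sJ : J \subset D by apply: symd_sub.
have oJ z : odeg J z = (u == z) (+) (v == z).
  have [[w1 e1] [w2 e2]] := (Pq u uD, Pq v vD).
  rewrite odeg_symd (odeg_eset_of _ w1 (ut u)) (odeg_eset_of _ w2 (ut v)) e1 e2.
  by case: (x == z); case: (u == z); case: (v == z).
have e0J : e0 \notin J.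
  have n z : (e0 \in P z) = false.
    by rewrite inE /unzip1 map_take; apply/negP=> /mem_take; apply/negP.
  by rewrite in_symd !n.
have eZ : evenset (symd (arcB u v) J).
  by move=> z; rewrite odeg_symd (odeg_arc cD nD) // oJ addbb.
have sZ : symd (arcB u v) J \subset D by rewrite symd_sub ?(arc_sub cD nD).
have same f : f \in D -> (f \in symd (arcB u v) J) = (e0 \in symd (arcB u v) J).
  move=> fD; case: (set_0Vmem (symd (arcB u v) J)) => [->|[g gZ]]; first by rewrite !inE.
  by rewrite (edge_cycle_min cub cD eZ sZ) ?fD ?e0D //; apply/set0Pn; exists g.
have e_q : e \in unzip1 q by move: eD'; rewrite -DE !inE (negPf ne).
have := same e eD'; rewrite !(in_symd (arcB u v) J) (negPf e0J) addbF => <-.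
by rewrite [e \in J]in_symd !memP // -addbA addbb addbF.
Qed.

(** After opening [D] at [e0], the arc between two vertices is the interval between them if their
    colours agree and the complement of that interval otherwise. With one colour the extreme
    positions span all arcs. With two colours these form two consecutive blocks, and the hull is the
    complement of the gap between the blocks. *)
Lemma hull (K : {set V}) x0 : x0 \in K -> K \subset vs D ->
  (forall u v w, u \in K -> v \in K -> w \in K -> arcB u v :|: arcB v w != D) ->
  exists p q : V, [/\ p \in K, q \in K & forall u v, u \in K -> v \in K -> arcB u v \subset arcB p q].
Proof.
move=> x0K sK notri; have KD u : u \in K -> u \in vs D by apply: subsetP.
have [e0 e0D] : exists e, e \in D by case: cD => _ /set0Pn.
have [pos [idx coord]] := arc_coords e0D.
pose col u := e0 \in arcB x0 u; pose side e u := (e != e0) && (idx e < pos u).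
have arcE e u v : u \in K -> v \in K -> e \in D ->
    (e \in arcB u v) = (col u (+) side e u) (+) (col v (+) side e v).
  move=> uK vK eD'.
  have e0uv : (e0 \in arcB u v) = col u (+) col v.
    by rewrite /col -(arc_add cub cD nD h (KD _ uK) (KD _ x0K) (KD _ vK)) in_symd
       (arcC cub cD nD h (KD _ uK) (KD _ x0K)).
  rewrite /side; case: (eqVneq e e0) => [->|ne] /=; first by rewrite !addbF.
  by rewrite (coord u v e) ?KD // e0uv addbACA.
have mono e u v : pos u <= pos v -> side e u ==> side e v.
  by move=> l; apply/implyP=> /andP[ne lt]; rewrite /side ne; apply: leq_trans lt l.
have subD u v e : u \in K -> v \in K -> e \in arcB u v -> e \in D.
  by move=> uK vK; apply/subsetP/(arc_sub cD nD); apply: KD.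
case: (pickP [pred u in K | col u != col x0]) => [x1 /andP[x1K nx1]|mono_col]; last first.
  have same u : u \in K -> col u = col x0.
    by move=> uK; have := mono_col u; rewrite /= uK /= => /negbFE/eqP.
  have [p pK minp] := arg_minnP pos x0K; have [q qK maxq] := arg_maxnP pos x0K.
  exists p, q; split=> // u v uK vK; apply/subsetP=> e euv; have eD' := subD _ _ _ uK vK euv.
  move: euv; rewrite !arcE // !same //.
  have := mono e _ _ (minp u uK); have := mono e _ _ (minp v vK).
  have := mono e _ _ (maxq u uK); have := mono e _ _ (maxq v vK).
  case: (col x0); case: (side e p); case: (side e q) => //=;
    by case: (side e u); case: (side e v).
(* a colour that recurs after the other one yields a triple excluded by notri *)
have noalt u v w : u \in K -> v \in K -> w \in K -> pos u <= pos v -> pos v <= pos w ->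
    col u = col w -> col u = col v.
  move=> uK vK wK l1 l2 cuw; apply/eqP; apply: contraT => ncol.
  have /eqP[] := notri u v w uK vK wK; apply/eqP; rewrite eqEsubset subUset.
  rewrite !(arc_sub cD nD) ?KD //=; apply/subsetP=> e eD'.
  rewrite in_setU !arcE // -cuw.
  have := mono e _ _ l1; have := mono e _ _ l2; move: ncol.
  by case: (col u); case: (col v) => //= _; case: (side e u); case: (side e v); case: (side e w).
have [m mK minm] := arg_minnP pos x0K.
have [y yK ny] : exists2 y, y \in K & col y != col m.
  case: (eqVneq (col m) (col x0)) => [e|ne]; first by exists x1; rewrite ?e.
  by exists x0; rewrite // eq_sym.
have mm : m \in [pred u in K | col u == col m] by apply/andP; split; rewrite ?eqxx.
have yy : y \in [pred u in K | col u != col m] by apply/andP; split.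
have [p /andP[pK /eqP cp] maxp] := arg_maxnP pos mm.
have [q /andP[qK cq] minq] := arg_minnP pos yy.
have lpq : pos p < pos q.
  rewrite ltnNge; apply/negP=> l; case/negP: cq; apply/eqP/esym.
  by apply: (noalt m q p) => //; apply: minm.
exists p, q; split=> // u v uK vK; apply/subsetP=> e euv; have eD' := subD _ _ _ uK vK euv.
apply: contraTT euv; rewrite !arcE // => npq.
have pF : side e p = false /\ side e q = true.
  move: npq cq (mono e p q (ltnW lpq)); rewrite cp.
  by case: (col m); case: (col q) => //=; case: (side e p); case: (side e q).
have val z : z \in K -> side e z = (col z != col m).
  move=> zK; case: (eqVneq (col z) (col m)) => cz.
    apply/negbTE/negP=> sz; have [sp _] := pF; have := mono e z p.
    have zP : [pred u in K | col u == col m] z by apply/andP; split; rewrite ?cz.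
    by rewrite sp sz => /(_ (maxp z zP)).
  have zP : [pred u in K | col u != col m] z by apply/andP; split.
  by have := mono e q z (minq z zP); rewrite pF.2.
by rewrite !val //; case: (col u); case: (col v); case: (col m).
Qed.

(** Seen from [e0], each arc is the complement of an interval. Of three intervals, one neither
    starts strictly last nor ends strictly first, so it contains the intersection of the other
    two. *)
Lemma arc_helly e0 u1 v1 u2 v2 u3 v3 :
  u1 \in vs D -> v1 \in vs D -> u2 \in vs D -> v2 \in vs D -> u3 \in vs D -> v3 \in vs D ->
  e0 \in arcB u1 v1 -> e0 \in arcB u2 v2 -> e0 \in arcB u3 v3 ->
  [\/ arcB u1 v1 \subset arcB u2 v2 :|: arcB u3 v3,
      arcB u2 v2 \subset arcB u1 v1 :|: arcB u3 v3 |
      arcB u3 v3 \subset arcB u1 v1 :|: arcB u2 v2].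
Proof.
move=> u1D v1D u2D v2D u3D v3D e1 e2 e3.
have e0D : e0 \in D by apply: subsetP e1; apply: (arc_sub cD nD).
have [pos [idx coord]] := arc_coords e0D.
pose a u v := minn (pos u) (pos v); pose b u v := maxn (pos u) (pos v).
have out u v e : u \in vs D -> v \in vs D -> e0 \in arcB u v -> e \in D -> e != e0 ->
    (e \in arcB u v) = ~~ (a u v <= idx e < b u v).
  move=> uD vD e0uv eD' ne; rewrite (coord u v e) // e0uv /a /b.
  rewrite geq_min leq_max [pos u <= _]leqNgt [pos v <= _]leqNgt.
  by case: (idx e < pos u); case: (idx e < pos v).
have red u v u' v' u'' v'' : u \in vs D -> v \in vs D -> u' \in vs D -> v' \in vs D ->
    u'' \in vs D -> v'' \in vs D -> e0 \in arcB u v -> e0 \in arcB u' v' -> e0 \in arcB u'' v'' ->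
    a u v <= maxn (a u' v') (a u'' v'') -> minn (b u' v') (b u'' v'') <= b u v ->
    arcB u v \subset arcB u' v' :|: arcB u'' v''.
  move=> uD vD u'D v'D u''D v''D h1 h2 h3 l1 l2; apply/subsetP=> e ea.
  have eD' : e \in D by apply: subsetP ea; apply: (arc_sub cD nD).
  rewrite in_setU; case: (eqVneq e e0) => [->|ne]; first by rewrite h2.
  move: ea; rewrite (out u v) // (out u' v') // (out u'' v'') //; apply: contraTT; rewrite negb_or !negbK => /andP[/andP[m1 m2] /andP[m3 m4]].
  apply/andP; split; first by rewrite (leq_trans l1) // geq_max m1.
  by apply: leq_trans l2; rewrite leq_min m2.
have : (a u1 v1 <= maxn (a u2 v2) (a u3 v3)) && (minn (b u2 v2) (b u3 v3) <= b u1 v1) ||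
  ((a u2 v2 <= maxn (a u1 v1) (a u3 v3)) && (minn (b u1 v1) (b u3 v3) <= b u2 v2) ||
   (a u3 v3 <= maxn (a u1 v1) (a u2 v2)) && (minn (b u1 v1) (b u2 v2) <= b u3 v3)).
  by move: (a u1 v1) (a u2 v2) (a u3 v3) (b u1 v1) (b u2 v2) (b u3 v3) => k1 k2 k3 k4 k5 k6; clear; lia.
case/or3P=> /andP[l1 l2]; [apply: Or31 | apply: Or32 | apply: Or33]; exact: red.
Qed.

(** An ear has at most one edge more than there are vertices off [D] in its component, so the ears
    of a family [F] cost at most [#|V| - #|D| + #|F|]. For a minimal family the arcs cost at most
    [2 * #|D| - #|F|], which compensates the extra term. *)
Lemma hull_cost :
  (forall e0, e0 \in D -> exists u v,
    [/\ u \in vs D, v \in vs D, connect (adj O) u v & e0 \in arcB u v]) ->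
  (forall u v w, u \in vs D -> v \in vs D -> w \in vs D -> connect (adj O) u v ->
     connect (adj O) v w -> arcB u v :|: arcB v w != D) ->
  cov sigma D (#|V| + #|D|).
Proof.
move=> covD notri; pose rt := fingraph.root (adj O).
pose K r := [set x in vs D | rt x == r].
have rtE x y : (rt x == rt y) = connect (adj O) x y by rewrite /rt (root_connect (conn_sym O)).
have KE r x : (x \in K r) = (x \in vs D) && (rt x == r) by rewrite /K in_set.
have /fin_all_exists[PQ hPQ] : forall r, exists pq : V * V, K r != set0 ->
    [/\ pq.1 \in K r, pq.2 \in K r &
        forall u v, u \in K r -> v \in K r -> arcB u v \subset arcB pq.1 pq.2].
  move=> r; case: (set_0Vmem (K r)) => [->|[x xK]]; first by exists (r, r); rewrite eqxx.
  have [||p [q hpq]] := @hull (K r) x xK; last by exists (p, q).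
    by apply/subsetP=> y; rewrite KE => /andP[].
  move=> u v w; rewrite !KE => /andP[uD /eqP ru] /andP[vD /eqP rv] /andP[wD /eqP rw].
  by apply: notri; rewrite // -rtE ?ru ?rv ?rw.
pose P r := (PQ r).1; pose Q r := (PQ r).2; pose B r := arcB (P r) (Q r).
have KP r : K r != set0 -> [/\ P r \in vs D, Q r \in vs D, rt (P r) = r & rt (Q r) = r].
  by case/hPQ; rewrite !KE => /andP[h1 /eqP h2] /andP[h3 /eqP h4] _.
pose I0 := [set r | K r != set0].
pose good (F : {set V}) := (F \subset I0) && (D \subset \bigcup_(r in F) B r).
have good0 : good I0.
  rewrite /good subxx /=; apply/subsetP=> e /covD[u [v [uD vD c eB]]].
  have uK : u \in K (rt u) by rewrite KE uD eqxx.
  have K0 : K (rt u) != set0 by apply/set0Pn; exists u.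
  apply/bigcupP; exists (rt u); first by rewrite inE.
  have [_ _ hB] := hPQ _ K0; apply: (subsetP (hB u v uK _) e eB).
  by rewrite KE vD eq_sym rtE.
(* Minimality gives each chosen arc a private edge, so no arc lies in the union of two others; by
   [arc_helly] no edge of [D] is then in three arcs. *)
have [F minF _] := minset_exists good0.
have [/andP[FI FD] Fmin] := minsetP minF.
have KF r : r \in F -> [/\ P r \in vs D, Q r \in vs D, rt (P r) = r & rt (Q r) = r].
  by move=> /(subsetP FI); rewrite inE => /KP.
have priv r : r \in F -> exists2 e, e \in D & forall r', r' \in F -> (e \in B r') = (r' == r).
  move=> rF; have : ~~ (D \subset \bigcup_(r' in F :\ r) B r').
    apply/negP=> cD'; have := Fmin (F :\ r); rewrite /good cD' (subset_trans (subsetDl _ _) FI) /=.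
    move=> /(_ isT (subsetDl _ _)) e; by have : r \in F :\ r; [rewrite e | rewrite !inE eqxx].
  case/subsetPn=> e eD' eN; exists e => // r' r'F.
  case: (eqVneq r' r) => [->|nr].
    have /bigcupP[r2 r2F er2] := subsetP FD e eD'.
    case: (eqVneq r2 r) => [<- //|n2]; case/negP: eN; apply/bigcupP; exists r2 => //.
    by rewrite !inE n2.
  by apply/negbTE; apply: contra eN => er'; apply/bigcupP; exists r'; rewrite // !inE nr.
have /fin_all_exists[pe hpe] r : exists e, r \in F ->
    e \in D /\ forall r', r' \in F -> (e \in B r') = (r' == r).
  case rF: (r \in F); first by have [e h1 h2] := priv r rF; exists e.
  by have [e _] := set0Pn _ (let: And3 _ x _ := cD in x); exists e.
pose count e := #|[set r in F | e \in B r]|.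
have count2 e : e \in D -> count e <= 2.
  move=> eD'; rewrite leqNgt; apply/negP=> c3.
  have [r1] : exists r, r \in [set r in F | e \in B r] by apply/card_gt0P; apply: leq_trans c3.
  have [r2] : exists r, r \in [set r in F | e \in B r] :\ r1.
    by apply/card_gt0P; move: c3; rewrite /count (cardsD1 r1); case: (_ \in _); move: #|_| => k; clear; lia.
  have [r3] : exists r, r \in [set r in F | e \in B r] :\ r1 :\ r2.
    apply/card_gt0P; move: c3; rewrite /count (cardsD1 r1) (cardsD1 r2 (_ :\ r1)).
    by case: (r1 \in _); case: (r2 \in _); move: #|_| => k; clear; lia.
  rewrite !inE => /and4P[n32 n31 r3F e3] /and3P[n21 r2F e2] /andP[r1F e1].
  have [p1 q1 _ _] := KF _ r1F; have [p2 q2 _ _] := KF _ r2F; have [p3 q3 _ _] := KF _ r3F.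
  have redF r r' r'' : r \in F -> r' \in F -> r'' \in F -> r' != r -> r'' != r ->
      B r \subset B r' :|: B r'' -> False.
    move=> rF r'F r''F n1 n2 s; have [_ hp] := hpe r rF.
    have := subsetP s (pe r); rewrite in_setU !hp // eqxx (negPf n1) (negPf n2).
    by move=> /(_ isT).
  have [] := arc_helly p1 q1 p2 q2 p3 q3 e1 e2 e3; apply: redF => //; by rewrite eq_sym.
have sumB : \sum_(r in F) #|B r| + #|F| <= 2 * #|D|.
  have pinj : {in F &, injective pe}.
    move=> r r' rF r'F e; have [_ h1] := hpe r rF; have [_ h2] := hpe r' r'F.
    by have := h1 r rF; rewrite e h2 // eqxx => /eqP.
  rewrite -(card_in_imset pinj).
  have -> : \sum_(r in F) #|B r| = \sum_(e in D) count e.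
    rewrite /count; under eq_bigr do rewrite -sum1_card.
    under [RHS]eq_bigr do rewrite -sum1_card.
    rewrite (exchange_big_dep (mem D)) /= => [|r e rF eB]; last first.
      by have [h1 h2 _ _] := KF _ rF; apply: subsetP eB; apply: (arc_sub cD nD).
    by apply: eq_bigr => e eD'; apply: eq_bigl => r; rewrite inE.
  have -> : #|[set pe x | x in F]| = \sum_(e in D) (e \in [set pe x | x in F]).
    rewrite -sum1_card big_mkcond [RHS]big_mkcond; apply: eq_bigr => e _.
    case eF: (e \in [set pe x | x in F]); last by rewrite if_same.
    by case/imsetP: eF => r /hpe[eD' _] ->; rewrite eD'.
  rewrite -big_split /= mulnC -sum_nat_const; apply: leq_sum => e eD'.
  case eF: (e \in _); last by rewrite addn0 count2.
  case/imsetP: eF => r rF ->; have [_ hp] := hpe r rF.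
  rewrite /count (_ : [set _ in _ | _] = [set r]) ?cards1 //.
  apply/setP=> r'; rewrite in_set in_set1; case r'F: (r' \in F) => /=; first exact: hp.
  by apply/esym/negbTE; apply: contraFneq r'F => ->.
pose W r := [set z | (z \notin vs D) && (rt z == r)].
have sumW : \sum_(r in F) #|W r| + #|D| <= #|V|.
  rewrite -(card_vs cub eD) -(cardsC (vs D)) addnC leq_add2l.
  under eq_bigr do rewrite -sum1_card.
  rewrite (exchange_big_dep (mem (~: vs D))) /= => [|r z _]; last by rewrite !inE => /andP[].
  rewrite -sum1_card; apply: leq_sum => z zD.
  rewrite sum1_card (leq_trans (subset_leq_card _) (_ : #|[set rt z]| <= 1)) ?cards1 //.
  apply/subsetP=> r; rewrite unfold_in /= => /andP[_].
  by rewrite in_set => /andP[_ /eqP <-]; rewrite in_set1.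
have ear r : r \in F -> cov sigma (B r) (#|W r| + 1 + #|B r|).
  move=> rF; have [pD qD rp rq] := KF _ rF.
  have npq : P r != Q r.
    have [_ hp] := hpe r rF; apply/eqP=> pq; have := hp r rF.
    by rewrite eqxx /B pq (arcuu cub cD nD h qD) inE.
  have c : connect (adj O) (P r) (Q r) by rewrite -rtE rp rq.
  have [p [w s ep up]] := conn_path c.
  apply: cov_sub (ear_cov cub cD nD hO pD qD npq w s ep) => //.
  rewrite leq_add2r.
  have : #|[set z in vtx (P r) p]| <= #|W r :|: [set P r; Q r]|.
    apply: subset_leq_card; apply/subsetP=> z; rewrite in_set => zp; rewrite in_setU.
    case: (eqVneq z (P r)) => [->|n1]; first by rewrite !inE eqxx orbT.
    case: (eqVneq z (Q r)) => [->|n2]; first by rewrite !inE eqxx !orbT.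
    apply/orP; left; rewrite in_set (interior_notD cub cD w up s zp n1) ?ep //=.
    by rewrite -rp rtE conn_sym (walk_conn w).
  rewrite cardsE (card_uniqP up) /= size_map => l1.
  have := leq_card_setU (W r) [set P r; Q r]; rewrite cards2 npq.
  by move/(leq_trans l1); rewrite /= addn2 addn1 ltnS.
apply: cov_sub (cov_bigcup ear) => //.
rewrite !big_split /= sum_nat_const muln1.
by move: sumB sumW; move: (\sum_(_ in _) _) (\sum_(_ in _) _) #|F| #|D| #|V| => k1 k2 k3 k4 k5; clear; lia.
Qed.

End Hulls.

(** * The length of a shortest circuit cover *)

Section Assembly.
Variable G : graph.
Notation E := (edge G).
Notation V := (vertex G).
Implicit Types (A B C D J K Q R S U Z : {set E}) (X Y T : {set V}) (e f : E) (u v w x y z : V).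
Hypothesis cub : cubic G.
Hypothesis tec : forall X, X != set0 -> X != setT -> 1 < #|cut X|.
Variable sigma : signature G.
Hypothesis V1 : 1 < #|V|.

Lemma single_cover D RS : edge_cycle D -> neg sigma D -> evenset RS -> RS \subset ~: D ->
  (forall x, x \in vs RS -> 4 <= #|ecomp RS x|) ->
  (forall (g : V -> bool) e0, exists2 e, e != e0 &
     sigma e != g (endpoint e false) (+) g (endpoint e true)) ->
  exists2 c, cov sigma D c &
    [\/ c <= #|V|.+1, c <= #|V| + #|D| | 3 * c + #|RS| <= 4 * #|V| + 8].
Proof.
move=> cD nD eR sR R4 far; have [eD _ _] := cD.
case: (pickP (fun Z : {set E} => [&& [forall v, ~~ odeg Z v], Z \subset ~: D & neg sigma Z])).
  move=> Z /and3P[/forallP eZ sZ nZ].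
  have [|Q [sQ cQ nQ]] := @neg_cycle G sigma Z _ nZ; first by move=> v; apply/negbTE.
  exists #|V|.+1; last by constructor 1.
  apply: cov_sub (barbell_small cub tec cD cQ nD nQ _); rewrite ?subsetUl //.
  apply: even_vs_disj => //; first by case: cQ.
  by rewrite disjoint_sym disjoints_subset (subset_trans sQ).
move=> none; have [|h hO] := @potential G sigma (~: D).
  move=> Z eZ sZ; have := none Z; rewrite sZ /= => /negbT; rewrite negb_and.
  by case/orP=> // /negP[]; apply/forallP=> v; rewrite eZ.
case: (pickP (fun t : V * V * V => [&& [&& t.1.1 \in vs D, t.1.2 \in vs D & t.2 \in vs D],
    connect (adj (~: D)) t.1.1 t.1.2, connect (adj (~: D)) t.1.2 t.2 &
    arcB sigma D h t.1.1 t.1.2 :|: arcB sigma D h t.1.2 t.2 == D])).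
  move=> [[u v] w] /= /and4P[/and3P[uD vD wD] c1 c2 /eqP UD].
  have [c hc le] := triple_cost cub cD nD hO eR sR R4 uD vD wD c1 c2 UD.
  by exists c => //; constructor 3.
move=> notri; exists (#|V| + #|D|); last by constructor 2.
apply: (hull_cost cub cD nD hO); first exact: (arcs_cover cub cD nD hO far).
move=> u v w uD vD wD c1 c2; have /= := notri (u, v, w).
by rewrite uD vD wD c1 c2 /= => ->.
Qed.

(** A loop leaves a single half-edge at its vertex, but the cut of that vertex has at least two
    edges. *)
Lemma noloop e : endpoint e false != endpoint e true.
Proof.
apply/eqP=> l; set v := endpoint e false in l.
have X0 : [set v] != set0 by apply/set0Pn; exists v; rewrite inE.
have XT : [set v] != setT.
  by apply: contraTneq V1 => h; rewrite -cardsT -h cards1.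
have c2 := tec X0 XT.
have d : [disjoint cut [set v] & [set e]].
  by rewrite disjoint_sym disjoints1 !inE -/v -l addbb.
have := hdeg_le3 cub (cut [set v] :|: [set e]) v; rewrite hdegU // [hdeg [set e] v]hdegE big_set1.
rewrite -/v -l eqxx.
have : #|cut [set v]| <= hdeg (cut [set v]) v.
  rewrite hdegE -sum1_card; apply: leq_sum => f; rewrite !inE.
  by case: (_ == v); case: (_ == v).
move: c2; move: #|cut _| (hdeg _ _) => k1 k2; clear; lia.
Qed.

Lemma odeg_class S (c : V -> bool) v :
  (forall x y, connect (adj S) x y -> c x = c y) ->
  odeg [set e in S | c (endpoint e false)] v = c v && odeg S v.
Proof.
move=> hc; rewrite /odeg /xsum.
have -> : c v && (\big[addb/false]_(e in S) inc v e) = \big[addb/false]_(e in S) (c v && inc v e).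
  by case: (c v) => //=; rewrite big1.
rewrite big_mkcond [RHS]big_mkcond; apply: eq_bigr => e _; rewrite in_set.
case eS: (e \in S) => //=; case iv: (inc v e); last by rewrite andbF if_same.
have [b hb] : exists b, endpoint e b = v.
  move: iv; rewrite /inc; case: eqP => [h|_]; first by exists false.
  by case: eqP => // h _; exists true.
by rewrite (hc _ _ (conn_end false b eS)) hb andbT; case: (c v).
Qed.

Section Split.
Variable S : {set E}.
Hypothesis eS : evenset S.

Definition pos_part : {set E} := [set e in S | ~~ neg sigma (ecomp S (endpoint e false))].
Definition neg_reps : {set V} :=
  [set x in vs S | (fingraph.root (adj S) x == x) && neg sigma (ecomp S x)].

Lemma pos_part_sub : pos_part \subset S.
Proof. by apply/subsetP=> e; rewrite in_set => /andP[]. Qed.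

Lemma pos_part_even : evenset pos_part.
Proof.
move=> v; have := @odeg_class S (fun x => ~~ neg sigma (ecomp S x)) v.
by rewrite eS andbF => -> // x y c; rewrite (ecomp_eq c).
Qed.

Lemma pos_part_comp x : x \in vs pos_part -> ecomp pos_part x = ecomp S x /\ ~~ neg sigma (ecomp S x).
Proof.
move=> xP; have xS := subsetP (vs_sub pos_part_sub) x xP; split.
  apply: (edge_cycle_min cub (ecomp_cycle eS xS)); first exact/even_ecomp/pos_part_even.
    apply/subsetP=> e; rewrite !in_set => /andP[/andP[eS' _] c]; rewrite eS' /=.
    exact: conn_sub pos_part_sub c.
  by case: (ecomp_cycle pos_part_even xP).
case/vsP: xP => e [b [eP <-]]; move: eP; rewrite in_set => /andP[eS' n].
by rewrite (ecomp_eq (conn_end b false eS')).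
Qed.

Lemma reps_negreps : negreps sigma S neg_reps.
Proof.
split=> [t|t t']; rewrite in_set; first by case/and3P.
case/and3P=> tS /eqP rt _; rewrite in_set => /and3P[t'S /eqP rt' _]; apply: contra => c.
by rewrite -rt -rt' (root_connect (conn_sym S)).
Qed.

Lemma split_cover : S \subset pos_part :|: \bigcup_(t in neg_reps) ecomp S t.
Proof.
apply/subsetP=> e eS'; rewrite in_setU in_set eS' /=.
case n: (neg sigma _) => //=; apply/bigcupP.
have c := connect_root (adj S) (endpoint e false); set t := fingraph.root _ _ in c.
have tS : t \in vs S by apply: conn_vs c _; apply: vs_end.
exists t; last by rewrite (mem_ecomp t false eS') conn_sym.
rewrite in_set tS -(ecomp_eq c) n andbT /=.
by rewrite -[X in _ == X]/(fingraph.root (adj S) (endpoint e false)) (root_connect (conn_sym S)) conn_sym.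
Qed.

Lemma split_card : #|pos_part| + \sum_(t in neg_reps) #|ecomp S t| <= #|S|.
Proof.
rewrite -(cardsID pos_part S) (setIidPr pos_part_sub) leq_add2l.
under eq_bigr do rewrite -sum1_card.
rewrite (exchange_big_dep (mem (S :\: pos_part))) /= => [|t e tR eC]; last first.
  have eS' := subsetP (ecomp_sub S t) e eC; rewrite in_setD eS' andbT.
  rewrite in_set eS' /= negbK; move: eC; rewrite (mem_ecomp t false eS') => c.
  by rewrite -(ecomp_eq c); move: tR; rewrite in_set => /and3P[].
rewrite -sum1_card; apply: leq_sum => e; rewrite in_setD => /andP[_ eS'].
rewrite sum1_card.
rewrite (leq_trans (subset_leq_card _) (_ : #|[set fingraph.root (adj S) (endpoint e false)]| <= 1)) ?cards1 //.
apply/subsetP=> t; rewrite unfold_in /= => /andP[]; rewrite in_set => /and3P[_ /eqP rt _].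
rewrite (mem_ecomp t false eS') in_set1 => c.
by rewrite -rt (root_connect (conn_sym S)).
Qed.

Lemma pos_part_cov : cov sigma pos_part #|pos_part|.
Proof.
apply: (cov_even cub pos_part_even) => x /pos_part_comp[-> //].
Qed.

End Split.

(** In the sum of all conservation equations, with the signs of the switching, the half-edges of an
    edge outside the switched negative set cancel. A unique negative edge would contribute twice its
    value up to sign, which is nonzero. *)
Lemma signature_flow (X : {set V}) : flow_admissible sigma ->
  #|symd [set e | sigma e] (cut X)| != 1.
Proof.
case=> tw [f [bi fl nz]]; apply/negP=> /cards1P[e0 N1].
pose t e b : int := (if tw e b then 1 else -1)%R.
pose s v : int := (if v \in X then 1 else -1)%R.
have cons v : (\sum_(h : E * bool | endpoint h.1 h.2 == v) f h.1 * t h.1 h.2 = 0)%R.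
  rewrite (bigID (fun h => tw h.1 h.2)) /=.
  rewrite (eq_bigr (fun h => f h.1)) => [|h /andP[_ h2]]; last by rewrite /t h2 mulr1.
  rewrite [X in (_ + X)%R](eq_bigr (fun h => - f h.1)%R) => [|h /andP[_ /negPf h2]].
    by rewrite sumrN fl subrr.
  by rewrite /t h2 mulrN1.
have tot : (\sum_(h : E * bool) f h.1 * t h.1 h.2 * s (endpoint h.1 h.2) = 0)%R.
  rewrite (partition_big (fun h => endpoint h.1 h.2) predT) //= big1 // => v _.
  rewrite (eq_bigr (fun h => f h.1 * t h.1 h.2 * s v)%R) => [|h /eqP-> //].
  by rewrite -mulr_suml cons mul0r.
move: tot; rewrite -(pair_bigA _ (fun e b => f e * t e b * s (endpoint e b)))%R /=.
rewrite (bigD1 e0) //= [X in (_ + X)%R]big1 ?addr0 => [|e ne].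
  rewrite big_bool /= => h; have := nz e0; case/negP; apply/eqP.
  have : e0 \in symd [set e | sigma e] (cut X) by rewrite N1 inE.
  have := bi e0; move: h; rewrite in_symd !inE /t /s.
  by case: (tw e0 false); case: (tw e0 true); case: (sigma e0); case: (_ \in X); case: (_ \in X) => //=; lia.
have : e \notin symd [set e | sigma e] (cut X) by rewrite N1 inE.
have := bi e; rewrite big_bool in_symd !inE /t /s /=.
by case: (tw e false); case: (tw e true); case: (sigma e); case: (_ \in X); case: (_ \in X) => //=; lia.
Qed.

Lemma short_circuit_cover : flow_admissible sigma -> exists2 n, cov sigma setT n & 3 * n <= 13 * #|V|.
Proof.
move=> fa; pose N0 := [set e | sigma e].
have [X _ minX] := @arg_minnP _ (set0 : {set V}) predT (fun X => #|symd N0 (cut X)|) isT.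
pose N := symd N0 (cut X).
(* Switching along [Y] as well replaces [N] by its symmetric difference with [cut Y], which is no
   smaller than [N]. *)
have Ncut Y : 2 * #|N :&: cut Y| <= #|cut Y|.
  have h : symd N (cut Y) = symd N0 (cut (symd X Y)).
    by apply/setP=> e; rewrite cut_symd !in_symd addbA.
  have := card_symd N (cut Y); have := minX (symd X Y) isT; rewrite -h -/N.
  by move: #|N| #|_| #|_| #|_| => k1 k2 k3 k4; clear; lia.
(* An even set meets every cut evenly, so switching preserves its sign. *)
have negN A : evenset A -> neg sigma A = odd #|A :&: N|.
  move=> eA; have h := handshake A X; rewrite [LHS]xsumF in h; last by move=> v _; apply: eA.
  rewrite /neg (eq_xsum (P' := fun e => (e \in N) (+) (e \in cut X))) => [|e _]; last first.
    by rewrite in_symd inE -addbA addbb addbF.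
  rewrite xsum_addb -[xsum (fun e => e \in cut X) A]h addbF xsum_odd.
  by congr (odd #|pred_of_set _|); apply/setP=> e; rewrite in_set in_setI.
have N1 : #|N| != 1 by apply: signature_flow.
pose K := ~: N.
have conK x y : connect (adj K) x y.
  apply: contraT => nc; have Y0 : cc K x != set0 by apply/set0Pn; exists x; rewrite inE connect0.
  have YT : cc K x != setT.
    by apply: contraNneq nc => h; have : y \in cc K x; [rewrite h inE | rewrite inE].
  have c2 := tec Y0 YT; have := Ncut (cc K x).
  rewrite (_ : N :&: _ = cut (cc K x)); first by move: c2; move: #|_| => k; clear; lia.
  apply/setIidPr/subsetP=> e ec; apply: contraT => eN.
  have := cut_cc K x => /setP/(_ e); rewrite in_setI in_set0 ec andbT.
  by rewrite in_setC eN.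
have [|Y Y0 YT|C [D1 [D2 [[eC e1 e2] cvU dU C3]]]] := @even_triple G N.
- exact: ltnW.
- apply/negP=> s; have := Ncut Y; rewrite (setIidPr s).
  by have := tec Y0 YT; move: #|_| => k; clear; lia.
set U := C :|: (D1 :|: D2) in cvU dU.
(* the bridges of G - N *)
pose Br := ~: (U :|: N).
have cards : #|U| + (#|N| + #|Br|) = #|E|.
  have := cardsC (U :|: N); rewrite cardsU (disjoint_setI0 dU) cards0 subn0 -/Br.
  by move: #|U| #|N| #|Br| #|E| => k1 k2 k3 k4; clear; lia.
have sUK : U \subset K by rewrite -disjoints_subset.
pose TN := [set v | odeg N v].
have oTN : ~~ odd #|TN|.
  have h := handshake N setT; rewrite [RHS]xsumF in h; last by move=> e _; rewrite /= !inE.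
  move: h; rewrite xsum_odd (_ : [set _ in _ | _] = TN) => [->//|].
  by apply/setP=> v; rewrite !inE.
have [J [sJ hJ minJ]] := min_join conK oTN.
have dNJ : [disjoint N & J] by rewrite disjoint_sym disjoints_subset.
pose S := N :|: J.
have eS : evenset S by move=> v; rewrite /S -symd_disj // odeg_symd hJ inE addbb.
have sBr : Br \subset S.
  apply/subsetP=> e; rewrite in_setC in_setU negb_or => /andP[eU eN].
  have [Y cY] : exists Y, cut Y :\: N = [set e].
    case: (pickP (fun Y => cut Y :\: N == [set e])) => [Y /eqP cY|none]; first by exists Y.
    by case/negP: eU; apply: cvU => // Y; rewrite none.
  have eY : e \in cut Y by have : e \in cut Y :\: N; [rewrite cY set11 | rewrite inE => /andP[]].
  have Y0 : Y != set0 by apply: contraTneq eY => ->; rewrite !inE.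
  have YT : Y != setT by apply: contraTneq eY => ->; rewrite !inE.
  (* All edges of this cut but [e] lie in [N]; at most half of them may, and there are at least two
     edges. *)
  have c1 : #|N :&: cut Y| = 1.
    have := tec Y0 YT; have := Ncut Y; rewrite setIC.
    have := cardsID N (cut Y); rewrite cY cards1.
    by move: #|_| #|_| => k1 k2; clear; lia.
  apply: contraT => eS'; have := even_cut Y eS.
  rewrite (_ : S :&: cut Y = N :&: cut Y) ?c1 //; apply/setP=> g; rewrite !in_setI in_setU.
  case gN: (g \in N) => //=; apply/negP=> /andP[gJ gY].
  have : g \in cut Y :\: N by rewrite in_setD gN.
  by rewrite cY in_set1 => /eqP ge; move: eS'; rewrite -ge in_setU gJ orbT.
(* [J] contains at most half of [U] and otherwise only bridges of G - N. *)
have L : 2 * #|S| <= #|E| + (#|N| + #|Br|).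
  have hj : 2 * #|J :&: U| <= #|U|.
    by apply: (half_join eC e1 e2) => Z eZ sZ; apply: minJ => //; apply: subset_trans sUK.
  have : #|J| <= #|J :&: U| + #|Br|.
    rewrite -(cardsID U J) leq_add2l subset_leq_card //; apply/subsetP=> e.
    rewrite in_setD => /andP[eU /(subsetP sJ)]; rewrite in_setC => eN.
    by rewrite in_setC in_setU negb_or eU.
  have : #|S| = #|N| + #|J| by rewrite cardsU (disjoint_setI0 dNJ) cards0 subn0.
  move: cards hj; move: #|S| #|N| #|J| #|J :&: U| #|U| #|Br| #|E| => k1 k2 k3 k4 k5 k6 k7.
  by clear; lia.
have [cU hU leU] : exists2 c, cov sigma U c & 3 * c <= 5 * #|U|.
  have [A1 [A2 [A3 [[a1 a2 a3] UA le]]]] := short_even_cover eC e1 e2 C3.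
  have cA A : evenset A -> A \subset U -> cov sigma A #|A|.
    move=> eA sA; apply: (cov_even cub eA) => x _.
    rewrite negN; last exact: even_ecomp.
    rewrite (_ : _ :&: _ = set0) ?cards0 //; apply/disjoint_setI0.
    by apply: disjointWl dU; apply: subset_trans (ecomp_sub _ _) sA.
  exists (#|A1| + #|A2| + #|A3|); last exact: le.
  rewrite /U -UA; apply: covU; first apply: covU; apply: cA => //; rewrite /U -UA.
  - by rewrite -setUA subsetUl.
  - by rewrite setUAC subsetUr.
  by rewrite subsetUr.
have [cS hS leS] : exists2 c, cov sigma S c & 6 * c <= 11 * #|V| + 10 * (#|N| + #|Br|).
  have sp := split_card S; have E2 := card_edges cub.
  have nT := reps_negreps S; have pc := pos_part_cov eS.
  set T := neg_reps S in sp nT; set P := pos_part S in sp pc.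
  case: (boolP (odd #|T|)) => oT; last first.
    have [J' [hJ' lJ']] := half_tjoin tec oT.
    have cv := covU pc (pair_cover cub eS nT hJ').
    exists (#|P| + (\sum_(t in T) #|ecomp S t| + #|J'|)).
      by apply: cov_sub cv; rewrite ?split_cover.
    move: sp L E2 lJ'; move: #|P| (\sum_(_ in _) _) #|J'| #|S| #|V| #|E| (#|N| + #|Br|).
    by move=> k1 k2 k3 k4 k5 k6 k7; clear; lia.
  (* A negative cycle meets [N], and [N] is not a single edge; this absorbs the additive constants
     of the odd cases. *)
  have N2 : 1 < #|N|.
    have [t tT] : exists t, t \in T by apply/card_gt0P; case: #|T| oT.
    have [tS nt] := nT.1 t tT; rewrite negN in nt; last exact: even_ecomp.
    have : 0 < #|ecomp S t :&: N| by case: #|_| nt.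
    have : #|ecomp S t :&: N| <= #|N| by rewrite subset_leq_card // subsetIr.
    by move: N1; move: #|N| #|_| => k1 k2; clear; lia.
  case: (ltnP 2 #|T|) => T3.
    have cv := covU pc (odd_cover cub tec eS nT oT T3).
    exists (#|P| + (\sum_(t in T) #|ecomp S t| + #|E| %/ 2 + (#|V| %/ 3 + 2))).
      by apply: cov_sub cv; rewrite ?split_cover.
    move: sp L E2 N2; move: #|P| (\sum_(_ in _) _) #|S| #|V| #|E| #|N| #|Br|.
    by move=> k1 k2 k3 k4 k5 k6 k7; clear; lia.
  have /cards1P[t Tt] : #|T| == 1 by case: #|T| oT T3 => [|[|[|k]]].
  have [tS nt] : t \in vs S /\ neg sigma (ecomp S t) by apply: nT.1; rewrite Tt set11.
  set D := ecomp S t in nt; have cD : edge_cycle D := ecomp_cycle eS tS.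
  have sc := split_cover S; rewrite -/T Tt big_set1 -/D -/P in sc.
  rewrite Tt big_set1 -/D in sp.
  have PD : P \subset ~: D.
    apply/subsetP=> e eP; rewrite in_setC; apply/negP=> eD.
    have eS' := subsetP (pos_part_sub S) e eP.
    move: eP; rewrite in_set eS' /= => /negP[].
    by move: eD; rewrite (mem_ecomp t false eS') => /ecomp_eq <-.
  (* A positive cycle of [S] meets [N], since otherwise removing it from [J] would give a smaller
     join; hence it contains two edges of [N]. They share no vertex, because a cut of at most three
     edges contains at most one edge of [N]. *)
  have R4 x : x \in vs P -> 4 <= #|ecomp P x|.
    move=> xP; have [-> pR] := pos_part_comp eS xP.
    have xS := subsetP (vs_sub (pos_part_sub S)) x xP.
    have [eR R0 _] := ecomp_cycle eS xS; have sRS := ecomp_sub S x.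
    set R := ecomp S x in pR eR R0 sRS *.
    have RN : R :&: N != set0.
      apply: contraTneq isT => RN; have RJ : R \subset J.
        apply/subsetP=> e eR'; have /setUP[eN|//] := subsetP sRS e eR'.
        by have : e \in R :&: N; [rewrite inE eR' | rewrite RN inE].
      have := minJ R eR (subset_trans RJ sJ); rewrite symd_setD // -(cardsID R J) (setIidPr RJ).
      by have := R0; rewrite -card_gt0; move: #|R| #|_| => k1 k2; clear; lia.
    have [f1 f1R] := set0Pn _ RN.
    have [f2 f2R] : exists f2, f2 \in (R :&: N) :\ f1.
      apply/card_gt0P; move: pR; rewrite negN // (cardsD1 f1) f1R.
      by case: #|_ :\ _|.
    move: f1R f2R; rewrite in_setD1 !in_setI => /andP[f1R f1N] /and3P[n12 f2R f2N].
    have matching b1 b2 : endpoint f1 b1 != endpoint f2 b2.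
      apply/eqP=> h; set v := endpoint f1 b1 in h.
      have inc_cut f b : endpoint f b = v -> f \in cut [set v].
        have := noloop f; rewrite !inE; case: b => nl hb.
          by rewrite hb eqxx; move: nl; rewrite hb => /negPf->.
        by rewrite hb eqxx; move: nl; rewrite hb eq_sym => /negPf->.
      have c2 : 2 <= #|N :&: cut [set v]|.
        have : #|[set f1; f2]| <= #|N :&: cut [set v]|.
          apply: subset_leq_card; rewrite subUset !sub1set !in_setI f1N f2N.
          by rewrite (inc_cut f1 b1) // (inc_cut f2 b2).
        by rewrite cards2 eq_sym n12.
      have c3 : #|cut [set v]| <= 3.
        rewrite -(hdegT cub v) (leq_trans _ (hdeg_sub v (subsetT (cut [set v])))) //.
        rewrite hdegE -sum1_card; apply: leq_sum => f; rewrite !inE.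
        by case: (_ == v); case: (_ == v).
      by move: (Ncut [set v]) c2 c3; move: #|_| #|_| => k1 k2; clear; lia.
    rewrite -(card_vs cub eR).
    pose W := [:: endpoint f1 false; endpoint f1 true; endpoint f2 false; endpoint f2 true].
    have uW : uniq W by rewrite /= !inE !negb_or !matching !noloop.
    rewrite -[4]/(size W) -(card_uniqP uW); apply: subset_leq_card.
    by apply/subsetP=> z; rewrite !in_cons in_nil orbF => /or4P[] /eqP->; apply: vs_end.
  have far (g : V -> bool) e0 : exists2 e, e != e0 &
      sigma e != g (endpoint e false) (+) g (endpoint e true).
    case: (pickP (fun e => (e != e0) && (sigma e != g (endpoint e false) (+) g (endpoint e true))))
      => [e /andP[n1 n2]|none]; first by exists e.
    have : #|symd N0 (cut [set v | g v])| <= 1.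
      rewrite -(cards1 e0) subset_leq_card //; apply/subsetP=> e; rewrite in_symd in_set1 !inE.
      by have := none e; case: (e == e0) => //= /negbFE/eqP->; rewrite addbb.
    have := minX [set v | g v] isT; rewrite -/N.
    by move: N2; move: #|N| #|_| => k1 k2; clear; lia.
  have [c hc le] := single_cover cD nt (pos_part_even eS) PD R4 far.
  have d0 : 0 < #|D| by rewrite card_gt0; case: cD.
  exists (#|P| + c); first exact: cov_sub (covU pc hc).
  case: le; move: sp L E2 N2 d0; move: #|P| #|D| #|S| #|V| #|E| #|N| #|Br|;
    move=> k1 k2 k3 k4 k5 k6 k7; clear; lia.
exists (cU + cS).
  apply: cov_sub (covU hU hS) => //; apply/subsetP=> e _.
  rewrite in_setU; case eU: (e \in U) => //=; case eN: (e \in N).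
    by rewrite in_setU eN.
  by apply: (subsetP sBr); rewrite in_setC in_setU eU eN.
move: leU leS cards (card_edges cub); move: #|U| #|V| #|E| (#|N| + #|Br|) => k1 k2 k3 k4.
by clear; lia.
Qed.

End Assembly.

(** * Cuts of 2-edge-connected graphs and existence of the minimum *)

Section Final.
Variable G : graph.

Lemma conn_cross (A : {set edge G}) (X : {set vertex G}) x y :
  connect (adj A) x y -> x \in X -> y \notin X -> exists2 e, e \in A & e \in cut X.
Proof.
case/conn_walk=> p [w s <-]; elim: p x w s => [|[e z] p IH] x /=.
  by move=> _ _ xX; rewrite /wend /= xX.
case/andP=> j w s xX nX; case zX: (z \in X).
  by apply: (IH z) => // f fp; apply: s; rewrite inE fp orbT.
by exists e; [apply: s; rewrite mem_head | rewrite (joins_cut _ j) xX zX].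
Qed.

Lemma two_edge_cuts : two_edge_connected G ->
  forall X : {set vertex G}, X != set0 -> X != setT -> 1 < #|cut X|.
Proof.
case=> _ [_ c0] c1 X X0 XT; have [x xX] := set0Pn _ X0.
have [y yX] : exists y, y \notin X.
  by apply/existsP; rewrite -negb_forall; apply: contra XT => /forallP h; apply/eqP/setP=> y; rewrite h inE.
have [e _ eX] := @conn_cross setT X x y (c0 x y (in_setT _) (in_setT _)) xX yX.
have [f fe fX] := @conn_cross [set~ e] X x y ((c1 e).2 x y (in_setT _) (in_setT _)) xX yX.
have : #|[set e; f]| <= #|cut X| by apply: subset_leq_card; rewrite subUset !sub1set eX.
by move: fe; rewrite !inE cards2 eq_sym => ->.
Qed.

(** The minimum is reached by descent on the length of a cover; [classic] decides whether a shorter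
    cover exists. *)
Lemma scc_le (sigma : signature G) n : cov sigma setT n ->
  exists m, is_scc sigma m /\ m <= n.
Proof.
case=> F [hF cF lF].
pose Fam (i : 'I_(size F)) := subgraph_of (nth set0 F i).
have cc0 : circuit_cover sigma Fam.
  split=> [i|]; first by apply: hF; apply: mem_nth.
  apply/setP=> e; rewrite [RHS]inE; apply/bigcupP.
  have [A AF eA] := cF e (in_setT e); have iA : index A F < size F by rewrite index_mem.
  by exists (Ordinal iA); rewrite //= nth_index.
have l0 : family_length Fam <= n.
  by apply: leq_trans lF; rewrite /family_length (big_nth set0) big_mkord.
suff : forall k (F : 'I_k -> subgraph G), circuit_cover sigma F -> family_length F <= n ->
    exists m, is_scc sigma m /\ m <= n by apply; [exact: cc0 | exact: l0].
have [l] := ubnP n; elim: l n {F hF cF lF Fam cc0 l0} => // l IH n lt k F cF lF.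
case: (classic (exists k' (F' : 'I_k' -> subgraph G),
    circuit_cover sigma F' /\ family_length F' < family_length F)).
  case=> k' [F' [cF' lt']].
  have ltF : family_length F' < n := leq_trans lt' lF.
  have [m [hm lm]] := IH _ (leq_trans ltF lt) k' F' cF' (leqnn _).
  by exists m; split=> //; apply: leq_trans lm (ltnW ltF).
move=> none; exists (family_length F); split=> //; split; first by exists k, F.
move=> k' F' cF'; rewrite leqNgt; apply/negP=> lt'; apply: none.
by exists k', F'.
Qed.

End Final.

Theorem theorem1p6 (G : graph) (sigma : signature G) :
  two_edge_connected G -> cubic G -> flow_admissible sigma ->
  exists n : nat, is_scc sigma n /\
    (n%:R <= 26%:R / 9%:R * #|edge G|%:R :> rat)%R.
Proof.
move=> tec cub fa; have [V1 _ _] := tec.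
have [n cn ln] := short_circuit_cover cub (two_edge_cuts tec) V1 fa.
have [m [hm lm]] := scc_le cn; exists m; split=> //.
have le : 9 * m <= 26 * #|edge G|.
  by have := card_edges cub; move: ln lm; move: #|edge G| #|vertex G| => k1 k2; clear; lia.
have : ((9 * m)%:R <= (26 * #|edge G|)%:R :> rat)%R by rewrite ler_nat.
rewrite !natrM; lra.
Qed.
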